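(* There exist absolute constants $C, c > 0$ such that the following holds. Let $0<s<d$, $0<\nu\le L$ with $\nu/(2L)\le 0.5$, let $f\in\mathcal{F}_{L,\nu,d}\cap CG_{s,d}$, and let $\mathcal{C}_f(\cdot,\cdot)$ be a polynomial comparison oracle for $f$ with $\kappa=1$ and $0<\delta_0<\mu\le 0.5$. Let $\varepsilon>0$, $\mathbf{x}_0\in\mathbb{R}^d$, $0<\eta<\nu/(2L)$, $\Delta_0=\|\mathbf{x}_0-\mathrm{P}_\star(\mathbf{x}_0)\|_2$, $\rho^\star=\dfrac{1-\eta^2}{\frac{\nu}{2L}-\eta}$, and take the fixed step size $$\alpha_k=\alpha=(1+\rho^\star)^{-1}\sqrt{2\varepsilon/L}.$$ Choose $$K=\frac{(\Delta_0-\alpha\eta)^3}{(\alpha\rho^\star)^2\left(\frac{\alpha\nu}{2L}-\alpha\eta\right)},\qquad m=\frac{C}{\eta^4\delta_0^2}\,s\log(2d/s),\qquad r=\frac{\alpha\nu\rho^\star}{2L\sqrt d},$$ where $m$ and $K$ are rounded up to integers (and $K=0$ if the expression is negative). Let $\mathbf{x}_1,\mathbf{x}_2,\dots$ be the iterates produced by SCOBO with inputs $\mathbf{x}_0,s,m,r,K$. Then with probability at least $1-8K\exp\left(-c\eta^4s\log(2d/s)\right)$, for all $0\le k\le K-1$ either $f(\mathbf{x}_{k+1})\le f(\mathbf{x}_k)$ or $f(\mathbf{x}_k)-f^\star\le\varepsilon$.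
   Context: Function classes. $CG_{s,d}$ is the set of all (differentiable) $f:\mathbb{R}^d\to\mathbb{R}$ with $\|\nabla f(\mathbf{x})\|_1\le\sqrt{s}\,\|\nabla f(\mathbf{x})\|_2$ for all $\mathbf{x}\in\mathbb{R}^d$. For $0<\nu\le L$, $\mathcal{F}_{L,\nu,d}$ is the set of all $f:\mathbb{R}^d\to\mathbb{R}$ that are twice continuously differentiable, convex, $L$-Lipschitz differentiable ($\|\nabla f(\mathbf{x})-\nabla f(\mathbf{y})\|_2\le L\|\mathbf{x}-\mathbf{y}\|_2$ for all $\mathbf{x},\mathbf{y}$), and $\nu$-restricted-strongly convex: $f(\mathbf{x})-f^\star\ge\frac{\nu}{2}\|\mathbf{x}-\mathrm{P}_\star(\mathbf{x})\|_2^2$ for all $\mathbf{x}\in\mathbb{R}^d$. Here $f^\star=\min_{\mathbf{x}\in\mathbb{R}^d}f(\mathbf{x})$ (assumed attained), $\mathcal{X}=\arg\min f$ is the (nonempty, closed, convex) solution set, and $\mathrm{P}_\star(\mathbf{x})=\arg\min_{\mathbf{z}\in\mathcal{X}}\|\mathbf{x}-\mathbf{z}\|_2$ is the projection onto it. Oracle. A polynomial comparison oracle for $f$ with parameters $0<\delta_0\le 1/2$, $\mu>0$, $\kappa\ge1$ returns, for each query $(\mathbf{x},\mathbf{y})$, a random value $\mathcal{C}_f(\mathbf{x},\mathbf{y})\in\{-1,+1\}$ with $$\mathbb{P}\left[\mathcal{C}_f(\mathbf{x},\mathbf{y})=\mathrm{sign}(f(\mathbf{y})-f(\mathbf{x}))\right]\ge\tfrac12+\min\{\delta_0,\mu|f(\mathbf{y})-f(\mathbf{x})|^{\kappa-1}\}.$$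 Signs are regarded as taking values in $\{-1,+1\}$ (with a fixed convention for $\mathrm{sign}(0)$). For $\kappa=1$ and $\delta_0<\mu$ this lower bound is $\frac12+\delta_0$, and the oracle is understood to be correct with a constant probability not depending on the points queried. The randomness of the oracle is independent across queries and independent of all other random choices. Algorithm 1BitGradEst$(\mathbf{x},s,m,r)$. Draw $\mathbf{z}_1,\dots,\mathbf{z}_m$ independently and uniformly from the unit sphere $\mathbb{S}^{d-1}\subset\mathbb{R}^d$; query $y_i=\mathcal{C}_f(\mathbf{x},\mathbf{x}+r\mathbf{z}_i)$ for $i=1,\dots,m$; output $$\hat{\mathbf{g}}\in\arg\max\Big\{\sum_{i=1}^m y_i\mathbf{z}_i^\top\mathbf{g}' : \|\mathbf{g}'\|_1\le\sqrt{s},\ \|\mathbf{g}'\|_2\le1\Big\}.$$ Algorithm SCOBO (inputs $\mathbf{x}_0,s,m,r,K$ and step sizes $\alpha_k$). For $k=0,\dots,K-1$: set $\hat{\mathbf{g}}_k=$ 1BitGradEst$(\mathbf{x}_k,s,m,r)$ (with fresh independent randomness) and $\mathbf{x}_{k+1}=\mathbf{x}_k-\alpha_k\hat{\mathbf{g}}_k$. Output $\mathbf{x}_K$. *)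

(* Defs.v *)
From HB Require Import structures.
From mathcomp Require Import all_boot all_order all_algebra.
From mathcomp Require Import all_classical all_reals all_analysis.

Set Implicit Arguments.
Unset Strict Implicit.
Unset Printing Implicit Defensive.

Import Order.TTheory GRing.Theory Num.Theory.
Import numFieldNormedType.Exports.

Local Open Scope classical_set_scope.
Local Open Scope ring_scope.

(* The library norm on 'rV[R]_d is the sup norm; it is used only for the
   topology and for differentiability, which do not depend on the norm. *)
Section euclidean.
Variables (R : realType) (d : nat).
Implicit Types x y : 'rV[R]_d.

Definition dotp x y : R := \sum_(i < d) x 0 i * y 0 i.
Definition l1norm x : R := \sum_(i < d) `|x 0 i|.
Definition l2norm x : R := Num.sqrt (\sum_(i < d) x 0 i ^+ 2).

Definition borel_rV := g_sigma_algebraType (@open 'rV[R]_d).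

End euclidean.

Section function_classes.
Variables (R : realType) (d : nat).
Implicit Types (f : 'rV[R]_d -> R) (x y p : 'rV[R]_d).

Definition partial f (i : 'I_d) : 'rV[R]_d -> R := 'D_(delta_mx 0 i) f.

Definition grad f x : 'rV[R]_d := \row_i partial f i x.

Definition CG (s : R) f : Prop :=
  (forall x, differentiable f x) /\
  (forall x, l1norm (grad f x) <= Num.sqrt s * l2norm (grad f x)).

Definition twice_continuously_differentiable f : Prop :=
  [/\ forall x, differentiable f x,
      forall i x, differentiable (partial f i) x &
      forall i j, continuous (partial (partial f i) j)].

Definition lipschitz_differentiable (L : R) f : Prop :=
  (forall x, differentiable f x) /\
  (forall x y, l2norm (grad f x - grad f y) <= L * l2norm (x - y)).

Definition argmin f : set 'rV[R]_d := [set x | forall y, f x <= f y].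

(* This is the minimum of f as soon as argmin f is nonempty. *)
Definition fstar f : R := inf (range f).

Definition is_proj (A : set 'rV[R]_d) x p : Prop :=
  A p /\ forall z, A z -> l2norm (x - p) <= l2norm (x - z).

(* When f is convex, continuous and attains its minimum, argmin f is nonempty,
   closed and convex, hence there is exactly one p with
   is_proj (argmin f) x p, and the default value 0 is not used. *)
Definition Pstar f x : 'rV[R]_d := xget 0 [set p | is_proj (argmin f) x p].

Definition restricted_strongly_convex (nu : R) f : Prop :=
  forall x, nu / 2 * l2norm (x - Pstar f x) ^+ 2 <= f x - fstar f.

Definition Fclass (L nu : R) f : Prop :=
  [/\ twice_continuously_differentiable f,
      convex_function (E := 'rV[R]_d) [set: 'rV[R]_d] f,
      lipschitz_differentiable L f,
      argmin f !=set0 &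
      restricted_strongly_convex nu f].

End function_classes.

Section probability.
Variable R : realType.

Definition sigma_of dO (Omega : measurableType dO) dT (T : measurableType dT)
  (X : Omega -> T) : set (set Omega) :=
  preimage_set_system [set: Omega] X measurable.

Definition mutually_independent dO (Omega : measurableType dO)
    (P : probability Omega R) (I : finType) (G : I -> set (set Omega)) : Prop :=
  forall (J : {set I}) (A : I -> set Omega),
    (forall i, i \in J -> G i (A i)) ->
    fine (P (\bigcap_(i in [set` J]) A i))
      = \prod_(i in J) fine (P (A i)).

(* The uniform distribution on the unit sphere is the only Borel probability
   measure carried by the sphere that is invariant under the orthogonal
   group. *)
Definition uniform_on_sphere (d : nat) (mu : set (borel_rV R d) -> \bar R) :=
  mu [set z | l2norm z = 1] = 1%E /\
  forall U : 'M[R]_d, U *m U^T = 1%:M ->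
    forall A : set (borel_rV R d), measurable A ->
      mu [set z | A (z *m U)] = mu A.

End probability.

Section oracle.
Variables (R : realType) (d : nat).

(* Sign with values in {-1, 1}; the boolean sg0 fixes the sign of 0. *)
Definition sgnpm (sg0 : bool) (t : R) : R :=
  if 0 < t then 1 else if t < 0 then -1 else (-1) ^+ sg0.

Variables (dX : measure_display) (Xi : measurableType dX).

(* The random answer to the query (x, y) is orc x y u, where u is a noise
   variable of law Q. *)
Definition correct_answer (sg0 : bool) (f : 'rV[R]_d -> R)
    (orc : 'rV[R]_d -> 'rV[R]_d -> Xi -> R) (x y : 'rV[R]_d) : set Xi :=
  [set u | orc x y u = sgnpm sg0 (f y - f x)].

Definition polynomial_comparison_oracle (sg0 : bool) (Q : probability Xi R)
    (orc : 'rV[R]_d -> 'rV[R]_d -> Xi -> R)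
    (f : 'rV[R]_d -> R) (delta0 mu kappa : R) : Prop :=
  [/\ [/\ 0 < delta0, delta0 <= 1 / 2, 0 < mu & 1 <= kappa],
      measurable_fun [set: borel_rV R d * borel_rV R d * Xi]
        (fun q : borel_rV R d * borel_rV R d * Xi => orc q.1.1 q.1.2 q.2),
      forall x y u, orc x y u = -1 \/ orc x y u = 1 &
      forall x y,
        ((1 / 2 + Num.min delta0 (mu * `|f y - f x| `^ (kappa - 1)))%:E
          <= Q (correct_answer sg0 f orc x y))%E].

Definition constant_correctness (sg0 : bool) (Q : probability Xi R)
    (orc : 'rV[R]_d -> 'rV[R]_d -> Xi -> R) (f : 'rV[R]_d -> R) : Prop :=
  exists p : R, forall x y, Q (correct_answer sg0 f orc x y) = p%:E.

End oracle.

Section algorithms.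
Variables (R : realType) (d : nat).

(* g is a possible output of 1BitGradEst for sampled directions z and oracle
   answers y. *)
Definition is_1bit_grad_est (s : R) (m : nat) (z : 'I_m -> 'rV[R]_d)
    (y : 'I_m -> R) (g : 'rV[R]_d) : Prop :=
  let feasible := [set g' | l1norm g' <= Num.sqrt s /\ l2norm g' <= 1] in
  feasible g /\
  forall g', feasible g' ->
    \sum_(i < m) y i * dotp (z i) g' <= \sum_(i < m) y i * dotp (z i) g.

Variables (dO : measure_display) (Omega : measurableType dO).
Variables (dX : measure_display) (Xi : measurableType dX).

Definition history (m : nat) (z : nat -> 'I_m -> Omega -> 'rV[R]_d)
    (xi : nat -> 'I_m -> Omega -> Xi) (g : nat -> Omega -> 'rV[R]_d)
    (k : nat) : set (set Omega) :=
  <<s [set A | exists2 j, (j < k)%N &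
        [\/ exists i, sigma_of (z j i : Omega -> borel_rV R d) A,
            exists i, sigma_of (xi j i) A |
            sigma_of (g j : Omega -> borel_rV R d) A]] >>.

(* x k is the k-th iterate; g k, z k i and xi k i are the output, the i-th
   direction and the noise of the i-th oracle query of the k-th call to
   1BitGradEst.  Any measurable choice, even a randomized one, is allowed for
   the maximizer g k, provided the draws of the later calls are independent
   of it. *)
Record SCOBO_run (P : probability Omega R) (Q : probability Xi R)
    (orc : 'rV[R]_d -> 'rV[R]_d -> Xi -> R)
    (x0 : 'rV[R]_d) (s : R) (m : nat) (r : R) (K : nat) (alpha : nat -> R)
    (z : nat -> 'I_m -> Omega -> 'rV[R]_d) (xi : nat -> 'I_m -> Omega -> Xi)
    (g x : nat -> Omega -> 'rV[R]_d) : Prop := {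
  run_measurable_z : forall k i, (k < K)%N ->
    measurable_fun [set: Omega] (z k i : Omega -> borel_rV R d);
  run_measurable_xi : forall k i, (k < K)%N ->
    measurable_fun [set: Omega] (xi k i);
  run_measurable_g : forall k, (k < K)%N ->
    measurable_fun [set: Omega] (g k : Omega -> borel_rV R d);
  run_law_z : forall k i, (k < K)%N ->
    uniform_on_sphere (pushforward P (z k i : Omega -> borel_rV R d));
  run_law_xi : forall k i, (k < K)%N ->
    forall B : set Xi, measurable B -> pushforward P (xi k i) B = Q B;
  run_independent : forall k, (k < K)%N ->
    mutually_independent P (fun o : option ('I_m + 'I_m) =>
      match o with
      | None => history z xi g k
      | Some (inl i) => sigma_of (z k i : Omega -> borel_rV R d)
      | Some (inr i) => sigma_of (xi k i)
      end);
  run_init : forall w, x 0%N w = x0;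
  run_grad_est : forall k w, (k < K)%N ->
    is_1bit_grad_est s (fun i => z k i w)
      (fun i => orc (x k w) (x k w + r *: z k i w) (xi k i w)) (g k w);
  run_step : forall k w, (k < K)%N -> x k.+1 w = x k w - alpha k *: g k w }.

End algorithms.

(* Rounding up to a natural number, with value 0 on negative numbers. *)
Definition natceil (R : realType) (t : R) : nat :=
  absz (Num.ceil (Num.max t 0)).

(* Main.v *)
Require Import Defs.
From HB Require Import structures.
From mathcomp Require Import all_boot all_order all_algebra.
From mathcomp Require Import all_classical all_reals all_analysis.
From mathcomp Require Import measurable_realfun.
From mathcomp Require Import ring lra.

Set Implicit Arguments.
Unset Strict Implicit.
Unset Printing Implicit Defensive.

Import Order.TTheory GRing.Theory Num.Theory.
Import numFieldNormedType.Exports.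

Local Open Scope classical_set_scope.
Local Open Scope ring_scope.

(** Write [Lam = s * ln (2 d / s)].  The constants are [C = 30^4] and [c = 1], and
    each iteration fails with probability at most [exp (- Lam)]; a union bound
    over the [K] iterations then gives the claim ([union_bound]).

    Deterministic part.  At a point [x] with [f x - fstar f > eps], cocoercivity
    of the gradient and restricted strong convexity bound the norm [G] of the
    gradient from below by [3 / 4 * nu * sqrt (2 eps / L)] ([grad_lower_bound]).
    The step size and the sampling radius are so small that [L alpha] and
    [sqrt d * L * r] are at most [2 / 3 * G].  Hence, by the descent lemma, a step
    along [- g] does not increase [f] as soon as [g] has length at most one and
    [dotp v g >= 1 / 3], where [v] is the direction of the gradient
    ([step_decreases]).  It remains to see that the estimate has this correlation
    with [v].

    Expectation.  For a direction [z] on the sphere, convexity and smoothness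
    show that [f (x + r z) - f x] has the sign of [dotp z v], unless
    [sqrt d * dotp z v] lies between [- 1 / 3] and [0] ([sign_pos],
    [sign_neg]).  The second and fourth moments of the uniform law,
    and a symmetry argument for the slab where the sign is unknown, give
    [E (sign * sqrt d * dotp z (v - g)) >= 1 / 30] whenever [g] has length at most
    one and [dotp v g <= 1 / 3] ([expect_sign_correlation]).  The oracle noise,
    being independent of the direction and correct with constant probability
    [p >= 1 / 2 + delta0], multiplies this expectation by [2 p - 1]
    ([expect_answer_dotp]).  So in the mean [v] beats a misaligned [g] in the
    objective of the estimator by a margin of order [delta0].

    Fluctuations.  They have to be controlled for all feasible [g] at once.
    Centred and scaled, the sum of the signed directions is a random vector [h]
    with [E (exp (dotp h theta)) <= exp (dotp theta theta / 2)] for every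
    [theta] ([expect_exp_deviation]).  On the feasible set [dotp h g] is at most
    [2 (sqrt (T s) + sqrt B)] when the truncated squares [max (0, h_j^2 / 4 - T)]
    of the coordinates of [h] add up to at most [B] ([norm_dotp_excess]).  With
    the threshold [T = 1 / 4 + ln (d / s)] the product [T s] is at most [Lam], and
    the sum of the truncated squares exceeds [17 Lam] with probability at most
    [exp (- Lam)]: its exponential is dominated by a product of sums of
    exponentials, which can be integrated term by term although the coordinates
    of [h] are dependent ([deviation_tail]).  When [m * delta0^2 >= 30^4 * Lam]
    the fluctuations are smaller than the margin, and the maximizer cannot be
    misaligned ([bad_estimate_excess], [good_estimate]).

    The restriction [s >= 1] used along the way holds unless all gradients
    vanish, in which case [f] is constant. *)


(** * Euclidean geometry of row vectors *)

Section euclidean_geometry.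
Variables (R : realType) (d : nat).
Implicit Types (x y z : 'rV[R]_d) (a : R).

Lemma dotpC x y : dotp x y = dotp y x.
Proof. by apply: eq_bigr => i _; rewrite mulrC. Qed.

Lemma dotpDl x y z : dotp (x + y) z = dotp x z + dotp y z.
Proof. by rewrite -big_split; apply: eq_bigr => i _; rewrite mxE mulrDl. Qed.

Lemma dotpZl a x y : dotp (a *: x) y = a * dotp x y.
Proof. by rewrite mulr_sumr; apply: eq_bigr => i _; rewrite mxE mulrA. Qed.

Lemma dotpNl x y : dotp (- x) y = - dotp x y.
Proof. by rewrite -scaleN1r dotpZl mulN1r. Qed.

Lemma dotpBl x y z : dotp (x - y) z = dotp x z - dotp y z.
Proof. by rewrite dotpDl dotpNl. Qed.

Lemma dotpDr x y z : dotp x (y + z) = dotp x y + dotp x z.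
Proof. by rewrite dotpC dotpDl !(dotpC x). Qed.

Lemma dotpZr a x y : dotp x (a *: y) = a * dotp x y.
Proof. by rewrite dotpC dotpZl dotpC. Qed.

Lemma dotpNr x y : dotp x (- y) = - dotp x y.
Proof. by rewrite dotpC dotpNl dotpC. Qed.

Lemma dotpBr x y z : dotp x (y - z) = dotp x y - dotp x z.
Proof. by rewrite dotpDr dotpNr. Qed.

Lemma dotp0l x : dotp 0 x = 0.
Proof. by rewrite -(scale0r x) dotpZl mul0r. Qed.

Lemma dotp0r x : dotp x 0 = 0.
Proof. by rewrite dotpC dotp0l. Qed.

Definition dotpE := (dotpDl, dotpDr, dotpBl, dotpBr, dotpNl, dotpNr, dotpZl,
  dotpZr, dotp0l, dotp0r).

Lemma dotp_ge0 x : 0 <= dotp x x.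
Proof. by apply: sumr_ge0 => i _; rewrite -expr2 sqr_ge0. Qed.

Lemma l2normE x : l2norm x = Num.sqrt (dotp x x).
Proof. by congr Num.sqrt; apply: eq_bigr => i _; rewrite expr2. Qed.

Lemma l2norm_ge0 x : 0 <= l2norm x.
Proof. exact: sqrtr_ge0. Qed.

Lemma sqr_l2norm x : l2norm x ^+ 2 = dotp x x.
Proof. by rewrite l2normE sqr_sqrtr // dotp_ge0. Qed.

Lemma dotp_eq0 x : dotp x x = 0 -> x = 0.
Proof.
move=> /eqP; rewrite psumr_eq0 => [/allP x0|i _]; last first.
  by rewrite -expr2 sqr_ge0.
apply/rowP => i; rewrite mxE.
by have := x0 i (mem_index_enum i); rewrite mulf_eq0 orbb => /eqP.
Qed.

Lemma l2norm_eq0 x : l2norm x = 0 -> x = 0.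
Proof. by move=> x0; apply: dotp_eq0; rewrite -sqr_l2norm x0 expr0n. Qed.

Lemma l2normZ a x : l2norm (a *: x) = `|a| * l2norm x.
Proof.
by rewrite !l2normE !dotpE mulrA -expr2 sqrtrM ?sqr_ge0 // sqrtr_sqr.
Qed.

Lemma l1normZ a x : l1norm (a *: x) = `|a| * l1norm x.
Proof. by rewrite mulr_sumr; apply: eq_bigr => i _; rewrite mxE normrM. Qed.

Lemma l2normN x : l2norm (- x) = l2norm x.
Proof. by rewrite -scaleN1r l2normZ normrN1 mul1r. Qed.

Lemma sqr_dotp_le x y : dotp x y ^+ 2 <= dotp x x * dotp y y.
Proof.
have [/dotp_eq0 ->|y0] := eqVneq (dotp y y) 0.
  by rewrite !dotpE expr0n mulr0.
have yy : 0 < dotp y y by rewrite lt_def y0 dotp_ge0.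
have := dotp_ge0 (dotp y y *: x - dotp x y *: y).
rewrite !dotpE (dotpC y x) => h.
rewrite -subr_ge0 -(pmulr_rge0 _ yy); apply: le_trans h _.
by rewrite le_eqVlt; apply/orP; left; apply/eqP; ring.
Qed.

Lemma norm_dotp_le x y : `|dotp x y| <= l2norm x * l2norm y.
Proof.
rewrite !l2normE -sqrtrM ?dotp_ge0 // -sqrtr_sqr.
by rewrite ler_sqrt ?mulr_ge0 ?dotp_ge0 // sqr_dotp_le.
Qed.

Lemma dotp_le x y : dotp x y <= l2norm x * l2norm y.
Proof. by rewrite (le_trans (ler_norm _)) ?norm_dotp_le. Qed.

Lemma dotp_delta x i : dotp x (delta_mx 0 i) = x 0 i.
Proof.
rewrite /dotp (bigD1 i) //= mxE !eqxx mulr1 big1 ?addr0 // => j ji.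
by rewrite mxE (negbTE ji) andbF mulr0.
Qed.

Lemma l1norm_ge0 x : 0 <= l1norm x.
Proof. exact: sumr_ge0. Qed.

Lemma l2norm_le_l1norm x : l2norm x <= l1norm x.
Proof.
rewrite -[leRHS]ger0_norm ?l1norm_ge0 // -sqrtr_sqr.
rewrite /l2norm ler_sqrt ?sqr_ge0 // expr2 mulr_suml; apply: ler_sum => i _.
rewrite -real_normK ?num_real // expr2 ler_wpM2l // /l1norm.
by rewrite (bigD1 i) //= lerDl sumr_ge0.
Qed.

Lemma ler_coord_l2norm x i : `|x 0 i| <= l2norm x.
Proof.
rewrite -sqrtr_sqr ler_sqrt ?sumr_ge0 // => [|j _]; last exact: sqr_ge0.
by rewrite (bigD1 i) //= lerDl sumr_ge0 // => j _; exact: sqr_ge0.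
Qed.

End euclidean_geometry.

(** * Smooth convex functions *)

Section smooth_convex.
Variables (R : realType) (d : nat) (f : 'rV[R]_d -> R).
Implicit Types (x y h : 'rV[R]_d).
Hypothesis df : forall x, differentiable f x.

Lemma derive_dotp x h : 'D_h f x = dotp (grad f x) h.
Proof.
rewrite deriveE // {1}(row_sum_delta h) linear_sum /=.
apply: eq_bigr => i _; rewrite linearZ /= -deriveE //.
by rewrite !mxE /partial; apply: mulrC.
Qed.

Lemma is_derive_line x h (t : R) :
  is_derive t 1 (fun t => f (x + t *: h)) (dotp (grad f (x + t *: h)) h).
Proof.
have E : (fun s : R => s^-1 *: (((fun t => f (x + t *: h)) \o shift t) (s *: 1)
            - f (x + t *: h))) =
         (fun s : R => s^-1 *: ((f \o shift (x + t *: h)) (s *: h)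
            - f (x + t *: h))).
  apply/funext => s /=; congr (_ *: (f _ - _)).
  by rewrite [s *: 1]mulr1 scalerDl addrCA.
split; first by rewrite /derivable E; exact: diff_derivable.
by rewrite /derive E -derive_dotp.
Qed.

Lemma line_MVT x h (t : R) : 0 < t ->
  exists2 c, 0 < c < t &
    f (x + t *: h) - f x = t * dotp (grad f (x + c *: h)) h.
Proof.
move=> t0.
have dl s := is_derive_line x h s.
have [|c] := MVT t0 (fun s _ => dl s).
  by apply: derivable_within_continuous => s _; have [] := dl s.
rewrite in_itv /= => ct; rewrite scale0r addr0 subr0 mulrC => E.
by exists c.
Qed.

Variable L : R.
Hypothesis fL : forall x y, l2norm (grad f x - grad f y) <= L * l2norm (x - y).

Lemma dotp_grad_line x h (c : R) : 0 <= c ->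
  `|dotp (grad f (x + c *: h)) h - dotp (grad f x) h|
     <= L * c * l2norm h ^+ 2.
Proof.
move=> c0; rewrite -dotpBl (le_trans (norm_dotp_le _ _)) //.
rewrite expr2 [leRHS]mulrA ler_wpM2r ?l2norm_ge0 //.
rewrite (le_trans (fL _ _)) // addrC addKr l2normZ ger0_norm //.
by rewrite mulrA.
Qed.

(** Subtracting the quadratic majorant from the restriction of [f] to a segment
    leaves a function with nonpositive derivative. *)
Lemma descent_lemma x y :
  f y <= f x + dotp (grad f x) (y - x) + L / 2 * l2norm (y - x) ^+ 2.
Proof.
set h := y - x; set D := dotp (grad f x) h; set Q := l2norm h ^+ 2.
pose psi (t : R) := f (x + t *: h) - (t * D + L / 2 * Q * t ^+ 2).
have dpsi (t : R) : is_derive t 1 psi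
    (dotp (grad f (x + t *: h)) h - (D + L * t * Q)).
  have ? := is_derive_line x h t.
  rewrite /psi; apply: is_derive_eq.
  have sc (a b : R) : a *: (b : R^o) = a * b by [].
  by rewrite !sc; congr (_ - _); field.
have := @MVT _ psi _ 0 1 ltr01 (fun t _ => dpsi t).
have cpsi : {within `[0, 1], continuous psi}.
  by apply: derivable_within_continuous => t _; have [] := dpsi t.
move=> /(_ cpsi)[c]; rewrite in_itv /= => /andP[c0 _].
rewrite subr0 mulr1 /psi scale0r scale1r addr0 (_ : x + h = y); last first.
  by rewrite /h addrC subrK.
have := dotp_grad_line x h (ltW c0); rewrite ler_norml => /andP[_].
rewrite -/D -/Q; lra.
Qed.

Hypothesis cvxf : convex_function (E := 'rV[R]_d) [set: 'rV[R]_d] f.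

Lemma convex_line x y (t : R) : 0 <= t <= 1 ->
  f (x + t *: (y - x)) <= f x + t * (f y - f x).
Proof.
move=> /andP[t0 t1].
have := @cvxf (Itv01 t0 t1) y x (mem_set I) (mem_set I).
rewrite /conv /=.
have -> : x + t *: (y - x) = t *: y + (1 - t) *: x.
  by rewrite scalerBr scalerBl scale1r addrCA; congr (_ + _); rewrite addrC.
move=> /le_trans; apply.
change (t * f y + (1 - t) * f x <= f x + t * (f y - f x)); lra.
Qed.

(** The mean value theorem bounds the slope of a chord from below by the slope
    of the tangent up to an error that vanishes with the length. *)
Lemma tangent_le x y : f x + dotp (grad f x) (y - x) <= f y.
Proof.
set h := y - x; set D := dotp (grad f x) h; set Q := L * l2norm h ^+ 2.
have main (t : R) : 0 < t -> t <= 1 -> D - t * Q <= f y - f x.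
  move=> t0 t1.
  have /(convex_line x y) c1 : 0 <= t <= 1 by rewrite ltW.
  have [c /andP[c0 ct] E] := line_MVT x h t0.
  have le1 : t * dotp (grad f (x + c *: h)) h <= t * (f y - f x).
    by rewrite -E lerBlDl.
  rewrite ler_pM2l // in le1; apply: le_trans le1.
  have := dotp_grad_line x h (ltW c0); rewrite ler_norml => /andP[+ _].
  have : 0 <= L * l2norm h ^+ 2 * (t - c).
    apply: mulr_ge0; last by rewrite subr_ge0 ltW.
    rewrite expr2 mulrA mulr_ge0 ?l2norm_ge0 //.
    by have := fL y x; apply: le_trans; exact: l2norm_ge0.
  rewrite -/D /Q; lra.
rewrite -lerBrDl leNgt; apply/negP => lt0.
have Q0 : 0 < Q.
  by have := main 1 ltr01 (lexx _); rewrite mul1r; lra.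
pose t := Num.min 1 ((D - (f y - f x)) / (2 * Q)).
have t0 : 0 < t.
  by rewrite lt_min ltr01 /=; apply: divr_gt0; [lra|rewrite mulr_gt0].
have t1 : t <= 1 by rewrite ge_min lexx.
have : t * Q <= (D - (f y - f x)) / 2.
  have -> : (D - (f y - f x)) / 2 = (D - (f y - f x)) / (2 * Q) * Q.
    by field; rewrite gt_eqF.
  by rewrite ler_pM2r // ge_min lexx orbT.
have := main t t0 t1; lra.
Qed.

Hypothesis L0 : 0 < L.

(** A gradient step of length [1 / L] from [p] would otherwise decrease [f]. *)
Lemma grad_argmin p : argmin f p -> grad f p = 0.
Proof.
move=> fp; have := descent_lemma p (p - L^-1 *: grad f p).
have := fp (p - L^-1 *: grad f p).
rewrite [p - _ - p]addrC addKr sqr_l2norm !dotpE => h1 h2.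
apply: dotp_eq0; apply/eqP; rewrite eq_le dotp_ge0 andbT.
have : L^-1 / 2 * dotp (grad f p) (grad f p) <= 0.
  have E : L / 2 * - (L^-1 * - (L^-1 * dotp (grad f p) (grad f p)))
      = L^-1 / 2 * dotp (grad f p) (grad f p) by field; rewrite gt_eqF.
  lra.
by rewrite pmulr_rle0 // divr_gt0 ?invr_gt0.
Qed.

(** Compare both tangent bounds at the point reached from the minimizer [p] by
    a step of length [1 / L] along the gradient at [x]. *)
Lemma grad_cocoercive x p : argmin f p ->
  f x - f p + l2norm (grad f x) ^+ 2 / (2 * L) <= dotp (grad f x) (x - p).
Proof.
move=> fp; set g := grad f x.
have := descent_lemma p (p + L^-1 *: g).
have := tangent_le x (p + L^-1 *: g).
rewrite (grad_argmin fp) -/g !sqr_l2norm [p + _ - p]addrC addKr !dotpE.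
move=> h1 h2.
have E : L / 2 * (L^-1 * (L^-1 * dotp g g)) = dotp g g / (2 * L).
  by field; rewrite gt_eqF.
have E' : L^-1 * dotp g g = 2 * (dotp g g / (2 * L)) by field; rewrite gt_eqF.
lra.
Qed.

Lemma continuous_dist2 x : continuous (fun z : 'rV[R]_d => dotp (x - z) (x - z)).
Proof.
apply: continuous_big => //.
  exact: add_continuous.
move=> i _ z /=.
have c : {for z, continuous (fun z : 'rV[R]_d => (x - z) 0 i)}.
  have -> : (fun z : 'rV[R]_d => (x - z) 0 i) = (fun z => x 0 i - z 0 i).
    by apply/funext => y; rewrite !mxE.
  apply: continuousB; first exact: cst_continuous.
  exact: coord_continuous.
exact: continuousM.
Qed.

Lemma closed_argmin : closed (argmin f).
Proof.
have -> : argmin f = \bigcap_(y in setT) (f @^-1` [set t | t <= f y]).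
  apply/seteqP; split => x h y; first by move=> _; exact: h.
  exact: (h y I).
apply: closed_bigI => y _; apply: preimage_closed; last exact: closed_le.
by move=> x _; exact: differentiable_continuous.
Qed.

Lemma nearest_point (A : set 'rV[R]_d) x : closed A -> A !=set0 ->
  exists p, is_proj A x p.
Proof.
move=> cA [a Aa].
pose B := A `&` [set z | dotp (x - z) (x - z) <= dotp (x - a) (x - a)].
have cB : compact B.
  apply: bounded_closed_compact.
    exists (l2norm x + l2norm (x - a)); split; first exact: num_real.
    move=> M ltM z [_ /= Bz]; rewrite [leLHS]/Num.Def.normr /= mx_normrE.
    apply/bigmax_leP; split => [|[i j] _ /=].
      by apply: le_trans (ltW ltM); rewrite addr_ge0 ?l2norm_ge0.
    apply: le_trans (ltW ltM); rewrite (ord1 i).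
    have -> : z 0 j = x 0 j - (x - z) 0 j by rewrite !mxE; ring.
    rewrite (le_trans (ler_normB _ _)) // lerD ?ler_coord_l2norm //.
    rewrite (le_trans (ler_coord_l2norm _ _)) // !l2normE.
    by rewrite ler_sqrt ?dotp_ge0.
  apply: closedI => //.
  apply: (preimage_closed (D := [set t | t <= dotp (x - a) (x - a)])
    (f := fun z : 'rV[R]_d => dotp (x - z) (x - z))); last exact: closed_le.
  by move=> z _; exact: continuous_dist2.
have [||p /set_mem[Ap _] pmin] :=
    @compact_EVT_min _ R (fun z : 'rV[R]_d => dotp (x - z) (x - z)) B _ cB.
- by exists a; split => //=.
- by apply: continuous_subspaceT; exact: continuous_dist2.
exists p; split => // z Az; rewrite !l2normE ler_sqrt ?dotp_ge0 //.
have [Bz|/ltW Bz] := leP (dotp (x - z) (x - z)) (dotp (x - a) (x - a)).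
  by apply: pmin; rewrite inE; split.
by apply: le_trans Bz; apply: pmin; rewrite inE; split => //=.
Qed.

Lemma Pstar_argmin x : argmin f !=set0 -> argmin f (Pstar f x).
Proof.
move=> f0; have := nearest_point x closed_argmin f0.
by move=> /(@xgetPex _ 0)[].
Qed.

Lemma fstarE p : argmin f p -> fstar f = f p.
Proof.
move=> fp; apply/eqP; rewrite eq_le; apply/andP; split.
  by apply: ge_inf; [exists (f p) => _ [y _ <-]; exact: fp|exists p].
by apply: lb_le_inf; [exists (f p), p|move=> _ [y _ <-]; exact: fp].
Qed.

(** With [F] the excess of [f] at [x], [D] the distance to the minimizers and
    [G] the norm of the gradient, cocoercivity gives [F + G^2 / 2L <= G D] and
    restricted strong convexity gives [D^2 <= 2 F / nu].  Squaring the former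
    and inserting the latter, the claim reduces to [3 u <= (1 + u^2)^2], with
    [u] the ratio of [G] and [sqrt (2 L F)]. *)
Lemma grad_lower_bound nu eps x : 0 < nu -> 0 < eps -> argmin f !=set0 ->
  restricted_strongly_convex nu f -> eps < f x - fstar f ->
  nu * Num.sqrt (2 * eps / L) <= 4 / 3 * l2norm (grad f x).
Proof.
move=> nu0 eps0 f0 rsc epsF.
have Ap := Pstar_argmin x f0; set p := Pstar f x in Ap.
have := grad_cocoercive x Ap; rewrite -(fstarE Ap).
set F := f x - fstar f in epsF *; set G := l2norm (grad f x).
move=> /le_trans/(_ (dotp_le _ _)); rewrite -/G; set D := l2norm (x - p) => h1.
have h2 : nu / 2 * D ^+ 2 <= F by exact: rsc.
have F0 : 0 < F := lt_trans eps0 epsF.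
have G0 : 0 <= G := l2norm_ge0 _.
have D0 : 0 <= D := l2norm_ge0 _.
pose e := Num.sqrt (2 * F / L).
have e0 : 0 < e by rewrite sqrtr_gt0 divr_gt0 ?mulr_gt0.
have FE : F = L * e ^+ 2 / 2.
  rewrite sqr_sqrtr; last by rewrite divr_ge0 ?mulr_ge0 ?ltW.
  by field; rewrite gt_eqF.
apply: (@le_trans _ _ (nu * e)).
  rewrite ler_pM2l // ler_sqrt; last by rewrite divr_ge0 ?mulr_ge0 ?ltW.
  by rewrite ler_pM2r ?invr_gt0 // ler_pM2l // ltW.
have h3 : (F + G ^+ 2 / (2 * L)) ^+ 2 <= G ^+ 2 * D ^+ 2.
  rewrite -exprMn ler_sqr ?nnegrE //; last exact: mulr_ge0.
  by rewrite addr_ge0 ?(ltW F0) // divr_ge0 ?exprn_ge0 // mulr_ge0 // ltW.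
have h4 : nu * (F + G ^+ 2 / (2 * L)) ^+ 2 <= 2 * F * G ^+ 2.
  apply: (@le_trans _ _ (nu * (G ^+ 2 * D ^+ 2))); first by rewrite ler_pM2l.
  have := ler_wpM2l (exprn_ge0 2 G0) h2; lra.
pose y := L * e; have y0 : 0 < y by rewrite mulr_gt0.
have h5 : nu * (y ^+ 2 + G ^+ 2) ^+ 2 <= 4 * L ^+ 3 * e ^+ 2 * G ^+ 2.
  have -> : nu * (y ^+ 2 + G ^+ 2) ^+ 2 =
      4 * L ^+ 2 * (nu * (F + G ^+ 2 / (2 * L)) ^+ 2).
    by rewrite FE /y; field; rewrite gt_eqF.
  have -> : 4 * L ^+ 3 * e ^+ 2 * G ^+ 2 = 4 * L ^+ 2 * (2 * F * G ^+ 2).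
    by rewrite FE; field.
  by rewrite ler_pM2l // mulr_gt0 // exprn_gt0.
have h6 : 3 * (G * y ^+ 3) <= (y ^+ 2 + G ^+ 2) ^+ 2.
  have := sqr_ge0 (G ^+ 2 - y ^+ 2 / 3).
  by have := sqr_ge0 (y * (G - 9 / 16 * y)); have := sqr_ge0 (y ^+ 2); lra.
have Y0 : 0 < (y ^+ 2 + G ^+ 2) ^+ 2.
  by rewrite exprn_gt0 // ltr_wpDr ?sqr_ge0 // exprn_gt0.
rewrite -(ler_pM2r Y0).
have h7 : nu * (y ^+ 2 + G ^+ 2) ^+ 2 * e <= 4 * L ^+ 3 * e ^+ 2 * G ^+ 2 * e.
  by rewrite ler_pM2r.
have h8 := ler_wpM2l G0 h6.
rewrite mulrAC; apply: le_trans h7 _.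
have -> : 4 * L ^+ 3 * e ^+ 2 * G ^+ 2 * e = 4 / 3 * (G * (3 * (G * y ^+ 3))).
  by rewrite /y; field.
by rewrite -[leRHS]mulrA ler_pM2l // divr_gt0.
Qed.

End smooth_convex.

(** * One descent step *)

Section one_step.
Variables (R : realType) (d : nat) (f : 'rV[R]_d -> R) (L : R).
Hypothesis df : forall x, differentiable f x.
Hypothesis fL : forall x y, l2norm (grad f x - grad f y) <= L * l2norm (x - y).
Hypothesis cvxf : convex_function (E := 'rV[R]_d) [set: 'rV[R]_d] f.
Hypothesis L0 : 0 < L.

Definition grad_dir x : 'rV[R]_d := (l2norm (grad f x))^-1 *: grad f x.

Lemma l2norm_grad_dir x : grad f x != 0 -> l2norm (grad_dir x) = 1.
Proof.
move=> g0; have G0 : l2norm (grad f x) != 0.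
  by apply: contra_neq g0; exact: l2norm_eq0.
by rewrite l2normZ ger0_norm ?invr_ge0 ?l2norm_ge0 // mulVf.
Qed.

Lemma grad_dirE x : grad f x = l2norm (grad f x) *: grad_dir x.
Proof.
rewrite scalerA; have [/l2norm_eq0 ->|G0] := eqVneq (l2norm (grad f x)) 0.
  by rewrite scaler0.
by rewrite divff // scale1r.
Qed.

(** The first-order gain [alpha G / 3] of the step pays for its second-order cost
    [L alpha^2 / 2] because [L alpha] is at most [2 G / 3], with [G] the norm of
    the gradient. *)
Lemma step_decreases x g alpha : 0 <= alpha -> l2norm g <= 1 ->
  3 * (L * alpha) <= 2 * l2norm (grad f x) ->
  1 / 3 <= dotp (grad_dir x) g -> f (x - alpha *: g) <= f x.
Proof.
move=> a0 g1 aG vg; apply: le_trans (descent_lemma df fL x _) _.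
rewrite [x - _ - x]addrC addKr l2normN l2normZ ger0_norm //.
rewrite dotpNr dotpZr grad_dirE dotpZl.
set G := l2norm (grad f x) in aG *.
have G0 : 0 <= G := l2norm_ge0 _.
have h1 : L / 2 * (alpha * l2norm g) ^+ 2 <= L / 2 * alpha ^+ 2.
  rewrite ler_pM2l ?divr_gt0 // exprMn ler_piMr ?exprn_ge0 //.
  by rewrite exprn_ile1 // l2norm_ge0.
have h2 : alpha * G * (1 / 3) <= alpha * G * dotp (grad_dir x) g.
  by rewrite ler_wpM2l // mulr_ge0.
have h3 := ler_wpM2l a0 aG.
lra.
Qed.

(** Along directions of positive slope convexity makes [f] increase at every
    scale, so comparing values reveals the sign of the slope exactly. *)
Lemma sign_pos x z r : 0 < r -> 0 < dotp z (grad_dir x) -> f x < f (x + r *: z).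
Proof.
move=> r0 zv; apply: lt_le_trans (tangent_le df fL cvxf x _).
rewrite [x + _ - x]addrAC subrr add0r dotpZr grad_dirE dotpZl (dotpC _ z) ltrDl.
rewrite !mulr_gt0 // lt_def l2norm_ge0 andbT; apply/eqP => /l2norm_eq0 g0.
by move: zv; rewrite /grad_dir g0 scaler0 dotp0r ltxx.
Qed.

(** Along directions of negative slope the curvature may hide the decrease, but
    only if the slope is small.  The factor [c] will be the square root of the
    dimension, which makes [c * dotp z v] of order one for a random [z]. *)
Lemma sign_neg x z r c : 0 < r -> 0 < c -> l2norm z = 1 ->
  3 * (c * (L * r)) <= 2 * l2norm (grad f x) ->
  c * dotp z (grad_dir x) < - (1 / 3) -> f (x + r *: z) < f x.
Proof.
move=> r0 c0 z1 rG zv; apply: le_lt_trans (descent_lemma df fL x _) _.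
rewrite [x + _ - x]addrAC subrr add0r l2normZ gtr0_norm // z1 mulr1.
rewrite dotpZr grad_dirE dotpZl.
rewrite (dotpC _ z); set G := l2norm (grad f x) in rG *.
set X := dotp z _ in zv *.
have G0 : 0 < G.
  by rewrite -(@pmulr_rgt0 _ 2) //; apply: lt_le_trans rG; rewrite !mulr_gt0.
rewrite -(ltr_pM2l c0).
have := ltr_pM2l (mulr_gt0 r0 G0) (c * X) (- (1 / 3)); rewrite zv => h1.
have := ler_wpM2r (ltW r0) rG; move: h1; lra.
Qed.

End one_step.

Section step_size.
Variables (R : realType) (L nu eps eta : R).
Hypotheses (nu0 : 0 < nu) (L0 : 0 < L) (nuL : nu / (2 * L) <= 1 / 2).
Hypotheses (eps0 : 0 < eps) (eta0 : 0 < eta) (etanu : eta < nu / (2 * L)).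

Let rhostar := (1 - eta ^+ 2) / (nu / (2 * L) - eta).
Let alpha := (1 + rhostar)^-1 * Num.sqrt (2 * eps / L).

Lemma rhostar_ge : 2 * L / nu <= rhostar.
Proof.
rewrite /rhostar ler_pdivlMr ?subr_gt0 //.
have -> : 2 * L / nu * (nu / (2 * L) - eta) = 1 - 2 * L / nu * eta.
  by field; rewrite !gt_eqF.
have : 1 <= 2 * L / nu.
  rewrite ler_pdivlMr // mul1r.
  by move: nuL; rewrite ler_pdivrMr ?mulr_gt0 //; move: L0; lra.
have : eta ^+ 2 <= eta.
  have e1 : eta < 1 by have := lt_le_trans etanu nuL; lra.
  by rewrite expr2 ler_piMr // ltW.
move=> h1 h2; have : eta <= 2 * L / nu * eta by rewrite ler_peMl // ltW.
lra.
Qed.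

Lemma rhostar_gt0 : 0 < rhostar.
Proof. by apply: lt_le_trans rhostar_ge; rewrite divr_gt0 ?mulr_gt0. Qed.

Lemma alpha_gt0 : 0 < alpha.
Proof.
rewrite mulr_gt0 ?sqrtr_gt0 ?divr_gt0 ?mulr_gt0 ?invr_gt0 //.
by rewrite addr_gt0 // rhostar_gt0.
Qed.

(** The step size is at most [nu / (2 L) * sqrt (2 eps / L)], because
    [1 + rhostar >= 2 L / nu]; the hypothesis on [G] is the conclusion of
    [grad_lower_bound]. *)
Lemma alpha_small G : nu * Num.sqrt (2 * eps / L) <= 4 / 3 * G ->
  3 * (L * alpha) <= 2 * G.
Proof.
rewrite /alpha; set e := Num.sqrt _ => eG.
have e0 : 0 <= e := sqrtr_ge0 _.
have h : L * ((1 + rhostar)^-1 * e) <= nu / 2 * e.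
  rewrite mulrA ler_wpM2r // ler_pdivrMr; last first.
    by rewrite addr_gt0 // rhostar_gt0.
  have := ler_wpM2l (ltW nu0) rhostar_ge.
  have -> : nu * (2 * L / nu) = 2 * L by field; rewrite gt_eqF.
  by move: nu0; lra.
lra.
Qed.

Lemma radius_small c G : 0 < c ->
  nu * Num.sqrt (2 * eps / L) <= 4 / 3 * G ->
  3 * (c * (L * (alpha * nu * rhostar / (2 * L * c)))) <= 2 * G.
Proof.
move=> c0 eG.
have -> : c * (L * (alpha * nu * rhostar / (2 * L * c))) =
    (rhostar / (1 + rhostar)) * (nu * Num.sqrt (2 * eps / L)) / 2.
  rewrite /alpha; field; rewrite !gt_eqF //.
  by rewrite addr_gt0 // rhostar_gt0.
have : rhostar / (1 + rhostar) * (nu * Num.sqrt (2 * eps / L)) <=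
    nu * Num.sqrt (2 * eps / L).
  rewrite ler_piMl ?mulr_ge0 ?sqrtr_ge0 ?ltW //.
  rewrite ltr_pdivrMr ?mul1r ?ltrDr //.
  by rewrite addr_gt0 // rhostar_gt0.
lra.
Qed.

End step_size.

(** * Borel sets of row vectors *)

Lemma measurable_bool_set dT (T : measurableType dT) (b : T -> bool) :
  measurable_fun setT b -> measurable [set t | b t].
Proof. by move=> mb; rewrite -[X in measurable X]setTI; exact: (mb _ [set true]). Qed.

Section borel_row_vectors.
Variables (R : realType) (d : nat).

Lemma continuous_measurable_rV (f : 'rV[R]_d -> R) :
  continuous f -> measurable_fun [set: borel_rV R d] f.
Proof.
move=> /continuousP cf; apply: (measurability _ (RGenOpens.measurableE R)).
move=> _ [_ [a [b ->]] <-]; rewrite setTI.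
by apply: sub_sigma_algebra; apply: cf; exact: interval_open.
Qed.

Lemma measurable_coord (i : 'I_d) :
  measurable_fun [set: borel_rV R d] (fun z : borel_rV R d => z 0 i : R).
Proof. by apply: continuous_measurable_rV; exact: coord_continuous. Qed.

(** Every open set is a countable union of open boxes with rational centres and
    radii [1 / n]. *)
Lemma measurable_rV dT (T : measurableType dT) (F : T -> 'rV[R]_d) :
  (forall i, measurable_fun setT (fun t => F t 0 i)) ->
  measurable_fun setT (F : T -> borel_rV R d).
Proof.
move=> mF; apply: (@measurability _ _ T (borel_rV R d) setT F open erefl).
move=> _ [U oU <-]; rewrite setTI.
pose box (p : 'rV[rat]_d * nat) : set 'rV[R]_d :=
  [set z | forall i, `|z 0 i - ratr (p.1 0 i)| < p.2.+1%:R^-1].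
pose G p := [set t | box p `<=` U /\ box p (F t)].
have -> : F @^-1` U = \bigcup_(p in setT) G p.
  apply/seteqP; split => [t /= Ut|t [p _ [pU pt]]]; last exact: pU.
  have /nbhs_ballP[e /= e0 eU] := open_nbhs_nbhs (conj oU Ut).
  have [n ne] : exists n : nat, n.+1%:R^-1 < e / 2.
    exists (Num.truncn (2 / e)).
    rewrite invf_plt ?posrE ?divr_gt0 // invf_div.
    by rewrite -truncn_le_nat ?divr_ge0 ?ltW.
  have qP i : exists q : rat, `|F t 0 i - ratr q| < n.+1%:R^-1.
    have [q] := @rat_in_itvoo R (F t 0 i - n.+1%:R^-1) (F t 0 i + n.+1%:R^-1)
      ltac:(by rewrite ltrBlDr -addrA ltrDl addr_gt0).
    by rewrite in_itv /= => qF; exists q; rewrite ltr_distlC.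
  have [q qE] := choice qP.
  exists (\row_i q i, n) => //; split; last by move=> i; rewrite /= mxE.
  move=> z zbox; apply: eU; split => // i j; rewrite (ord1 i).
  have := zbox j; have := qE j; rewrite /= mxE /ball /= => h1 h2.
  have -> : F t 0 j - z 0 j = (F t 0 j - ratr (q j)) - (z 0 j - ratr (q j)).
    by ring.
  rewrite (le_lt_trans (ler_normB _ _)) // (splitr e).
  by rewrite ltrD // (lt_trans _ ne).
apply: countable_bigcupT_measurable => [|p]; first exact: countableP.
have [pU|pU] := pselect (box p `<=` U); last first.
  rewrite (_ : G p = set0) // -subset0 => t [].
  by move=> /pU.
have -> : G p = \bigcap_(i in setT)
    [set t | `|F t 0 i - ratr (p.1 0 i)| < p.2.+1%:R^-1].
  apply/seteqP; split => t; first by move=> [_ h] i _; exact: h.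
  by move=> h; split => // i; exact: (h i).
apply: fin_bigcap_measurable; first exact: finite_finset.
move=> i _; apply: (@measurable_bool_set _ _
  (fun t => `|F t 0 i - ratr (p.1 0 i)| < p.2.+1%:R^-1)).
apply: measurable_fun_ltr => //; apply: measurableT_comp => //.
by apply: measurable_funB.
Qed.

End borel_row_vectors.

(** * Bounded random variables *)

Section bounded_random_variables.
Variables (R : realType) (dO : measure_display) (Omega : measurableType dO).
Variable P : probability Omega R.
Implicit Types (X Y : Omega -> R).

Definition bounded_rv X :=
  measurable_fun setT X /\ exists B, forall w, `|X w| <= B.

Definition expect X : R := \int[P]_w X w.

Lemma bounded_rv_integrable X : bounded_rv X ->
  P.-integrable setT (EFin \o X).
Proof.
move=> [mX [B XB]]; apply: measurable_bounded_integrable => //.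
  by apply: le_lt_trans (probability_le1 P measurableT) _; rewrite ltry.
exists B; split; first exact: num_real.
by move=> M BM w _; exact: le_trans (XB w) (ltW BM).
Qed.

Lemma bounded_rv_cst a : bounded_rv (fun=> a).
Proof. by split; [exact: measurable_cst|exists `|a|]. Qed.

Lemma bounded_rvD X Y : bounded_rv X -> bounded_rv Y ->
  bounded_rv (fun w => X w + Y w).
Proof.
move=> [mX [A XA]] [mY [B YB]]; split; first exact: measurable_funD.
by exists (A + B) => w; rewrite (le_trans (ler_normD _ _)) // lerD.
Qed.

Lemma bounded_rvM X Y : bounded_rv X -> bounded_rv Y ->
  bounded_rv (fun w => X w * Y w).
Proof.
move=> [mX [A XA]] [mY [B YB]]; split; first exact: measurable_funM.
by exists (A * B) => w; rewrite normrM ler_pM.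
Qed.

Lemma bounded_rvZ a X : bounded_rv X -> bounded_rv (fun w => a * X w).
Proof. by move=> bX; apply: bounded_rvM => //; exact: bounded_rv_cst. Qed.

Lemma bounded_rvN X : bounded_rv X -> bounded_rv (fun w => - X w).
Proof.
move=> [mX [A XA]]; split; first exact: measurableT_comp.
by exists A => w; rewrite normrN.
Qed.

Lemma bounded_rvB X Y : bounded_rv X -> bounded_rv Y ->
  bounded_rv (fun w => X w - Y w).
Proof. by move=> bX bY; apply: bounded_rvD => //; exact: bounded_rvN. Qed.

Lemma bounded_rvX X n : bounded_rv X -> bounded_rv (fun w => X w ^+ n).
Proof.
move=> bX; elim: n => [|n IH].
  under [X in bounded_rv X]eq_fun do rewrite expr0; exact: bounded_rv_cst.
under [X in bounded_rv X]eq_fun do rewrite exprS.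
exact: bounded_rvM.
Qed.

Lemma bounded_rv_norm X : bounded_rv X -> bounded_rv (fun w => `|X w|).
Proof.
move=> [mX [A XA]]; split; first exact: measurableT_comp.
by exists A => w; rewrite normr_id.
Qed.

Lemma bounded_rv_exp X : bounded_rv X -> bounded_rv (fun w => expR (X w)).
Proof.
move=> [mX [A XA]]; split; first exact: measurableT_comp.
exists (expR A) => w; rewrite ger0_norm ?expR_ge0 // ler_expR.
by rewrite (le_trans _ (XA w)) // ler_norm.
Qed.

Lemma bounded_rv_bool (b : Omega -> bool) : measurable_fun setT b ->
  bounded_rv (fun w => (b w)%:R).
Proof.
move=> mb; split; last by exists 1 => w; case: (b w); rewrite ?normr1 ?normr0.
rewrite (_ : (fun w => _) = \1_[set w | b w]).
  by apply: measurable_indic; exact: measurable_bool_set.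
by apply/funext => w; rewrite indicE; congr (_%:R); rewrite mem_setE.
Qed.

Lemma bounded_rv_ler X Y : bounded_rv X -> bounded_rv Y ->
  bounded_rv (fun w => (X w <= Y w)%R%:R).
Proof.
move=> [mX _] [mY _]; apply: (@bounded_rv_bool (fun w => X w <= Y w)).
exact: measurable_fun_ler.
Qed.

Lemma bounded_rv_ltr X Y : bounded_rv X -> bounded_rv Y ->
  bounded_rv (fun w => (X w < Y w)%R%:R).
Proof.
move=> [mX _] [mY _]; apply: (@bounded_rv_bool (fun w => X w < Y w)).
exact: measurable_fun_ltr.
Qed.

Lemma bounded_rv_eqr X Y : bounded_rv X -> bounded_rv Y ->
  bounded_rv (fun w => (X w == Y w)%R%:R).
Proof.
move=> [mX _] [mY _]; apply: (@bounded_rv_bool (fun w => X w == Y w)).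
exact: measurable_fun_eqr.
Qed.

Lemma bounded_rv_sum (I : Type) (r : seq I) (X : I -> Omega -> R) :
  (forall i, bounded_rv (X i)) -> bounded_rv (fun w => \sum_(i <- r) X i w).
Proof.
move=> bX; elim: r => [|i r IH].
  under [X in bounded_rv X]eq_fun do rewrite big_nil; exact: bounded_rv_cst.
under [X in bounded_rv X]eq_fun do rewrite big_cons.
exact: bounded_rvD.
Qed.

Lemma bounded_rv_prod (I : Type) (r : seq I) (X : I -> Omega -> R) :
  (forall i, bounded_rv (X i)) -> bounded_rv (fun w => \prod_(i <- r) X i w).
Proof.
move=> bX; elim: r => [|i r IH].
  under [X in bounded_rv X]eq_fun do rewrite big_nil; exact: bounded_rv_cst.
under [X in bounded_rv X]eq_fun do rewrite big_cons.
exact: bounded_rvM.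
Qed.

Lemma expect_cst a : expect (fun=> a) = a.
Proof.
rewrite /expect Rintegral_cst //.
by rewrite [X in _ * fine X](@probability_setT _ _ _ P) mulr1.
Qed.

Lemma expectD X Y : bounded_rv X -> bounded_rv Y ->
  expect (fun w => X w + Y w) = expect X + expect Y.
Proof. by move=> bX bY; apply: RintegralD => //; exact: bounded_rv_integrable. Qed.

Lemma expectZ a X : bounded_rv X -> expect (fun w => a * X w) = a * expect X.
Proof. by move=> bX; apply: RintegralZl => //; exact: bounded_rv_integrable. Qed.

Lemma expectN X : bounded_rv X -> expect (fun w => - X w) = - expect X.
Proof.
move=> bX; under [X in expect X = _]eq_fun do rewrite -mulN1r.
by rewrite expectZ // mulN1r.
Qed.

Lemma expectB X Y : bounded_rv X -> bounded_rv Y ->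
  expect (fun w => X w - Y w) = expect X - expect Y.
Proof. by move=> bX bY; rewrite expectD ?expectN //; exact: bounded_rvN. Qed.

Lemma expect_sum (I : Type) (r : seq I) (X : I -> Omega -> R) :
  (forall i, bounded_rv (X i)) ->
  expect (fun w => \sum_(i <- r) X i w) = \sum_(i <- r) expect (X i).
Proof.
move=> bX; elim: r => [|i r IH].
  rewrite big_nil; under [X in expect X]eq_fun do rewrite big_nil.
  exact: expect_cst.
rewrite big_cons -IH; under [X in expect X]eq_fun do rewrite big_cons.
by rewrite expectD //; exact: bounded_rv_sum.
Qed.

Lemma ler_expect X Y : bounded_rv X -> bounded_rv Y ->
  (forall w, X w <= Y w) -> expect X <= expect Y.
Proof.
move=> bX bY XY; apply: le_Rintegral => //; exact: bounded_rv_integrable.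
Qed.

Lemma expect_ge0 X : (forall w, 0 <= X w) -> 0 <= expect X.
Proof. by move=> X0; apply: Rintegral_ge0. Qed.

Lemma norm_expect_le X : bounded_rv X -> `|expect X| <= expect (fun w => `|X w|).
Proof. by move=> bX; apply: le_normr_Rintegral => //; exact: bounded_rv_integrable. Qed.

Lemma integral_expect X : bounded_rv X ->
  (\int[P]_w (X w)%:E)%E = (expect X)%:E.
Proof.
move=> bX; rewrite /expect /Rintegral fineK //.
by apply: integrable_fin_num => //; exact: bounded_rv_integrable.
Qed.

End bounded_random_variables.

(** Decides boundedness along the syntax of a random variable; the atoms have to
    be in the context. *)
Ltac bounded := intros; repeat first
  [ solve [auto 1] | exact: bounded_rv_cst | apply: bounded_rv_exp
  | apply: bounded_rv_ler | apply: bounded_rv_ltr | apply: bounded_rv_eqr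
  | apply: bounded_rvN | apply: bounded_rvX | apply: bounded_rv_norm
  | apply: bounded_rvB | apply: bounded_rvD | apply: bounded_rvM ].

(** * Independence *)

Section independence.
Variables (R : realType) (dO : measure_display) (Omega : measurableType dO).
Variable P : probability Omega R.

Definition indep_sets (F G : set (set Omega)) :=
  forall A B, F A -> G B -> (P (A `&` B) = P A * P B)%E.

Lemma indep_setsC F G : indep_sets F G -> indep_sets G F.
Proof. by move=> FG A B GA FB; rewrite setIC muleC FG. Qed.

(** The events independent of a given event form a Dynkin system. *)
Lemma indep_sets_sigma F G : setI_closed F ->
  F `<=` measurable -> G `<=` measurable ->
  indep_sets F G -> indep_sets <<s F >> G.
Proof.
move=> FI mF mG FG A B FA GB.
have mB := mG _ GB.
have sF : <<s F >> `<=` measurable.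
  by apply: smallest_sub => //; exact: sigma_algebra_measurable.
have PB : P B \is a fin_num by rewrite fin_num_measure.
move: A FA; apply: (@dynkin_induction _ (g_sigma_algebraType F) F
  (fun A => P (A `&` B) = P A * P B)%E) => //.
- by rewrite setTI probability_setT mul1e.
- by move=> A FA; exact: FG.
- move=> A /sF mA AB.
  have -> : ~` A `&` B = B `\` (A `&` B).
    by rewrite setDIr setDv setU0 setDE setIC.
  rewrite measureD //=; last 2 first.
  - exact: measurableI.
  - by rewrite (le_lt_trans (probability_le1 _ _)) ?ltry.
  by rewrite setIC -setIA setIid AB probability_setC // muleBl ?mul1e.
- move=> E mE tE EB.
  have mE' n : @measurable _ Omega (E n) by apply: sF; exact: mE.
  rewrite setI_bigcupl measure_bigcup //=; last 2 first.
  - by move=> n _; exact: measurableI.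
  - by apply: trivIset_setIr.
  under eq_eseriesr do rewrite EB.
  rewrite measure_bigcup //= muleC -(fineK PB) -nneseriesZl //.
  by apply: eq_eseriesr => n _; rewrite muleC.
Qed.

Lemma indep_sigma F G : setI_closed F -> setI_closed G ->
  F `<=` measurable -> G `<=` measurable ->
  indep_sets F G -> indep_sets <<s F >> <<s G >>.
Proof.
move=> FI GI mF mG FG.
apply: indep_sets_sigma => //.
  by apply: smallest_sub => //; exact: sigma_algebra_measurable.
by apply/indep_setsC/indep_sets_sigma => //; exact: indep_setsC.
Qed.

(** Two independent blocks of coordinates have a product law, so they may be fed
    independent copies of the sample point.  The [g_sigma_algebraType]s record
    which block each argument of [Phi] is allowed to look at. *)
Lemma decoupling F G (Phi : g_sigma_algebraType F * g_sigma_algebraType G -> \bar R) :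
  setI_closed F -> setI_closed G -> F `<=` measurable -> G `<=` measurable ->
  indep_sets F G -> measurable_fun setT Phi -> (forall q, 0 <= Phi q)%E ->
  (\int[P]_w Phi (w, w) = \int[P]_w \int[P]_w' Phi (w, w'))%E.
Proof.
move=> FI GI mF mG FG mPhi Phi0.
have sF : <<s F >> `<=` measurable.
  by apply: smallest_sub => //; exact: sigma_algebra_measurable.
have sG : <<s G >> `<=` measurable.
  by apply: smallest_sub => //; exact: sigma_algebra_measurable.
have mV : measurable_fun setT (id : Omega -> g_sigma_algebraType F).
  by move=> _ A mA; rewrite setTI; exact: sF.
have mW : measurable_fun setT (id : Omega -> g_sigma_algebraType G).
  by move=> _ A mA; rewrite setTI; exact: sG.
pose V : {mfun Omega >-> g_sigma_algebraType F} :=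
  HB.pack (id : Omega -> g_sigma_algebraType F)
    (isMeasurableFun.Build _ _ _ _ _ mV).
pose W : {mfun Omega >-> g_sigma_algebraType G} :=
  HB.pack (id : Omega -> g_sigma_algebraType G)
    (isMeasurableFun.Build _ _ _ _ _ mW).
have mVW : measurable_fun setT
    (fun w : Omega => (V w, W w)).
  exact: measurable_fun_pair.
pose VW : {mfun Omega >-> (g_sigma_algebraType F * g_sigma_algebraType G)%type} :=
  HB.pack (fun w => (V w, W w)) (isMeasurableFun.Build _ _ _ _ _ mVW).
transitivity (\int[distribution P VW]_q Phi q)%E.
  by rewrite ge0_integral_distribution.
have <- : (\int[distribution P V \x distribution P W]_q Phi q =
    \int[distribution P VW]_q Phi q)%E.
  apply: eq_measure_integral => A mA _.
  apply: (@product_measure_unique _ _ _ _ R (distribution P V) (distribution P W)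
    (distribution P VW)) => // B C mB mC.
  by have := indep_sigma FI GI mF mG FG mB mC.
rewrite fubini_tonelli1 // ge0_integral_distribution //; last 2 first.
- exact: measurable_fun_fubini_tonelli_F.
- by move=> y; apply: integral_ge0.
apply: eq_integral => w _ /=; rewrite /fubini_F ge0_integral_distribution //.
by apply: measurableT_comp => //; exact: pair1_measurable.
Qed.

Lemma sigma_of_setI dT (T : measurableType dT) (X : Omega -> T) :
  setI_closed (sigma_of X).
Proof.
move=> _ _ [A mA <-] [B mB <-]; exists (A `&` B); first exact: measurableI.
by rewrite !setTI preimage_setI.
Qed.

Lemma sigma_of_setT dT (T : measurableType dT) (X : Omega -> T) : sigma_of X setT.
Proof. by exists setT => //; rewrite setTI preimage_setT. Qed.

Lemma sigma_of_measurable dT (T : measurableType dT) (X : Omega -> T) :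
  measurable_fun setT X -> sigma_of X `<=` measurable.
Proof. by move=> mX _ [A mA <-]; exact: mX. Qed.

Lemma mutually_independent_sub (I : finType) (G G' : I -> set (set Omega)) :
  (forall i, G' i `<=` G i) -> mutually_independent P G ->
  mutually_independent P G'.
Proof. by move=> GG h J A AG; apply: h => i /AG /GG. Qed.

Lemma probability_setI1 (A S : set Omega) : measurable A -> measurable S ->
  P S = 1%E -> P (A `&` S) = P A.
Proof.
move=> mA mS PS; rewrite [RHS](measureDI P mA mS).
rewrite [X in (X + _)%E](_ : _ = 0%E) ?add0e //; apply/eqP.
rewrite eq_le measure_ge0 andbT.
have <- : P (~` S) = 0%E by rewrite probability_setC // PS subee.
apply: le_measure; rewrite ?inE //; first exact: measurableD.
exact: measurableC.
Qed.

End independence.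

(** * The uniform law on the sphere *)

Section reflections.
Variables (R : realType) (d : nat).
Implicit Types (u v n z : 'rV[R]_d).

Definition reflect_mx n : 'M[R]_d :=
  1%:M - (2 / dotp n n) *: (n^T *m n).

Lemma dotp_mulmx z u : z *m u^T = (dotp z u)%:M.
Proof.
by apply/matrixP => i j; rewrite !ord1 !mxE eqxx; apply: eq_bigr => k _; rewrite mxE.
Qed.

Lemma mul_reflect z n :
  z *m reflect_mx n = z - (2 * dotp z n / dotp n n) *: n.
Proof.
rewrite /reflect_mx mulmxBr mulmx1 -scalemxAr mulmxA dotp_mulmx mul_scalar_mx.
by rewrite scalerA mulrAC.
Qed.

Lemma dotp_reflect z n u :
  dotp (z *m reflect_mx n) u = dotp z (u *m reflect_mx n).
Proof.
by rewrite !mul_reflect !dotpBl !dotpBr dotpZl dotpZr (dotpC n); ring.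
Qed.

Lemma reflect_mx_orth n : n != 0 -> reflect_mx n *m (reflect_mx n)^T = 1%:M.
Proof.
move=> n0; have nn : dotp n n != 0 by apply: contra_neq n0; exact: dotp_eq0.
have -> : (reflect_mx n)^T = reflect_mx n.
  by rewrite /reflect_mx linearB linearZ /= trmx1 trmx_mul trmxK.
apply/row_matrixP => i; rewrite rowE mulmxA !mul_reflect row1 dotpBl dotpZl.
rewrite -addrA -opprD -scalerDl [X in X *: n](_ : _ = 0); last by field.
by rewrite scale0r subr0.
Qed.

Lemma orth_dotp (U : 'M[R]_d) z u : U *m U^T = 1%:M ->
  dotp (z *m U) (u *m U) = dotp z u.
Proof.
move=> UU; have : (dotp (z *m U) (u *m U))%:M = (dotp z u)%:M :> 'M[R]_1.
  by rewrite -!dotp_mulmx trmx_mul mulmxA -(mulmxA z) UU mulmx1.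
by move=> /matrixP/(_ 0 0); rewrite !mxE eqxx.
Qed.

Lemma orth_l2norm (U : 'M[R]_d) z : U *m U^T = 1%:M ->
  l2norm (z *m U) = l2norm z.
Proof. by move=> UU; rewrite !l2normE orth_dotp. Qed.

End reflections.

Section uniform_sphere.
Variables (R : realType) (d : nat).
Implicit Types (u v n z : 'rV[R]_d) (F : 'rV[R]_d -> R).
Variable e : 'rV[R]_d.
Hypothesis e1 : l2norm e = 1.

(** A random direction is on the sphere only almost surely.  Sending the points
    off the sphere to a fixed unit vector [e] makes this hold everywhere, so that
    linear functions of the direction are bounded random variables. *)
Definition clip z : 'rV[R]_d := if l2norm z == 1 then z else e.

Lemma l2norm_clip z : l2norm (clip z) = 1.
Proof. by rewrite /clip; case: ifPn => // /eqP. Qed.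

Lemma clip_id z : l2norm z = 1 -> clip z = z.
Proof. by rewrite /clip => ->; rewrite eqxx. Qed.

Lemma measurable_dotp u :
  measurable_fun setT (fun z : borel_rV R d => dotp z u).
Proof.
apply: measurable_sum => i; apply: measurable_funM => //.
exact: measurable_coord.
Qed.

Lemma measurable_l2norm : measurable_fun setT (fun z : borel_rV R d => l2norm z).
Proof.
apply: (measurableT_comp (f := @Num.sqrt R)).
  by apply: continuous_measurable_fun; exact: sqrt_continuous.
by apply: measurable_sum => i; apply: measurable_funX; exact: measurable_coord.
Qed.

Lemma measurable_mulmxr (U : 'M[R]_d) :
  measurable_fun setT (fun z : borel_rV R d => z *m U : borel_rV R d).
Proof.
apply: measurable_rV => i.
have -> : (fun t : 'rV_d => (t *m U) 0 i) = (fun t => dotp t (\row_k U k i)).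
  by apply/funext => t; rewrite mxE; apply: eq_bigr => k _; rewrite mxE.
exact: measurable_dotp.
Qed.

Lemma measurable_unit_sphere :
  measurable [set z : borel_rV R d | l2norm z = 1].
Proof.
rewrite -[X in measurable X]setTI.
exact: (measurable_l2norm measurableT (measurable_set1 1)).
Qed.

Lemma measurable_clip :
  measurable_fun setT (clip : borel_rV R d -> borel_rV R d).
Proof.
apply: measurable_fun_ifT => //.
by apply: measurable_fun_eqr => //; exact: measurable_l2norm.
Qed.

(** Boundedness on the sphere, phrased so that sums, products and the like are
    covered by the closure properties of bounded random variables. *)
Definition sphere_bounded F := bounded_rv (fun z : borel_rV R d => F (clip z)).

Lemma sphere_bounded_dotp u :
  bounded_rv (fun z : borel_rV R d => dotp (clip z) u).
Proof.
split.
  apply: (measurableT_comp (f := fun z : borel_rV R d => dotp z u)).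
    exact: measurable_dotp.
  exact: measurable_clip.
exists (l2norm u) => z; rewrite (le_trans (norm_dotp_le _ _)) //.
by rewrite l2norm_clip mul1r.
Qed.

Variables (dO : measure_display) (Omega : measurableType dO).
Variable P : probability Omega R.

Definition uniform_rv (Z : Omega -> 'rV[R]_d) :=
  [/\ measurable_fun setT (Z : Omega -> borel_rV R d),
      forall w, l2norm (Z w) = 1 &
      uniform_on_sphere (pushforward P (Z : Omega -> borel_rV R d))].

Variable Z : Omega -> 'rV[R]_d.
Hypothesis unifZ : uniform_rv Z.
Let mZ : measurable_fun setT (Z : Omega -> borel_rV R d).
Proof. by case: unifZ. Qed.
Let Z1 w : l2norm (Z w) = 1.
Proof. by case: unifZ. Qed.

Lemma bounded_sphere F : sphere_bounded F -> bounded_rv (fun w => F (Z w)).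
Proof.
move=> [mF [B FB]]; split; last first.
  by exists B => w; have := FB (Z w); rewrite clip_id.
have -> : (fun w => F (Z w)) = (fun w => F (clip (Z w))).
  by apply/funext => w; rewrite clip_id.
exact: (measurableT_comp (f := fun z : borel_rV R d => F (clip z))).
Qed.

Lemma expect_orth F (U : 'M[R]_d) : U *m U^T = 1%:M -> sphere_bounded F ->
  expect P (fun w => F (Z w)) = expect P (fun w => F (Z w *m U)).
Proof.
move=> UU bF; pose G (z : borel_rV R d) := F (clip z).
have mG : measurable_fun setT G by case: bF.
have mEG : measurable_fun setT (EFin \o G) by apply/measurable_EFinP.
pose ZU w : borel_rV R d := Z w *m U.
have mZU : measurable_fun setT ZU := measurableT_comp (measurable_mulmxr U) mZ.
have eG : (fun w => F (Z w)) = (fun w => G (Z w)).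
  by apply/funext => w; rewrite /G clip_id.
have eGU : (fun w => F (Z w *m U)) = (fun w => G (ZU w)).
  by apply/funext => w; rewrite /G clip_id // orth_l2norm.
have bG : bounded_rv (fun w => G (Z w)) by rewrite -eG; exact: bounded_sphere.
have bGU : bounded_rv (fun w => G (ZU w)).
  have [mF [B FB]] := bF; split; last by exists B => w; exact: FB.
  exact: measurableT_comp mG mZU.
pose X : {mfun Omega >-> borel_rV R d} :=
  HB.pack (Z : Omega -> borel_rV R d) (isMeasurableFun.Build _ _ _ _ _ mZ).
pose XU : {mfun Omega >-> borel_rV R d} :=
  HB.pack ZU (isMeasurableFun.Build _ _ _ _ _ mZU).
rewrite eG eGU; congr fine.
rewrite -(@integral_distribution _ _ _ _ _ P X (EFin \o G)) //; last first.
  exact: bounded_rv_integrable.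
rewrite -(@integral_distribution _ _ _ _ _ P XU (EFin \o G)) //; last first.
  exact: bounded_rv_integrable.
apply: eq_measure_integral => A mA _.
by have [_ _ [_ /(_ U UU A mA) h]] := unifZ; exact: esym h.
Qed.

(** A reflection exchanges two given vectors of the same length. *)
Lemma expect_dir (phi : R -> R) u v : dotp u u = dotp v v ->
  sphere_bounded (fun z => phi (dotp z u)) ->
  expect P (fun w => phi (dotp (Z w) u)) = expect P (fun w => phi (dotp (Z w) v)).
Proof.
move=> uv bphi; have [->//|nuv] := eqVneq u v.
have n0 : u - v != 0 by rewrite subr_eq0.
rewrite (expect_orth (reflect_mx_orth n0) bphi); congr expect.
apply/funext => w; rewrite dotp_reflect mul_reflect; congr (phi (dotp _ _)).
have nn : dotp (u - v) (u - v) != 0 by apply: contra_neq n0; exact: dotp_eq0.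
rewrite (_ : _ / _ = 1); first by rewrite scale1r opprB addrC subrK.
rewrite (_ : 2 * _ = dotp (u - v) (u - v)) ?divff //.
by rewrite !dotpBl !dotpBr (dotpC v u) uv; ring.
Qed.

(** The reflection along [v - (a v + b u)] acts on the plane of the orthonormal
    vectors [v] and [u] by the symmetric orthogonal matrix with rows [(a, b)]
    and [(b, - a)]. *)
Lemma expect_plane (Phi : R -> R -> R) v u a b :
  dotp v v = 1 -> dotp u u = 1 -> dotp v u = 0 -> a ^+ 2 + b ^+ 2 = 1 ->
  sphere_bounded (fun z => Phi (dotp z v) (dotp z u)) ->
  expect P (fun w => Phi (dotp (Z w) v) (dotp (Z w) u)) =
  expect P (fun w => Phi (a * dotp (Z w) v + b * dotp (Z w) u)
                       (b * dotp (Z w) v - a * dotp (Z w) u)).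
Proof.
move=> v1 u1 vu ab bPhi.
pose n := if a == 1 then u else (1 - a) *: v - b *: u.
have [n0 [vn un]] : n != 0 /\ (v *m reflect_mx n = a *: v + b *: u /\
    u *m reflect_mx n = b *: v - a *: u).
  rewrite /n; case: ifPn => [/eqP aE|a1].
    have b0 : b = 0.
      apply/eqP; rewrite -sqrf_eq0; apply/eqP; move: ab; rewrite aE expr1n.
      by move=> /(canRL (addKr _)); rewrite addrC subrr.
    split; first by apply: contra_eq_neq u1 => ->; rewrite dotp0l eq_sym oner_eq0.
    rewrite !mul_reflect vu u1 aE b0 mulr0 mul0r !scale0r subr0 scale1r addr0.
    split => //; rewrite mulr1 divr1 sub0r scale1r scaler_nat mulr2n.
    by rewrite opprD addrA subrr sub0r.
  have a1' : 1 - a != 0 by rewrite subr_eq0 eq_sym.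
  set m := (1 - a) *: v - b *: u.
  have mm : dotp m m = 2 * (1 - a).
    rewrite /m !dotpE (dotpC u v) v1 u1 vu; move: ab; lra.
  have vm : dotp v m = 1 - a by rewrite /m !dotpE v1 vu; ring.
  have um : dotp u m = - b by rewrite /m !dotpE (dotpC u v) u1 vu; ring.
  split.
    apply: contra_neq a1' => m0.
    by move: mm; rewrite m0 dotp0l => h; apply/eqP; lra.
  rewrite !mul_reflect vm um mm; split.
    rewrite (_ : _ / _ = 1); last by field.
    by rewrite scale1r /m scalerBl scale1r opprB opprB addrCA subrKC addrC.
  rewrite (_ : _ / _ = - b / (1 - a)); last by field.
  rewrite /m scalerBr !scalerA (_ : - b / (1 - a) * (1 - a) = - b); last by field.
  rewrite opprB -[X in X + _]scale1r addrA -scalerDl.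
  have bb : b ^+ 2 = (1 - a) * (1 + a) by move: ab; lra.
  rewrite [X in X *: u](_ : _ = - a); last first.
    have -> : - b / (1 - a) * b = - (b ^+ 2 / (1 - a)) by field.
    by rewrite bb; field.
  by rewrite !scaleNr opprK addrC.
rewrite (expect_orth (reflect_mx_orth n0) bPhi); congr expect.
by apply/funext => w; rewrite !dotp_reflect vn un !dotpE.
Qed.

End uniform_sphere.

Section clipped_directions.
Variables (R : realType) (d : nat) (e : 'rV[R]_d).
Hypothesis e1 : l2norm e = 1.
Variables (dO : measure_display) (Omega : measurableType dO).
Variable P : probability Omega R.

Variable Z : Omega -> 'rV[R]_d.
Hypothesis mZ : measurable_fun setT (Z : Omega -> borel_rV R d).
Hypothesis unifZ : uniform_on_sphere (pushforward P (Z : Omega -> borel_rV R d)).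

(** Clipping changes a direction on a null event only. *)
Lemma uniform_clip : uniform_rv P (fun w => clip e (Z w)).
Proof.
have mc : measurable_fun setT ((fun w => clip e (Z w)) : Omega -> borel_rV R d).
  exact: (measurableT_comp (measurable_clip e) mZ).
have mS := @measurable_unit_sphere R d; have [S1 rot] := unifZ.
have mpre (F : Omega -> borel_rV R d) A : measurable_fun setT F ->
    measurable A -> measurable (F @^-1` A).
  by move=> mF mA; rewrite -[X in measurable X]setTI; exact: mF.
have same A : measurable A ->
    pushforward P ((fun w => clip e (Z w)) : Omega -> borel_rV R d) A =
    pushforward P (Z : Omega -> borel_rV R d) A.
  move=> mA; rewrite /pushforward.
  rewrite -(probability_setI1 (mpre _ _ mc mA) (mpre _ _ mZ mS) S1).
  rewrite -[RHS](probability_setI1 (mpre _ _ mZ mA) (mpre _ _ mZ mS) S1).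
  by congr (P _); apply/seteqP; split => w /= [h w1]; move: h; rewrite clip_id.
split=> // [w|]; first exact: l2norm_clip.
split=> [|U UU A mA]; first by rewrite same.
rewrite !same ?rot //.
by have := measurable_mulmxr U measurableT mA; rewrite setTI.
Qed.

Lemma sigma_of_clip :
  sigma_of ((fun w => clip e (Z w)) : Omega -> borel_rV R d)
    `<=` sigma_of (Z : Omega -> borel_rV R d).
Proof.
move=> _ [B mB <-]; exists (clip e @^-1` B : set (borel_rV R d)) => //.
by rewrite -[X in measurable X]setTI; exact: (measurable_clip e).
Qed.

End clipped_directions.

(** * Moments of the uniform law on the sphere *)

Section sphere_moments.
Variables (R : realType) (d : nat) (e : 'rV[R]_d).
Hypothesis e1 : l2norm e = 1.
Variables (dO : measure_display) (Omega : measurableType dO).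
Variable P : probability Omega R.
Variable Z : Omega -> 'rV[R]_d.
Hypothesis unifZ : uniform_rv P Z.
Implicit Types (u v : 'rV[R]_d).

Local Notation E := (expect P).

Lemma bounded_dotp u : bounded_rv (fun w => dotp (Z w) u).
Proof.
have h := @bounded_sphere R d e _ _ P Z unifZ (fun z => dotp z u).
exact (h (sphere_bounded_dotp e1 u)).
Qed.

Lemma dim_gt0 : 0 < d%:R :> R.
Proof.
rewrite ltr0n; case: (posnP d) => // d0; move: e1.
rewrite l2normE /dotp big1 ?sqrtr0 => [/esym/eqP|i _]; first by rewrite oner_eq0.
by have := ltn_ord i; rewrite [X in (_ < X)%N]d0.
Qed.

Lemma dotp_delta1 (i : 'I_d) : dotp (delta_mx 0 i) (delta_mx 0 i) = 1 :> R.
Proof. by rewrite dotp_delta mxE !eqxx. Qed.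

Lemma sum_sqr_coord z : l2norm z = 1 ->
  \sum_(i < d) dotp z (delta_mx 0 i) ^+ 2 = 1 :> R.
Proof.
move=> z1; rewrite -(expr1n _ 2) -[in RHS]z1 sqr_l2norm.
by apply: eq_bigr => i _; rewrite dotp_delta expr2.
Qed.

Let Z1 w : l2norm (Z w) = 1.
Proof. by case: unifZ. Qed.

(** The coordinates of [Z] have the same law and their squares add up to one. *)
Lemma expect_sqr v : dotp v v = 1 -> E (fun w => dotp (Z w) v ^+ 2) = d%:R^-1.
Proof.
move=> v1; have bZ := bounded_dotp.
have eq1 i : E (fun w => dotp (Z w) (delta_mx 0 i) ^+ 2) =
    E (fun w => dotp (Z w) v ^+ 2).
  apply: (expect_dir (e := e) unifZ (phi := fun x => x ^+ 2)).
    by rewrite dotp_delta1.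
  by rewrite /sphere_bounded; bounded; exact: sphere_bounded_dotp.
have : E (fun w => \sum_(i < d) dotp (Z w) (delta_mx 0 i) ^+ 2) = 1.
  under [X in E X]eq_fun do rewrite sum_sqr_coord //; exact: expect_cst.
rewrite expect_sum => [|i]; last by apply: bounded_rvX.
under eq_bigr do rewrite eq1.
rewrite sumr_const card_ord => h.
by apply: (mulfI (lt0r_neq0 dim_gt0)); rewrite mulr_natl h divff // gt_eqF // dim_gt0.
Qed.

(** For orthonormal [v] and [u] the fourth moments along the two diagonals
    [(v + u) / sqrt 2] and [(v - u) / sqrt 2] add up to twice the fourth moment
    along [v]; expanding, the mixed moment is a third of it. *)
Lemma expect_mixed v u : dotp v v = 1 -> dotp u u = 1 -> dotp v u = 0 ->
  E (fun w => dotp (Z w) v ^+ 2 * dotp (Z w) u ^+ 2)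
    = E (fun w => dotp (Z w) v ^+ 4) / 3.
Proof.
move=> v1 u1 vu; have bZ := bounded_dotp.
have dir4 x : dotp x x = 1 ->
    E (fun w => dotp (Z w) x ^+ 4) = E (fun w => dotp (Z w) v ^+ 4).
  move=> x1; apply: (expect_dir (e := e) unifZ (phi := fun x => x ^+ 4)).
    by rewrite x1 v1.
  by rewrite /sphere_bounded; bounded; exact: sphere_bounded_dotp.
pose c : R := Num.sqrt (1 / 2).
have c2 : c ^+ 2 = 1 / 2 by rewrite sqr_sqrtr.
have p1 : dotp (c *: (v + u)) (c *: (v + u)) = 1.
  by rewrite !dotpE (dotpC u v) v1 u1 vu; move: c2; lra.
have m1 : dotp (c *: (v - u)) (c *: (v - u)) = 1.
  by rewrite !dotpE (dotpC u v) v1 u1 vu; move: c2; lra.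
have := dir4 _ p1; have := dir4 _ m1; have := dir4 _ u1.
set M := E (fun w => dotp (Z w) v ^+ 4); move=> hu hm hp.
have : E (fun w => dotp (Z w) (c *: (v + u)) ^+ 4 +
                   dotp (Z w) (c *: (v - u)) ^+ 4) = 2 * M.
  by rewrite expectD ?hm ?hp; [ring|bounded..].
have -> : (fun w => dotp (Z w) (c *: (v + u)) ^+ 4 +
                   dotp (Z w) (c *: (v - u)) ^+ 4) =
    (fun w => (1 / 2 * dotp (Z w) v ^+ 4 + 1 / 2 * dotp (Z w) u ^+ 4) +
       3 * (dotp (Z w) v ^+ 2 * dotp (Z w) u ^+ 2)).
  apply/funext => w; rewrite !dotpZr !dotpDr dotpNr !exprMn.
  rewrite (_ : c ^+ 4 = 1 / 4); last by rewrite (exprM c 2 2) c2; field.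
  by field.
rewrite !expectD ?expectZ; [|bounded..].
rewrite hu -/M; lra.
Qed.

(** By invariance [v] may be taken from the standard basis; the mixed moments of
    its coordinate with all coordinates add up to the second moment [1 / d]. *)
Lemma expect_quad v : dotp v v = 1 ->
  E (fun w => dotp (Z w) v ^+ 4) = 3 / (d%:R * (d%:R + 2)).
Proof.
move=> v1; have bZ := bounded_dotp.
have [i0 _|d0] := pickP (fun _ : 'I_d => true); last first.
  by have := dim_gt0; rewrite ltr0n => dn0; have := d0 (Ordinal dn0).
have -> : E (fun w => dotp (Z w) v ^+ 4) =
    E (fun w => dotp (Z w) (delta_mx 0 i0) ^+ 4).
  apply: (expect_dir (e := e) unifZ (phi := fun x => x ^+ 4)).
    by rewrite dotp_delta1.
  by rewrite /sphere_bounded; bounded; exact: sphere_bounded_dotp.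
set M := E _.
have := expect_sqr (dotp_delta1 i0).
have -> : (fun w => dotp (Z w) (delta_mx 0 i0) ^+ 2) = (fun w =>
    \sum_(i < d) dotp (Z w) (delta_mx 0 i0) ^+ 2 * dotp (Z w) (delta_mx 0 i) ^+ 2).
  by apply/funext => w; rewrite -mulr_sumr sum_sqr_coord // mulr1.
rewrite expect_sum; last by move=> i; bounded.
rewrite (bigD1 i0) //=.
rewrite (_ : (fun w => _ * _) = (fun w => dotp (Z w) (delta_mx 0 i0) ^+ 4)); last first.
  by apply/funext => w; rewrite -exprD.
rewrite -/M (eq_bigr (fun=> M / 3)); last first.
  move=> i ii0; apply: expect_mixed; rewrite ?dotp_delta1 //.
  by rewrite dotp_delta mxE eqxx (negbTE ii0).
rewrite sumr_const cardC1 card_ord -mulr_natl => h.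
have dE : d%:R = d.-1%:R + 1 :> R.
  by rewrite natr1 prednK // -(ltr0n R) dim_gt0.
have d0 := dim_gt0.
have h' : M * (d%:R + 2) = 3 * d%:R^-1 by rewrite -h dE; field.
apply: (mulIf (x := d%:R + 2)); first by rewrite gt_eqF // addr_gt0.
by rewrite h'; field; rewrite !gt_eqF // addr_gt0.
Qed.

End sphere_moments.

(** * Slabs around a hyperplane *)

Section strip_geometry.
Variable R : realType.

(** The case analysis behind [strip_pathwise]: [p], [q] and [p'], [q'] are the
    absolute coordinates of a vector of the plane, of squared length [s], in two
    orthonormal frames that differ by an eighth of a turn.  The hypotheses are
    triangle inequalities, with [3 / 2] in place of [sqrt 2]. *)
Lemma strip_linear (p q p' q' s : R) :
  0 <= p -> 0 <= q -> 0 <= p' -> 0 <= q' ->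
  p <= q + 3 / 2 * p' -> p <= q + 3 / 2 * q' ->
  q <= p + 3 / 2 * p' -> q <= p + 3 / 2 * q' ->
  p' <= q' + 3 / 2 * p -> p' <= q' + 3 / 2 * q ->
  q' <= p' + 3 / 2 * p -> q' <= p' + 3 / 2 * q ->
  p <= 1 + s / 4 -> q <= 1 + s / 4 -> p' <= 1 + s / 4 -> q' <= 1 + s / 4 ->
  0 <= s ->
  q * (p <= 1 / 3)%R%:R + p * (q <= 1 / 3)%R%:R +
  (q' * (p' <= 1 / 3)%R%:R + p' * (q' <= 1 / 3)%R%:R) <= 7 / 4 + s / 4.
Proof.
move=> p0 q0 p'0 q'0 h1 h2 h3 h4 h5 h6 h7 h8 h9 h10 h11 h12 s0.
case: (leP p); case: (leP q); case: (leP p'); case: (leP q') => i1 i2 i3 i4;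
  rewrite /= ?mulr1 ?mulr0 ?addr0 ?add0r; lra.
Qed.

(** Among four equally spaced directions in the plane, at most one can be nearly
    orthogonal to a long vector; when two are, the vector is short. *)
Lemma strip_pathwise (x y : R) (c := Num.sqrt (1 / 2)) :
  `|y| * (`|x| <= 1 / 3)%R%:R + `|x| * (`|y| <= 1 / 3)%R%:R +
  (`|c * x - c * y| * (`|c * x + c * y| <= 1 / 3)%R%:R +
   `|c * x + c * y| * (`|c * x - c * y| <= 1 / 3)%R%:R)
  <= 7 / 4 + (x ^+ 2 + y ^+ 2) / 4.
Proof.
have c0 : 0 <= c := sqrtr_ge0 _.
have c2 : c ^+ 2 = 1 / 2 by rewrite sqr_sqrtr.
have cle : 2 * c <= 3 / 2.
  by have := sqr_ge0 (c - 3 / 4); rewrite sqrrB c2; lra.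
rewrite -mulrDr -mulrBr !normrM (ger0_norm c0).
set p := `|x|; set q := `|y|; set A := `|x + y|; set D := `|x - y|.
have [p0 q0 A0 D0] : [/\ 0 <= p, 0 <= q, 0 <= A & 0 <= D].
  by split; exact: normr_ge0.
have S1 : p ^+ 2 + q ^+ 2 = x ^+ 2 + y ^+ 2 by rewrite !real_normK ?num_real.
have S2 : (c * A) ^+ 2 + (c * D) ^+ 2 = x ^+ 2 + y ^+ 2.
  by rewrite !exprMn c2 !real_normK ?num_real //; field.
have AP : A <= 3 / 2 * (c * A).
  rewrite [leLHS](_ : A = 2 * c * (c * A)); last first.
    by transitivity (2 * c ^+ 2 * A); [rewrite c2; field|ring].
  by rewrite ler_wpM2r // mulr_ge0.
have DQ : D <= 3 / 2 * (c * D).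
  rewrite [leLHS](_ : D = 2 * c * (c * D)); last first.
    by transitivity (2 * c ^+ 2 * D); [rewrite c2; field|ring].
  by rewrite ler_wpM2r // mulr_ge0.
have pD : p <= q + D by rewrite /p -{1}(subrK y x) addrC ler_normD.
have qD : q <= p + D by rewrite /q /D distrC -{1}(subrK x y) addrC ler_normD.
have pA : p <= q + A by have := ler_normB (x + y) y; rewrite addrK addrC.
have qA : q <= p + A by have := ler_normB (x + y) x; rewrite addrAC subrr add0r addrC.
have AD : A <= D + 2 * q.
  rewrite /A (_ : x + y = (x - y) + 2 * y); last by ring.
  by rewrite (le_trans (ler_normD _ _)) // normrM ger0_norm.
have AD' : A <= D + 2 * p.
  rewrite /A (_ : x + y = (y - x) + 2 * x); last by ring.
  by rewrite /D (le_trans (ler_normD _ _)) // normrM [`|2|]ger0_norm // distrC.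
have DA : D <= A + 2 * q.
  rewrite /D (_ : x - y = (x + y) - 2 * y); last by ring.
  by rewrite (le_trans (ler_normB _ _)) // normrM [`|2|]ger0_norm.
have DA' : D <= A + 2 * p.
  rewrite /D (_ : x - y = 2 * x - (x + y)); last by ring.
  by rewrite [leRHS]addrC (le_trans (ler_normB _ _)) // normrM [`|2|]ger0_norm.
have cp : c * (2 * p) <= 3 / 2 * p by rewrite mulrCA mulrA ler_wpM2r.
have cq : c * (2 * q) <= 3 / 2 * q by rewrite mulrCA mulrA ler_wpM2r.
have := ler_wpM2l c0 AD; have := ler_wpM2l c0 AD'.
have := ler_wpM2l c0 DA; have := ler_wpM2l c0 DA'.
rewrite !mulrDr => DA1 DA2 DA3 DA4.
have le1 (a b : R) : a ^+ 2 + b ^+ 2 = x ^+ 2 + y ^+ 2 ->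
    a <= 1 + (x ^+ 2 + y ^+ 2) / 4.
  by move=> <-; have := sqr_ge0 (a - 2); have := sqr_ge0 b; lra.
apply: (@strip_linear p q (c * A) (c * D)) => //; rewrite ?mulr_ge0 //.
- exact: le_trans pA (lerD (lexx _) AP).
- exact: le_trans pD (lerD (lexx _) DQ).
- exact: le_trans qA (lerD (lexx _) AP).
- exact: le_trans qD (lerD (lexx _) DQ).
- exact: le_trans DA3 (lerD (lexx _) cp).
- exact: le_trans DA4 (lerD (lexx _) cq).
- exact: le_trans DA1 (lerD (lexx _) cp).
- exact: le_trans DA2 (lerD (lexx _) cq).
- exact: le1 S1.
- by apply: (le1 _ p); rewrite addrC.
- exact: le1 S2.
- by apply: (le1 _ (c * A)); rewrite addrC.
- by rewrite addr_ge0 ?sqr_ge0.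
Qed.

(** The quartic almost touches [|x|] from below near [sqrt 3], the value that
    saturates [E |X| >= (E X^2)^(3/2) / (E X^4)^(1/2)] when [E X^2 = 1] and
    [E X^4 = 3], and it is negative on the strip. *)
Lemma abs_quartic (x : R) :
  8 / 9 * x ^+ 2 - 1 / 10 * x ^+ 4 - 1 / 10 <= `|x| * (1 / 3 < `|x|)%R%:R.
Proof.
have -> : x ^+ 2 = `|x| ^+ 2 by rewrite real_normK ?num_real.
have -> : x ^+ 4 = `|x| ^+ 4 by rewrite (exprM `|x| 2 2) real_normK ?num_real // -exprM.
move: (normr_ge0 x); move: `|x| => y y0.
case: ltP => [_|h]; rewrite /= ?mulr1 ?mulr0.
  have : 0 <= (y - 7 / 4) ^+ 2 * (y ^+ 2 + 7 / 2 * y + 2 / 7).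
    by rewrite mulr_ge0 ?sqr_ge0 // !addr_ge0 ?sqr_ge0 // mulr_ge0.
  by have := sqr_ge0 y; move: y0; lra.
have : y ^+ 2 <= (1 / 3) ^+ 2 by rewrite ler_sqr ?nnegrE.
have : 0 <= y ^+ 4 by rewrite exprn_ge0.
lra.
Qed.

End strip_geometry.

Section sphere_sign.
Variables (R : realType) (d : nat) (e : 'rV[R]_d).
Hypothesis e1 : l2norm e = 1.
Variables (dO : measure_display) (Omega : measurableType dO).
Variable P : probability Omega R.
Variable Z : Omega -> 'rV[R]_d.
Hypothesis unifZ : uniform_rv P Z.
Implicit Types (u v : 'rV[R]_d).

Local Notation E := (expect P).
Let q : R := Num.sqrt d%:R.

Let q2 : q ^+ 2 = d%:R.
Proof. by rewrite sqr_sqrtr. Qed.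

Let bZ := bounded_dotp e1 unifZ.
Let bsZ := sphere_bounded_dotp e1.

Lemma expect_scaled_sqr v : dotp v v = 1 ->
  E (fun w => (q * dotp (Z w) v) ^+ 2) = 1.
Proof.
move=> v1; under [X in E X]eq_fun do rewrite exprMn.
rewrite expectZ; last by have := bZ; bounded.
by rewrite (expect_sqr e1 unifZ v1) q2 divff // gt_eqF // (dim_gt0 e1).
Qed.

Lemma expect_scaled_quad v : dotp v v = 1 ->
  E (fun w => (q * dotp (Z w) v) ^+ 4) <= 3.
Proof.
move=> v1; under [X in E X]eq_fun do rewrite exprMn.
rewrite expectZ; last by have := bZ; bounded.
rewrite (expect_quad e1 unifZ v1) (exprM q 2 2) q2.
have d0 := dim_gt0 e1.
have -> : d%:R ^+ 2 * (3 / (d%:R * (d%:R + 2))) = 3 * (d%:R / (d%:R + 2)) :> R.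
  by field; rewrite !gt_eqF // addr_gt0.
by rewrite ler_piMr // ler_pdivrMr ?mul1r ?lerDl // addr_gt0.
Qed.

(** A lower bound on a first absolute moment from the second and the fourth
    moments, which are the only ones known explicitly. *)
Lemma expect_abs_tail v : dotp v v = 1 ->
  12 / 25 <= E (fun w => `|q * dotp (Z w) v| * (1 / 3 < `|q * dotp (Z w) v|)%R%:R).
Proof.
move=> v1; have bZ' := bZ.
apply: (@le_trans _ _ (E (fun w => 8 / 9 * (q * dotp (Z w) v) ^+ 2 -
    1 / 10 * (q * dotp (Z w) v) ^+ 4 - 1 / 10))).
  rewrite !expectB ?expectZ ?expect_cst; [|bounded..].
  have := expect_scaled_quad v1.
  by rewrite (expect_scaled_sqr v1); lra.
by apply: ler_expect => [||w]; [bounded|bounded|exact: abs_quartic].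
Qed.

Section orthonormal_pair.
Variables v u : 'rV[R]_d.
Hypotheses (v1 : dotp v v = 1) (u1 : dotp u u = 1) (vu : dotp v u = 0).

Let X w := q * dotp (Z w) v.
Let Y w := q * dotp (Z w) u.

Lemma expect_planeXY (Phi : R -> R -> R) a b : a ^+ 2 + b ^+ 2 = 1 ->
  (forall v u, sphere_bounded e (fun z => Phi (q * dotp z v) (q * dotp z u))) ->
  E (fun w => Phi (X w) (Y w)) =
  E (fun w => Phi (a * X w + b * Y w) (b * X w - a * Y w)).
Proof.
move=> ab bPhi.
rewrite (expect_plane (e := e) unifZ (Phi := fun x y => Phi (q * x) (q * y))
  v1 u1 vu ab (bPhi v u)).
by congr expect; apply/funext => w; congr Phi; rewrite /X /Y; ring.
Qed.

(** Each of the four terms of [strip_pathwise] is the image of the first one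
    under an orthogonal map of the plane, so they have the same expectation. *)
Lemma expect_strip : E (fun w => `|Y w| * (`|X w| <= 1 / 3)%R%:R) <= 9 / 16.
Proof.
have bX : bounded_rv X by have := bZ; rewrite /X; bounded.
have bY : bounded_rv Y by have := bZ; rewrite /Y; bounded.
pose Phi (x y : R) := `|y| * (`|x| <= 1 / 3)%R%:R.
have bPhi v' u' : sphere_bounded e (fun z => Phi (q * dotp z v') (q * dotp z u')).
  by have := bsZ; rewrite /sphere_bounded /Phi; bounded.
pose c : R := Num.sqrt (1 / 2).
have c2 : c ^+ 2 = 1 / 2 by rewrite sqr_sqrtr.
have h1 := @expect_planeXY Phi 0 1.
have h2 := @expect_planeXY Phi c c.
rewrite expr0n expr1n add0r in h1; have {}h1 := h1 erefl bPhi.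
have {}h2 := h2 ltac:(by rewrite c2; lra) bPhi.
have h3 : E (fun w => Phi (c * X w - c * Y w) (c * X w + c * Y w)) =
    E (fun w => Phi (X w) (Y w)).
  have h := @expect_planeXY (fun x y => Phi y x) c c.
  rewrite h1 -h ?c2; [|by lra|move=> v' u'; exact: bPhi].
  by congr expect; apply/funext => w; rewrite !mul0r !mul1r add0r subr0.
set A := E (fun w => Phi (X w) (Y w)).
have : E (fun w => Phi (X w) (Y w) + Phi (Y w) (X w) +
    (Phi (c * X w + c * Y w) (c * X w - c * Y w) +
     Phi (c * X w - c * Y w) (c * X w + c * Y w))) = 4 * A.
  rewrite !expectD ?h3 -?h2; [|by rewrite /Phi; bounded..].
  have -> : E (fun w => Phi (Y w) (X w)) = A.
    rewrite /A h1; congr expect; apply/funext => w.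
    by rewrite !mul0r !mul1r add0r subr0.
  rewrite -/A; ring.
have : E (fun w => Phi (X w) (Y w) + Phi (Y w) (X w) +
    (Phi (c * X w + c * Y w) (c * X w - c * Y w) +
     Phi (c * X w - c * Y w) (c * X w + c * Y w))) <=
    E (fun w => 7 / 4 + 1 / 4 * (X w ^+ 2 + Y w ^+ 2)).
  apply: ler_expect; [by rewrite /Phi; bounded|by bounded|].
  by move=> w; apply: le_trans (strip_pathwise _ _) _; lra.
move=> + hA; rewrite hA.
rewrite !(expectD, expectZ, expect_cst); [|by bounded..].
rewrite /X /Y (expect_scaled_sqr v1) (expect_scaled_sqr u1).
move=> h; lra.
Qed.

(** The events [x + k y = 0], for [k < n], are pairwise incompatible away from
    the origin, and rotations give them all the same weight. *)
Lemma expect_null : E (fun w => `|Y w| * (X w == 0)%R%:R) = 0.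
Proof.
have bX : bounded_rv X by have := bZ; rewrite /X; bounded.
have bY : bounded_rv Y by have := bZ; rewrite /Y; bounded.
pose Phi (x y : R) := `|y| * (x == 0)%R%:R.
have bPhi v' u' : sphere_bounded e (fun z => Phi (q * dotp z v') (q * dotp z u')).
  by have := bsZ; rewrite /sphere_bounded /Phi; bounded.
set A := E _.
have A0 : 0 <= A by apply: expect_ge0 => w; rewrite mulr_ge0.
pose B := E (fun w => `|X w| + `|Y w|).
have AB n : n%:R * A <= B.
  pose s (k : 'I_n) : R := Num.sqrt (1 + k%:R ^+ 2).
  have s2 k : s k ^+ 2 = 1 + k%:R ^+ 2.
    by rewrite sqr_sqrtr // addr_ge0 // exprn_ge0.
  have s0 k : 0 < s k by rewrite sqrtr_gt0 ltr_wpDr // exprn_ge0.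
  pose a k := 1 / s k; pose b (k : 'I_n) := k%:R / s k.
  have ab k : a k ^+ 2 + b k ^+ 2 = 1.
    rewrite /a /b !exprMn exprVn expr1n -mulrDl -s2 divff //.
    by rewrite expf_neq0 // gt_eqF.
  have -> : n%:R * A = E (fun w => \sum_(k < n)
      Phi (a k * X w + b k * Y w) (b k * X w - a k * Y w)).
    rewrite expect_sum => [|k]; last by rewrite /Phi; bounded.
    rewrite (eq_bigr (fun=> A)) ?sumr_const ?card_ord ?mulr_natl // => k _.
    by rewrite -expect_planeXY.
  apply: ler_expect; [|by bounded|].
    by apply: bounded_rv_sum => k; rewrite /Phi; bounded.
  move=> w; set x := X w; set y := Y w.
  have a0 k : 0 < a k by rewrite divr_gt0.
  have bk k : b k = k%:R * a k by rewrite /a /b; field; rewrite gt_eqF.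
  have a1 k : `|a k| <= 1.
    rewrite gtr0_norm // -(@ler_pXn2r _ 2) ?nnegrE ?(ltW (a0 k)) // expr1n -(ab k).
    by rewrite lerDl sqr_ge0.
  have b1 k : `|b k| <= 1.
    rewrite -[leRHS]ger0_norm // -ler_sqr ?normr_ge0 // ?nnegrE //.
    by rewrite !real_normK ?num_real // expr1n -(ab k) lerDr sqr_ge0.
  have le1 k : Phi (a k * x + b k * y) (b k * x - a k * y) <=
      (`|x| + `|y|) * (x + k%:R * y == 0)%R%:R.
    rewrite /Phi bk -[a k * x + _]/(_ + _) (_ : a k * x + k%:R * a k * y =
      a k * (x + k%:R * y)); last by ring.
    rewrite mulf_eq0 gt_eqF //= ler_wpM2r //.
    by rewrite -bk (le_trans (ler_normB _ _)) // lerD // normrM ler_piMl.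
  apply: (@le_trans _ _
    (\sum_(k < n) (`|x| + `|y|) * (x + k%:R * y == 0)%R%:R)).
    by apply: ler_sum => k _; exact: le1.
  rewrite -mulr_sumr.
  have [y0|y0] := eqVneq y 0.
    have [x0|x0] := eqVneq x 0; first by rewrite x0 y0 normr0 addr0 mul0r.
    by rewrite big1 ?mulr0 ?addr_ge0 // => k _; rewrite y0 mulr0 addr0 (negbTE x0).
  rewrite ler_piMr ?addr_ge0 // -natr_sum -[leRHS]/(1%:R) ler_nat.
  have [k0 k0E|none] := pickP (fun k : 'I_n => x + k%:R * y == 0); last first.
    by rewrite big1 // => k _; rewrite none.
  rewrite (bigD1 k0) //= k0E big1 // => k kk0.
  apply/eqP; rewrite eqb0; apply: contra kk0 => /eqP kE.
  move: k0E; rewrite -kE (inj_eq (addrI _)) => /eqP.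
  by move=> /(mulIf y0)/eqP; rewrite eqr_nat => /eqP kk; apply/eqP/val_inj/esym.
apply/eqP; rewrite eq_le A0 andbT leNgt; apply/negP => Agt0.
have := AB (Num.truncn (B / A)).+1.
rewrite leNgt => /negP; apply.
by rewrite -ltr_pdivrMr // truncnS_gt.
Qed.

(** By symmetry each half of the strip carries half of the weight, up to the
    weight of the hyperplane [X = 0], which both halves contain. *)
Lemma expect_half_strip :
  E (fun w => `|Y w| * ((- (1 / 3) <= X w)%R%:R * (X w <= 0)%R%:R)) <= 9 / 32.
Proof.
have bX : bounded_rv X by have := bZ; rewrite /X; bounded.
have bY : bounded_rv Y by have := bZ; rewrite /Y; bounded.
pose Phi (x y : R) := `|y| * ((- (1 / 3) <= x)%R%:R * (x <= 0)%R%:R).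
have bPhi v' u' : sphere_bounded e (fun z => Phi (q * dotp z v') (q * dotp z u')).
  by have := bsZ; rewrite /sphere_bounded /Phi; bounded.
have h := @expect_planeXY Phi (-1) 0.
rewrite sqrrN expr1n expr0n addr0 in h; have {}h := h erefl bPhi.
set A := E _.
have hA : E (fun w => Phi (X w) (Y w)) = A by [].
have h2 : E (fun w => Phi (- X w) (Y w)) = A.
  rewrite -hA h; congr expect; apply/funext => w; rewrite /Phi.
  by rewrite !mul0r addr0 sub0r !mulN1r opprK.
have : E (fun w => Phi (X w) (Y w) + Phi (- X w) (Y w)) <=
    E (fun w => `|Y w| * (`|X w| <= 1 / 3)%R%:R + `|Y w| * (X w == 0)%R%:R).
  apply: ler_expect; [by rewrite /Phi; bounded|by bounded|move=> w].
  rewrite /Phi -!mulrDr ler_wpM2l // oppr_le0 lerN2.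
  move: (X w) => x; have [x0|x0|->] := ltgtP x 0.
  - by rewrite (ltr0_norm x0) [- x <= _]lerNl /= mulr1 mulr0.
  - by rewrite (gtr0_norm x0) /= mulr0 mulr1 add0r addr0.
  - have t0 : 0 <= 1 / 3 :> R by rewrite divr_ge0.
    by rewrite normr0 oppr_le0 t0 !mulr1.
rewrite !expectD; [|by rewrite /Phi; bounded..].
rewrite expect_null hA h2.
have := expect_strip; lra.
Qed.

End orthonormal_pair.

End sphere_sign.

(** * Correlation of the comparison sign with the direction *)

(** Here [v] is the direction of the gradient and [sigma z] the sign of the
    increment of the objective in the direction [z]: it agrees with the sign of
    [dotp z v], except possibly in a thin slab on the negative side. *)
Section correlation.
Variables (R : realType) (d : nat) (e : 'rV[R]_d).
Hypothesis e1 : l2norm e = 1.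
Variables (dO : measure_display) (Omega : measurableType dO).
Variable P : probability Omega R.
Variable Z : Omega -> 'rV[R]_d.
Hypothesis unifZ : uniform_rv P Z.
Implicit Types (u v g : 'rV[R]_d).

Local Notation E := (expect P).
Let q : R := Num.sqrt d%:R.
Let bZ := bounded_dotp e1 unifZ.
Let bsZ := sphere_bounded_dotp e1.
Let Z1 w : l2norm (Z w) = 1.
Proof. by case: unifZ. Qed.

Variables (v : 'rV[R]_d) (sigma : 'rV[R]_d -> R).
Hypothesis v1 : dotp v v = 1.
Hypothesis bsigma : sphere_bounded e sigma.
Hypothesis sigma1 : forall z, `|sigma z| <= 1.
Hypothesis sigma_pos : forall z, l2norm z = 1 -> 0 < dotp z v -> sigma z = 1.
Hypothesis sigma_neg : forall z, l2norm z = 1 -> q * dotp z v < - (1 / 3) ->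
  sigma z = - 1.

Let X w := q * dotp (Z w) v.
Let sg w := sigma (Z w).

Let bX : bounded_rv X.
Proof. by have := bZ; rewrite /X; bounded. Qed.
Let bsg : bounded_rv sg.
Proof. exact (bounded_sphere unifZ bsigma). Qed.
Let q0 : 0 < q.
Proof. by rewrite sqrtr_gt0 (dim_gt0 e1). Qed.
Let sg1 w : `|sg w| <= 1.
Proof. exact: sigma1. Qed.
Let sg_pos w : 0 < X w -> sg w = 1.
Proof. by move=> Xw; apply: sigma_pos => //; rewrite -(pmulr_rgt0 _ q0). Qed.
Let sg_neg w : X w < - (1 / 3) -> sg w = - 1.
Proof. by move=> Xw; apply: sigma_neg. Qed.

(** Inside the strip the sign may be wrong, but only on the side [X <= 0]; there
    [sigma X >= X], and the integral of [X] over the symmetric strip vanishes. *)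
Lemma expect_sign_parallel : 12 / 25 <= E (fun w => sg w * X w).
Proof.
pose S w : R := X w * (`|X w| <= 1 / 3)%R%:R.
have bS : bounded_rv S by rewrite /S; have := bX; bounded.
have S0 : E S = 0.
  have h : E S = E (fun w => - S w).
    have bPhi : sphere_bounded e
        (fun z => q * dotp z v * (`|q * dotp z v| <= 1 / 3)%R%:R).
      by have := bsZ; rewrite /sphere_bounded; bounded.
    rewrite /S /X (expect_dir (e := e) unifZ
      (phi := fun x => q * x * (`|q * x| <= 1 / 3)%R%:R) (v := - v) _ bPhi).
      congr expect; apply/funext => w.
      by rewrite dotpNr mulrN normrN mulNr.
    by rewrite !dotpE opprK.
  by move: h; rewrite expectN //; lra.
apply: le_trans (expect_abs_tail e1 unifZ v1) _; rewrite -/q.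
have -> : E (fun w => sg w * X w) = E (fun w => sg w * X w - S w).
  by rewrite expectB ?S0 ?subr0 //; bounded.
apply: ler_expect; [by have := bX; rewrite /X; bounded|by bounded|].
move=> w; rewrite -/(X w) /S; have := sg1 w; rewrite ler_norml => /andP[s1 s2].
have [X0|X0] := ltP 0 (X w).
  rewrite sg_pos // mul1r (gtr0_norm X0).
  by case: (leP (X w)) => _ /=; rewrite ?mulr0 ?mulr1 ?subr0 mul1r ?subrr.
rewrite (ler0_norm X0).
case: (leP (- X w)) => h /=; last first.
  rewrite (sg_neg (_ : X w < - (1 / 3))); last by rewrite ltrNr.
  by rewrite mulr0 mulr1 subr0 mulN1r.
rewrite mulr0 mulr1 subr_ge0.
by have := mulr_ge0_le0 (_ : 0 <= 1 - sg w) X0; rewrite subr_ge0 => /(_ s2); lra.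
Qed.

(** Off the half strip [- 1 / 3 <= X <= 0] the sign is a function of [X] alone,
    hence uncorrelated with the orthogonal component [Y]. *)
Lemma expect_sign_orthogonal u : dotp u u = 1 -> dotp v u = 0 ->
  E (fun w => sg w * (q * dotp (Z w) u)) <= 9 / 32.
Proof.
move=> u1 vu; pose Y w := q * dotp (Z w) u.
have bY : bounded_rv Y by have := bZ; rewrite /Y; bounded.
pose phi (x : R) : R := (0 < x)%R%:R - (x < - (1 / 3))%R%:R.
pose S w : R := phi (X w) * Y w.
have bS : bounded_rv S by rewrite /S /phi; have := bX; bounded.
have S0 : E S = 0.
  have h : E S = E (fun w => - S w).
    have := @expect_planeXY _ _ e _ _ _ _ unifZ _ _ v1 u1 vu
      (fun x y => phi x * y) 1 0.
    rewrite expr1n expr0n addr0 => /(_ erefl) -> //.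
      congr expect; apply/funext => w; rewrite /S !mul0r !mul1r addr0 sub0r.
      by rewrite mulrN.
    by move=> v' u'; rewrite /phi /sphere_bounded; have := bsZ; bounded.
  by move: h; rewrite expectN //; lra.
apply: le_trans (expect_half_strip e1 unifZ v1 u1 vu).
have -> : E (fun w => sg w * (q * dotp (Z w) u)) = E (fun w => sg w * Y w - S w).
  by rewrite expectB ?S0 ?subr0 //; bounded.
apply: ler_expect.
- by bounded.
- by have := bX; rewrite /X /Y; bounded.
move=> w; rewrite -/(X w) -/(Y w) /S /phi -mulrBl.
have := sg1 w; rewrite ler_norml => /andP[s1 s2].
have Y1 : Y w <= `|Y w| := ler_norm _.
have Y2 : - Y w <= `|Y w| by rewrite -normrN ler_norm.
have [X0|X0] := ltP 0 (X w).
  rewrite sg_pos // ltNge (_ : - (1 / 3) <= X w); last by lra.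
  by rewrite /= subr0 subrr mul0r mulr_ge0.
have [h|h] := ltP (X w).
  by rewrite sg_neg //= sub0r subrr mul0r mulr_ge0.
rewrite /= subr0 subr0 !mulr1 -[leRHS]mul1r.
by rewrite (le_trans (ler_norm _)) // normrM ler_wpM2r.
Qed.

(** Write [v - g = (1 - a) v - u'] with [u'] orthogonal to [v] and [a <= 1 / 3].
    The length of [u'] is at most [sqrt (1 - a^2) <= 3 / 2 (1 - a)], so that the
    loss [9 / 32 * 3 / 2 = 27 / 64] along [u'] stays below the gain [12 / 25]
    along [v]. *)
Lemma expect_sign_correlation g : dotp g g <= 1 -> dotp v g <= 1 / 3 ->
  1 / 30 <= E (fun w => sg w * (q * dotp (Z w) (v - g))).
Proof.
move=> g1 vg; set a := dotp v g in vg; pose u' := g - a *: v.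
have vu' : dotp v u' = 0 by rewrite /u' !dotpE v1 mulr1 subrr.
have u'2 : dotp u' u' = dotp g g - a ^+ 2.
  by rewrite /u' !dotpE (dotpC g v) v1 -/a; ring.
set b := l2norm u'.
have b0 : 0 <= b := l2norm_ge0 _.
have b2 : b ^+ 2 = dotp u' u' by rewrite sqr_l2norm.
have ble : b <= 3 / 2 * (1 - a).
  rewrite -ler_sqr ?nnegrE //; last by lra.
  rewrite b2 u'2 exprMn.
  have : 0 <= (1 - a) * (1 / 3 - a) by rewrite mulr_ge0 ?subr_ge0 //; lra.
  by move: g1; nra.
have par := expect_sign_parallel.
have -> : (fun w => sg w * (q * dotp (Z w) (v - g))) =
    (fun w => (1 - a) * (sg w * X w) - sg w * (q * dotp (Z w) u')).
  by apply/funext => w; rewrite /X /u' !dotpE; ring.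
have bXX := bX; have bsgg := bsg; have bZZ := bZ.
rewrite expectB ?expectZ; [|bounded..].
have orth : E (fun w => sg w * (q * dotp (Z w) u')) <= 9 / 32 * b.
  have [b_0|bn0] := eqVneq b 0.
    rewrite b_0 mulr0 (l2norm_eq0 b_0).
    under [X in E X]eq_fun do rewrite dotp0r !mulr0.
    by rewrite expect_cst.
  have bgt0 : 0 < b by rewrite lt_def bn0.
  have uu : dotp (b^-1 *: u') (b^-1 *: u') = 1.
    by rewrite dotpZl dotpZr -b2; field.
  have vu : dotp v (b^-1 *: u') = 0 by rewrite dotpZr vu' mulr0.
  have := expect_sign_orthogonal uu vu.
  rewrite -(ler_pM2l bgt0) [leRHS]mulrC; congr (_ <= _).
  rewrite -expectZ; last by bounded.
  by congr expect; apply/funext => w; rewrite dotpZr; field.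
have : (1 - a) * (12 / 25) <= (1 - a) * E (fun w => sg w * X w).
  by rewrite ler_wpM2l //; lra.
lra.
Qed.

End correlation.

(** * Exponential moments of a random direction *)

Section exponential_moments.
Variable R : realType.

(** Near the origin this follows from [1 + x <= exp x]; the duplication formula
    [cosh (2 x) = 2 cosh(x)^2 - 1] and [2 y^2 - 1 <= y^4] propagate it. *)
Lemma cosh_le (x : R) : (expR x + expR (- x)) / 2 <= expR (x ^+ 2).
Proof.
have base (y : R) : `|y| <= 1 / 2 -> (expR y + expR (- y)) / 2 <= expR (y ^+ 2).
  rewrite ler_norml => /andP[y1 y2]; apply: le_trans (expR_ge1Dx _).
  have half (t : R) : - (1 / 2) <= t -> t <= 1 / 2 ->
      expR t * (1 - t / 2) ^+ 2 <= 1.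
    move=> t1 t2; have p0 : 0 <= 1 - t / 2 by lra.
    have -> : expR t = expR (t / 2) ^+ 2 by rewrite -expRM_natl; congr expR; field.
    rewrite -[leRHS](expr1n _ 2) -exprMn ler_sqr ?nnegrE ?mulr_ge0 ?expR_ge0 //.
    have := expR_ge1Dx (- (t / 2)); rewrite expRN => h'.
    by rewrite mulrC -ler_pdivlMr ?expR_gt0 // div1r.
  have h1 := half y y1 y2.
  have h2 : expR (- y) * (1 + y / 2) ^+ 2 <= 1.
    by have := half (- y); rewrite mulNr opprK; apply; lra.
  have y2le : y ^+ 2 <= 1 / 4.
    have : 0 <= (1 / 2 - y) * (1 / 2 + y) by apply: mulr_ge0; lra.
    lra.
  set a := expR y in h1 *; set b := expR (- y) in h2 *.
  have a0 : 0 <= a := expR_ge0 _; have b0 : 0 <= b := expR_ge0 _.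
  set u := y ^+ 2 / 4.
  have u0 : 0 <= u by rewrite divr_ge0 ?sqr_ge0.
  have D0 : 0 < (1 - u) ^+ 2 by rewrite exprn_gt0 //; rewrite /u; lra.
  rewrite -(ler_pM2r D0).
  have e1 : a * (1 - u) ^+ 2 <= (1 + y / 2) ^+ 2.
    rewrite (_ : (1 - u) ^+ 2 = (1 - y / 2) ^+ 2 * (1 + y / 2) ^+ 2); last first.
      by rewrite /u; field.
    by rewrite mulrA ler_piMl ?sqr_ge0.
  have e2 : b * (1 - u) ^+ 2 <= (1 - y / 2) ^+ 2.
    rewrite (_ : (1 - u) ^+ 2 = (1 + y / 2) ^+ 2 * (1 - y / 2) ^+ 2); last first.
      by rewrite /u; field.
    by rewrite mulrA ler_piMl ?sqr_ge0.
  apply: (@le_trans _ _ (1 + u)).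
    by move: e1 e2; rewrite /u; lra.
  have k1 : 0 <= u * (1 - 7 * u) by rewrite mulr_ge0 //; rewrite /u; lra.
  have k2 : 0 <= u * u ^+ 2 by rewrite mulr_ge0 // sqr_ge0.
  rewrite (_ : y ^+ 2 = 4 * u); last by rewrite /u; field.
  by move: k1 k2; lra.
suff main n (y : R) : `|y| <= 2 ^+ n / 2 -> (expR y + expR (- y)) / 2 <= expR (y ^+ 2).
  apply: (main (Num.truncn (2 * `|x|)).+1).
  rewrite ler_pdivlMr // mulrC (le_trans (ltW (truncnS_gt _))) //.
  by rewrite -natrX ler_nat ltnW // ltn_expl.
elim: n y => [|n IH] y; first by rewrite expr0; exact: base.
move=> hy; have hy2 : `|y / 2| <= 2 ^+ n / 2.
  rewrite normrM [`|2^-1|]ger0_norm //.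
  by move: hy; rewrite exprS; lra.
have := IH _ hy2.
set h := expR (y / 2); set h' := expR (- (y / 2)); set k := expR ((y / 2) ^+ 2).
move=> le1.
have hh : h * h' = 1 by rewrite /h /h' -expRD subrr expR0.
have -> : expR y = h ^+ 2 by rewrite -expRM_natl; congr expR; field.
have -> : expR (- y) = h' ^+ 2 by rewrite -expRM_natl; congr expR; field.
have -> : expR (y ^+ 2) = k ^+ 4 by rewrite -expRM_natl; congr expR; field.
have h0 : 0 <= (h + h') / 2 by rewrite divr_ge0 ?addr_ge0 ?expR_ge0.
have : ((h + h') / 2) ^+ 2 <= k ^+ 2 by rewrite ler_sqr ?nnegrE ?expR_ge0.
have := sqr_ge0 (k ^+ 2 - 1).
have -> : (h ^+ 2 + h' ^+ 2) / 2 = 2 * ((h + h') / 2) ^+ 2 - h * h' by field.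
rewrite hh; lra.
Qed.

Variables (d : nat) (e : 'rV[R]_d).
Hypothesis e1 : l2norm e = 1.
Variables (dO : measure_display) (Omega : measurableType dO).
Variable P : probability Omega R.
Variable Z : Omega -> 'rV[R]_d.
Hypothesis unifZ : uniform_rv P Z.

(** By invariance [theta] may be replaced by a vector with equal coordinates;
    invariance under changes of signs then reduces the claim to a Rademacher
    sum whose coefficients are multiples of the coordinates of [Z], the squares
    of which add up to [1]. *)
Lemma expect_exp_dotp (theta : 'rV[R]_d) :
  expect P (fun w => expR (dotp (Z w) theta)) <= expR (dotp theta theta / d%:R).
Proof.
have bZ := bounded_dotp e1 unifZ; have bsZ := sphere_bounded_dotp e1.
have d0 := dim_gt0 e1.
pose c : R := Num.sqrt (dotp theta theta / d%:R).
have c2 : c ^+ 2 = dotp theta theta / d%:R.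
  by rewrite sqr_sqrtr // divr_ge0 ?dotp_ge0.
pose v (eps : {ffun 'I_d -> bool}) : 'rV[R]_d := \row_i ((-1) ^+ eps i * c).
have vv eps : dotp theta theta = dotp (v eps) (v eps).
  rewrite [RHS]/dotp (eq_bigr (fun=> c ^+ 2)) => [|i _]; last first.
    by rewrite /v !mxE mulrACA -expr2 sqrr_sign mul1r -expr2.
  by rewrite sumr_const card_ord -mulr_natl c2 mulrC divfK ?gt_eqF.
have Eeps eps : expect P (fun w => expR (dotp (Z w) theta)) =
    expect P (fun w => expR (dotp (Z w) (v eps))).
  apply: (expect_dir (e := e) unifZ (vv eps)).
  by rewrite /sphere_bounded; bounded.
set M := expect P _ in Eeps *.
have cE : (#|{ffun 'I_d -> bool}|%:R : R) = 2 ^+ d.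
  by rewrite card_ffun card_bool card_ord natrX.
have p2 : 0 < 2 ^+ d :> R by rewrite exprn_gt0.
rewrite -(ler_pM2l p2).
have -> : 2 ^+ d * M =
    expect P (fun w => \sum_(eps : {ffun 'I_d -> bool}) expR (dotp (Z w) (v eps))).
  rewrite expect_sum; last by move=> eps; bounded.
  rewrite (eq_bigr (fun=> M)); last by move=> eps _; rewrite -Eeps.
  by rewrite sumr_const -cE mulr_natl.
rewrite -[leRHS](expect_cst P); apply: ler_expect.
- by apply: bounded_rv_sum => eps; bounded.
- exact: bounded_rv_cst.
move=> w.
have -> : \sum_(eps : {ffun 'I_d -> bool}) expR (dotp (Z w) (v eps)) =
    \prod_(i < d) \sum_(b : bool) expR ((-1) ^+ b * (c * Z w 0 i)).
  rewrite bigA_distr_bigA /=; apply: eq_bigr => eps _.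
  rewrite -expR_sum; congr expR; apply: eq_bigr => i _.
  by rewrite /v mxE; ring.
apply: (@le_trans _ _ (\prod_(i < d) (2 * expR (c ^+ 2 * Z w 0 i ^+ 2)))).
  apply: ler_prod => i _; apply/andP; split.
    by apply: sumr_ge0 => b _; exact: expR_ge0.
  rewrite big_bool /= expr1 expr0 mul1r mulN1r addrC -exprMn.
  by have := cosh_le (c * Z w 0 i); lra.
rewrite big_split /= prodr_const card_ord -expR_sum -mulr_sumr.
have [_ Z1 _] := unifZ.
have -> : \sum_(i < d) Z w 0 i ^+ 2 = 1.
  by rewrite -(sum_sqr_coord (Z1 w)); apply: eq_bigr => i _; rewrite dotp_delta.
by rewrite mulr1 c2.
Qed.

End exponential_moments.

(** * Products over independent coordinates *)

Section grouping.
Variables (R : realType) (dO : measure_display) (Omega : measurableType dO).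
Variable P : probability Omega R.
Variables (I : finType) (S : I -> set (set Omega)).
Implicit Types (K : {set I}).

(** The pi-system of the events decided by the coordinates in [K]. *)
Definition cylinders K : set (set Omega) :=
  [set B | exists2 A : I -> set Omega, (forall i, i \in K -> S i (A i)) &
           B = \bigcap_(i in [set` K]) A i].

Hypothesis SI : forall i, setI_closed (S i).
Hypothesis ST : forall i, S i setT.
Hypothesis Sm : forall i, S i `<=` measurable.

Lemma cylinders_setI K : setI_closed (cylinders K).
Proof.
move=> _ _ [A SA ->] [B SB ->]; exists (fun i => A i `&` B i).
  by move=> i iK; apply: SI; [exact: SA|exact: SB].
by rewrite bigcapI.
Qed.

Lemma cylinders_measurable K : cylinders K `<=` measurable.
Proof.
move=> _ [A SA ->]; apply: fin_bigcap_measurable; first exact: finite_finset.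
by move=> i iK; apply: Sm; exact: SA.
Qed.

Lemma cylinders_sub K K' : K \subset K' -> cylinders K `<=` cylinders K'.
Proof.
move=> /fintype.subsetP KK' _ [A SA ->].
exists (fun i => if i \in K then A i else setT).
  by move=> i _; case: ifPn => // iK; exact: SA.
apply/seteqP; split => w h i /=; first by case: ifPn => // iK _; exact: h.
by move=> iK; have := h i (KK' _ iK); rewrite /= iK.
Qed.

Lemma cylinders_one K i A : i \in K -> S i A -> cylinders K A.
Proof.
move=> iK SA; apply: (@cylinders_sub [set i]%SET); first by rewrite finset.sub1set.
exists (fun=> A) => [j|]; first by rewrite inE => /eqP ->.
apply/seteqP; split => w //=; first by move=> wA j _.
by apply; rewrite /= inE.
Qed.

Lemma measurable_cylinders dT (T : measurableType dT) (f : Omega -> T) K i :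
  i \in K -> (forall B, measurable B -> S i (f @^-1` B)) ->
  measurable_fun setT (f : g_sigma_algebraType (cylinders K) -> T).
Proof.
move=> iK Sf _ B mB; rewrite setTI.
by apply: sub_sigma_algebra; apply: (cylinders_one iK); exact: Sf.
Qed.

Lemma measurable_cylinders_sub dT (T : measurableType dT) (f : Omega -> T) K K' :
  K \subset K' -> measurable_fun setT (f : g_sigma_algebraType (cylinders K) -> T) ->
  measurable_fun setT (f : g_sigma_algebraType (cylinders K') -> T).
Proof.
move=> KK' mf mT B mB; have := mf measurableT B mB.
by apply: sub_smallest2r; [exact: smallest_sigma_algebra|exact: cylinders_sub].
Qed.

Hypothesis indepS : mutually_independent P S.

Lemma indep_cylinders K K' : (forall i, i \in K -> i \notin K') ->
  indep_sets P (cylinders K) (cylinders K').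
Proof.
move=> KK' _ _ [A SA ->] [B SB ->].
pose C i := if i \in K then A i else B i.
have CK i : i \in K -> C i = A i by rewrite /C => ->.
have CK' i : i \in K' -> C i = B i.
  by move=> iK'; rewrite /C; case: ifPn => // /KK'; rewrite iK'.
have SC i : i \in K :|: K' -> S i (C i).
  by rewrite inE => /orP[iK|iK']; [rewrite CK //; exact: SA|rewrite CK' //; exact: SB].
have mcap (J : {set I}) (D : I -> set Omega) : (forall i, i \in J -> S i (D i)) ->
    measurable (\bigcap_(i in [set` J]) D i).
  by move=> SD; apply: (@cylinders_measurable J); exists D.
have -> : \bigcap_(i in [set` K]) A i `&` \bigcap_(i in [set` K']) B i =
    \bigcap_(i in [set` K :|: K']) C i.
  apply/seteqP; split => [w [wA wB] i|w wC].
    by rewrite /= inE => /orP[iK|iK]; [rewrite CK //; exact: wA|rewrite CK' //; exact: wB].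
  split=> i iK; [rewrite -CK //|rewrite -CK' //]; apply: wC.
    by rewrite /= inE (_ : i \in K).
  by rewrite /= inE (_ : i \in K') // orbT.
rewrite -[LHS]fineK ?fin_num_measure //; last exact: mcap.
rewrite -[X in (X * _)%E]fineK ?fin_num_measure //; last exact: mcap.
rewrite -[X in (_ * X)%E]fineK ?fin_num_measure //; last exact: mcap.
rewrite (indepS SC) (indepS SA) (indepS SB) -EFinM; congr EFin.
rewrite (eq_bigl (mem [predU K & K'])) => [|i]; last by rewrite !inE.
rewrite bigU /=; last first.
  by rewrite disjoint_subset; apply/fintype.subsetP => i iK; rewrite inE KK'.
congr (_ * _).
  by apply: eq_bigr => i iK; rewrite CK.
by apply: eq_bigr => i iK; rewrite CK'.
Qed.

(** A chain of conditionings: given [V] and the factors of the tail, the block of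
    coordinates [K j] is fresh, so the factor [G j] contributes at most [M].  The
    induction carries the union of the blocks used so far. *)
Lemma integral_prod_le (J : eqType) d0 (T0 : measurableType d0)
    d1 (T1 : measurableType d1) (V : Omega -> T0) (W : J -> Omega -> T1)
    (K0 : {set I}) (K : J -> {set I}) (G : J -> T0 * T1 -> R) (M : R) :
  0 <= M ->
  measurable_fun setT (V : g_sigma_algebraType (cylinders K0) -> T0) ->
  (forall j, measurable_fun setT (W j : g_sigma_algebraType (cylinders (K j)) -> T1)) ->
  (forall j i, i \in K j -> i \notin K0) ->
  (forall j k i, j != k -> i \in K j -> i \notin K k) ->
  (forall j, measurable_fun setT (G j)) -> (forall j q, 0 <= G j q) ->
  (forall j v, (\int[P]_w (G j (v, W j w))%:E <= M%:E)%E) ->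
  forall s : seq J, uniq s ->
  (\int[P]_w (\prod_(j <- s) G j (V w, W j w))%:E <= (M ^+ size s)%:E)%E.
Proof.
move=> M0 mV mW KK0 KK mG G0 GM; elim => [_|j s IH /= /andP[js us]].
  under eq_integral do rewrite big_nil.
  by rewrite expr0 integral_cst // [X in (_ * X)%E]probability_setT mul1e.
pose K1 := finset (fun i => (i \in K0) || has (fun k => i \in K k) s).
have dis i : i \in K1 -> i \notin K j.
  apply: contraL => ij; rewrite inE negb_or (KK0 j i ij) /=.
  by apply/hasPn => k ks; apply: KK ij; apply: contraNneq js => ->.
have mV1 : measurable_fun setT (V : g_sigma_algebraType (cylinders K1) -> T0).
  apply: measurable_cylinders_sub mV; apply/fintype.subsetP => i iK0.
  by rewrite inE iK0.
pose Pi w := \prod_(k <- s) G k (V w, W k w).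
have mPi : measurable_fun setT (Pi : g_sigma_algebraType (cylinders K1) -> R).
  apply: measurable_prod => k ks; apply: measurableT_comp; first exact: mG.
  apply: measurable_fun_pair => //.
  apply: measurable_cylinders_sub (mW k); apply/fintype.subsetP => i ik.
  by rewrite inE; apply/orP; right; apply/hasP; exists k.
have Pi0 w : 0 <= Pi w by apply: prodr_ge0 => k _; exact: G0.
have mPiO : measurable_fun setT Pi.
  move=> _ B mB; have := mPi measurableT B mB.
  apply: smallest_sub; last exact: cylinders_measurable.
  exact: sigma_algebra_measurable.
pose Phi (q : g_sigma_algebraType (cylinders K1) *
    g_sigma_algebraType (cylinders (K j))) : \bar R :=
  (Pi q.1 * G j (V q.1, W j q.2))%:E.
have -> : (\int[P]_w (\prod_(k <- j :: s) G k (V w, W k w))%:E =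
    \int[P]_w Phi (w, w))%E.
  by apply: eq_integral => w _; rewrite big_cons mulrC.
rewrite decoupling; first last.
- by move=> q; rewrite lee_fin mulr_ge0.
- apply/measurable_EFinP; apply: measurable_funM.
    by apply: (measurableT_comp mPi); exact: measurable_fst.
  apply: (measurableT_comp (mG j)); apply: measurable_fun_pair.
    by apply: (measurableT_comp mV1); exact: measurable_fst.
  by apply: (measurableT_comp (mW j)); exact: measurable_snd.
- exact: indep_cylinders.
- exact: cylinders_measurable.
- exact: cylinders_measurable.
- exact: cylinders_setI.
- exact: cylinders_setI.
have mVO : measurable_fun setT V.
  move=> _ B mB; have := mV measurableT B mB.
  apply: smallest_sub; last exact: cylinders_measurable.
  exact: sigma_algebra_measurable.
have mWO : measurable_fun setT (W j).
  move=> _ B mB; have := mW j measurableT B mB.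
  apply: smallest_sub; last exact: cylinders_measurable.
  exact: sigma_algebra_measurable.
apply: (@le_trans _ _ (\int[P]_w (M%:E * (Pi w)%:E))%E).
  apply: ge0_le_integral => //.
  - by move=> w _; apply: integral_ge0 => w' _; rewrite lee_fin mulr_ge0.
  - pose F (q : Omega * Omega) : \bar R := (Pi q.1 * G j (V q.1, W j q.2))%:E.
    apply: (@measurable_fun_fubini_tonelli_F _ _ _ _ R P F).
    + apply/measurable_EFinP; apply: measurable_funM.
        by apply: (measurableT_comp mPiO); exact: measurable_fst.
      apply: (measurableT_comp (mG j)); apply: measurable_fun_pair.
        by apply: (measurableT_comp mVO); exact: measurable_fst.
      by apply: (measurableT_comp mWO); exact: measurable_snd.
    + by move=> q; rewrite lee_fin mulr_ge0.
  - apply/(@measurable_EFinP _ _ _ _ (fun w => M * Pi w)).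
    by apply: measurable_funM.
  - move=> w _; rewrite /Phi /=.
    under eq_integral do rewrite EFinM.
    rewrite ge0_integralZl ?lee_fin //; first last.
    + by move=> w' _; rewrite lee_fin.
    + apply/measurable_EFinP; apply: (measurableT_comp (mG j)).
      exact: measurable_fun_pair.
    by rewrite muleC lee_wpmul2r ?lee_fin.
rewrite ge0_integralZl //; last 2 first.
- by apply/measurable_EFinP.
- by move=> w _; rewrite lee_fin.
by rewrite exprS EFinM lee_wpmul2l ?lee_fin //; exact: IH.
Qed.

End grouping.

(** * Deviations tested on sparse directions *)

Section exponential_mixture.
Variables (R : realType) (N : nat) (a : R).
Hypothesis a0 : 0 <= a.

(** For a vector with Gaussian exponential moments but dependent coordinates,
    products of functions of the coordinates are easy to integrate when these
    functions are sums of exponentials.  The mixture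
    [1 + a sum_k exp (- k^2) (exp (k x) + exp (- k x))] is such a sum; it dominates
    [exp] of a truncated square, and its Gaussian expectation is close to one.
    A single index type for its terms lets [bigA_distr_bigA] expand products. *)
Definition mix_weight (o : unit + ('I_N.+1 * bool)) : R :=
  if o is inr (k, _) then a * expR (- k%:R ^+ 2) else 1.

Definition mix_slope (o : unit + ('I_N.+1 * bool)) : R :=
  if o is inr (k, b) then (-1) ^+ b * k%:R else 0.

Definition mixture (x : R) : R :=
  \sum_(o : unit + ('I_N.+1 * bool)) mix_weight o * expR (mix_slope o * x).

Lemma mix_weight_ge0 o : 0 <= mix_weight o.
Proof. by case: o => [_|[k b]] //=; rewrite mulr_ge0 ?expR_ge0. Qed.

Lemma mixture_term o x : mix_weight o * expR (mix_slope o * x) <= mixture x.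
Proof.
rewrite /mixture (bigD1 o) //= lerDl sumr_ge0 // => o' _.
by rewrite mulr_ge0 ?mix_weight_ge0 ?expR_ge0.
Qed.

Lemma mixture_ge1 x : 1 <= mixture x.
Proof. by have := mixture_term (inl tt) x; rewrite /= mul0r expR0 mulr1. Qed.

(** The exponent [k |x| - k^2] is maximal for the integer [k] nearest to
    [|x| / 2]. *)
Lemma mixture_ge x : `|x| <= N%:R -> a * expR (x ^+ 2 / 4 - 1 / 4) <= mixture x.
Proof.
move=> xN; have y0 : 0 <= `|x| / 2 + 1 / 2 by rewrite addr_ge0 ?divr_ge0.
pose k := Num.truncn (`|x| / 2 + 1 / 2).
have k1 : k%:R <= `|x| / 2 + 1 / 2 by rewrite /k -truncn_ge_nat.
have k2 : `|x| / 2 + 1 / 2 < k%:R + 1 by rewrite natr1; exact: truncnS_gt.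
have kN : (k < N.+1)%N.
  by rewrite -(ltr_nat R) -[N.+1%:R]natr1; have := ler0n R N; lra.
apply: le_trans (mixture_term (inr (Ordinal kN, x < 0)) x) => /=.
rewrite -mulrA ler_wpM2l // -expRD ler_expR.
have -> : (-1) ^+ (x < 0)%R * k%:R * x = k%:R * `|x|.
  by rewrite mulrAC -normrEsign mulrC.
have -> : x ^+ 2 = `|x| ^+ 2 by rewrite real_normK ?num_real.
have : 0 <= (1 / 2 - (`|x| / 2 - k%:R)) * (1 / 2 + (`|x| / 2 - k%:R)).
  by apply: mulr_ge0; lra.
lra.
Qed.

Lemma sum_half n : \sum_(k < n) (1 / 2) ^+ k <= 2 :> R.
Proof.
have -> : \sum_(k < n) (1 / 2) ^+ k = 2 - 2 * (1 / 2) ^+ n :> R.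
  elim: n => [|n IH]; first by rewrite big_ord0 expr0 mulr1 subrr.
  by rewrite big_ord_recr /= IH exprS; field.
by rewrite gerBl mulr_ge0 // exprn_ge0 // divr_ge0.
Qed.

Lemma expR_sqr_le (k : nat) : expR (- (k%:R ^+ 2) / 2) <= 2 * (1 / 2) ^+ k :> R.
Proof.
have h1 : expR (1 / 2) <= 2 :> R.
  have := expR_ge1Dx (- (1 / 2) : R); rewrite expRN => h.
  rewrite -[leLHS]invrK -[leRHS]invrK lef_pV2 ?posrE ?invr_gt0 ?expR_gt0 //.
  lra.
have h2 : expR (- 1) <= 1 / 2 :> R.
  have := expR_ge1Dx (1 : R); rewrite expRN => h.
  rewrite div1r lef_pV2 ?posrE ?expR_gt0 //; lra.
apply: (@le_trans _ _ (expR (1 / 2) * expR (- 1) ^+ k)).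
  rewrite -expRM_natl -expRD ler_expR.
  have := sqr_ge0 (k%:R - 1 : R); lra.
apply: ler_pM => //; rewrite ?exprn_ge0 ?expR_ge0 //.
by rewrite lerXn2r ?nnegrE ?expR_ge0.
Qed.

Lemma mixture_gauss :
  \sum_o mix_weight o * expR (mix_slope o ^+ 2 / 2) <= 1 + 8 * a.
Proof.
rewrite big_sumType /= big_const card_unit /= addr0 expr0n /= mul0r expR0 mulr1.
rewrite lerD2l.
rewrite (eq_bigr (fun kb : 'I_N.+1 * bool => a * expR (- (kb.1%:R ^+ 2) / 2))); last first.
  move=> [k b] _ /=; rewrite -mulrA -expRD exprMn sqrr_sign mul1r.
  by congr (_ * expR _); field.
rewrite -(pair_bigA _ (fun (k : 'I_N.+1) (b : bool) => a * expR (- (k%:R ^+ 2) / 2))) /=.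
under eq_bigr do rewrite big_const card_bool /= addr0 -mulrDr.
rewrite -mulr_sumr mulrC ler_wpM2r //.
apply: (@le_trans _ _ (\sum_(k < N.+1) 4 * (1 / 2) ^+ k)).
  by apply: ler_sum => k _; have := expR_sqr_le k; lra.
by rewrite -mulr_sumr; have := sum_half N.+1; lra.
Qed.

End exponential_mixture.

Section soft_threshold.
Variables (R : realType) (d : nat).
Implicit Types (h g : 'rV[R]_d).

(** Up to constants, the squared length of what remains of [h] after soft
    thresholding of its coordinates at [2 sqrt T].  It controls the supremum of
    [dotp h] over the feasible set of the estimator. *)
Definition excess (T : R) h : R := \sum_(j < d) Num.max 0 (h 0 j ^+ 2 / 4 - T).

Lemma sum_abs_sqr_le (x y : 'I_d -> R) :
  \sum_j x j * `|y j| <= Num.sqrt (\sum_j x j ^+ 2) * Num.sqrt (\sum_j y j ^+ 2).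
Proof.
have := dotp_le (\row_j x j) (\row_j `|y j|).
have -> : dotp (\row_j x j) (\row_j `|y j|) = \sum_j x j * `|y j|.
  by apply: eq_bigr => j _; rewrite !mxE.
have -> : l2norm (\row_j x j) = Num.sqrt (\sum_j x j ^+ 2).
  by congr Num.sqrt; apply: eq_bigr => j _; rewrite mxE.
have -> // : l2norm (\row_j `|y j|) = Num.sqrt (\sum_j y j ^+ 2).
by congr Num.sqrt; apply: eq_bigr => j _; rewrite mxE real_normK ?num_real.
Qed.

(** Each [|h_j|] is at most [2 sqrt T] plus an excess; the former is paid for by
    the [l1] norm and the latter by the [l2] norm. *)
Lemma norm_dotp_excess (s T B : R) h g : 0 <= T -> excess T h <= B ->
  l1norm g <= Num.sqrt s -> l2norm g <= 1 ->
  `|dotp h g| <= 2 * (Num.sqrt T * Num.sqrt s + Num.sqrt B).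
Proof.
move=> T0 hB g1 g2.
pose q j : R := Num.max 0 (h 0 j ^+ 2 / 4 - T).
have q0 j : 0 <= q j by rewrite le_max lexx.
have hj j : `|h 0 j| <= 2 * (Num.sqrt T + Num.sqrt (q j)).
  rewrite -ler_sqr ?nnegrE ?mulr_ge0 ?addr_ge0 ?sqrtr_ge0 // real_normK ?num_real //.
  have : h 0 j ^+ 2 / 4 - T <= q j by rewrite le_max lexx orbT.
  have := sqr_sqrtr T0; have := sqr_sqrtr (q0 j).
  have := mulr_ge0 (sqrtr_ge0 T) (sqrtr_ge0 (q j)); nra.
apply: (@le_trans _ _ (\sum_j `|h 0 j| * `|g 0 j|)).
  rewrite (le_trans (ler_norm_sum _ _ _)) //.
  by apply: ler_sum => j _; rewrite normrM.
apply: (@le_trans _ _ (\sum_j (2 * (Num.sqrt T * `|g 0 j|) +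
    2 * (Num.sqrt (q j) * `|g 0 j|)))).
  apply: ler_sum => j _; have := ler_wpM2r (normr_ge0 (g 0 j)) (hj j); lra.
rewrite big_split /= -!mulr_sumr -mulrDr ler_pM2l // lerD //.
  by rewrite ler_wpM2l ?sqrtr_ge0.
apply: (le_trans (sum_abs_sqr_le _ _)).
rewrite -[leRHS]mulr1 ler_pM ?sqrtr_ge0 // ler_sqrt; last first.
  by apply: le_trans hB; apply: sumr_ge0 => j _; exact: q0.
apply: le_trans hB; rewrite le_eqVlt; apply/orP; left; apply/eqP.
by apply: eq_bigr => j _; rewrite sqr_sqrtr ?q0.
Qed.

Lemma expR_excess_le N (a : R) h : 0 < a -> (forall j, `|h 0 j| <= N%:R) ->
  expR (excess (1 / 4 - ln a) h) <= \prod_(j < d) mixture N a (h 0 j).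
Proof.
move=> a0 hN; rewrite expR_sum; apply: ler_prod => j _; rewrite expR_ge0 /=.
have [_|_] := leP 0 (h 0 j ^+ 2 / 4 - (1 / 4 - ln a)); last first.
  by rewrite expR0 mixture_ge1 // ltW.
have := mixture_ge (ltW a0) (hN j); apply: le_trans.
rewrite -{2}(lnK a0) -expRD ler_expR; lra.
Qed.

End soft_threshold.

Section centred_exponential.
Variables (R : realType) (dO : measure_display) (Omega : measurableType dO).
Variable P : probability Omega R.

(** By Jensen [exp (- E X) <= E exp (- X)], so the left-hand side is at most
    [E exp X * E exp (- X)]; the arithmetic mean bounds the geometric one. *)
Lemma expect_exp_centred (X : Omega -> R) : bounded_rv X ->
  expect P (fun w => expR (X w - expect P X)) <=
  (expect P (fun w => (expR (X w) + expR (- X w)) / 2)) ^+ 2.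
Proof.
move=> bX; set mu := expect P X.
have jensen : expR (- mu) <= expect P (fun w => expR (- X w)).
  have -> : expR (- mu) = expect P (fun w => expR (- mu) * (1 + (mu - X w))).
    transitivity (expR (- mu) * (1 + (mu - mu))).
      by rewrite subrr addr0 mulr1.
    rewrite expectZ; last by bounded.
    rewrite expectD; [|by bounded|by bounded].
    by rewrite expectB ?expect_cst //; bounded.
  apply: ler_expect; [by bounded|by bounded|move=> w].
  rewrite [in leRHS](_ : - X w = - mu + (mu - X w)); last by ring.
  by rewrite expRD ler_wpM2l ?expR_ge0 ?expR_ge1Dx.
have -> : expect P (fun w => expR (X w - mu)) =
    expR (- mu) * expect P (fun w => expR (X w)).
  rewrite -expectZ; last by bounded.
  by congr expect; apply/funext => w; rewrite expRD mulrC.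
have E0 : 0 <= expect P (fun w => expR (X w)).
  by apply: expect_ge0 => w; exact: expR_ge0.
apply: le_trans (ler_wpM2r E0 jensen) _.
have -> : expect P (fun w => (expR (X w) + expR (- X w)) / 2) =
    2^-1 * (expect P (fun w => expR (X w)) + expect P (fun w => expR (- X w))).
  rewrite -expectD; [|by bounded|by bounded].
  rewrite -expectZ; last by bounded.
  by congr expect; apply/funext => w; rewrite mulrC.
set b := expect P (fun w => expR (- X w)); set a := expect P _.
by have := sqr_ge0 (a - b); lra.
Qed.

End centred_exponential.

(** * Fluctuations of the oracle answers *)

Section parametric_expectation.
Variables (R : realType) (dO : measure_display) (Omega : measurableType dO).
Variable P : probability Omega R.

Lemma measurable_expect dT (T : measurableType dT) (F : T * Omega -> R) B :
  measurable_fun setT F -> (forall q, `|F q| <= B) ->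
  measurable_fun setT (fun t => expect P (fun w => F (t, w))).
Proof.
move=> mF FB.
have bF t : bounded_rv (fun w => F (t, w)).
  split; last by exists B.
  by apply: (measurableT_comp mF); exact: pair1_measurable.
have -> : (fun t => expect P (fun w => F (t, w))) =
    (fun t => fine (\int[P]_w (F (t, w) + B)%:E) - B).
  apply/funext => t; rewrite integral_expect; last by have := bF t; bounded.
  by rewrite /= expectD ?expect_cst ?addrK //; bounded.
apply: measurable_funB => //; apply: measurableT_comp => //.
apply: (@measurable_fun_fubini_tonelli_F _ _ _ _ R P (fun q => (F q + B)%:E)).
  by apply/measurable_EFinP; apply: measurable_funD.
by move=> q; rewrite lee_fin -lerBlDr sub0r; have := FB q; rewrite ler_norml => /andP[].
Qed.

Lemma prob_expect (b : Omega -> bool) : measurable_fun setT b ->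
  P [set w | b w] = (expect P (fun w => (b w)%:R))%:E.
Proof.
move=> mb; have mA := measurable_bool_set mb.
rewrite -integral_expect; last exact: bounded_rv_bool.
rewrite -[LHS]/(P _) -[X in P X]setIT -(integral_indic _ _ mA) //.
by apply: eq_integral => w _; rewrite indicE mem_setE.
Qed.

Lemma expect_markov (X : Omega -> R) (b : R) : bounded_rv X -> 0 < b ->
  (forall w, 0 <= X w) ->
  (P [set w | (b <= X w)%R] <= (expect P X / b)%:E)%E.
Proof.
move=> bX b0 X0.
have bc := @bounded_rv_cst R _ Omega b.
rewrite (@prob_expect (fun w => b <= X w)); last first.
  by apply: measurable_fun_ler; [case: bc|case: bX].
have bI : bounded_rv (fun w => (b <= X w)%R%:R : R) by bounded.
rewrite lee_fin ler_pdivlMr // mulrC -expectZ //.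
apply: ler_expect => [|//|w]; first by bounded.
by case: (leP b) => [bw|_] /=; rewrite ?mulr1 ?mulr0 ?X0.
Qed.

End parametric_expectation.

(** One call of the gradient estimator at a random point [x], decided by events
    of the collection [Hist]; the directions [Z i] and noises [U i] are fresh. *)
Section one_call.
Variables (R : realType) (d : nat) (e : 'rV[R]_d).
Hypothesis e1 : l2norm e = 1.
Variables (dO : measure_display) (Omega : measurableType dO).
Variable P : probability Omega R.
Variables (dX : measure_display) (Xi : measurableType dX).
Variable orc : 'rV[R]_d -> 'rV[R]_d -> Xi -> R.
Hypothesis morc : measurable_fun [set: borel_rV R d * borel_rV R d * Xi]
  (fun q : borel_rV R d * borel_rV R d * Xi => orc q.1.1 q.1.2 q.2).
Hypothesis orc1 : forall x y u, orc x y u = -1 \/ orc x y u = 1.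
Variable r : R.
Variable m : nat.
Variables (Z : 'I_m -> Omega -> 'rV[R]_d) (U : 'I_m -> Omega -> Xi).
Hypothesis unifZ : forall i, uniform_rv P (Z i).
Hypothesis mU : forall i, measurable_fun setT (U i).
Variable Hist : set (set Omega).
Hypothesis HistI : setI_closed Hist.
Hypothesis HistT : Hist setT.
Hypothesis Histm : Hist `<=` measurable.

Let S (o : option ('I_m + 'I_m)) : set (set Omega) :=
  match o with
  | None => Hist
  | Some (inl i) => sigma_of (Z i : Omega -> borel_rV R d)
  | Some (inr i) => sigma_of (U i)
  end.

Hypothesis indepS : mutually_independent P S.

Let q : R := Num.sqrt d%:R.
Let q0 : 0 <= q.
Proof. exact: sqrtr_ge0. Qed.
Let mZ i : measurable_fun setT (Z i : Omega -> borel_rV R d).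
Proof. by case: (unifZ i). Qed.
Let Z1 i w : l2norm (Z i w) = 1.
Proof. by case: (unifZ i). Qed.

Let SI o : setI_closed (S o).
Proof. by case: o => [[i|i]|] //=; exact: sigma_of_setI. Qed.
Let ST o : S o setT.
Proof. by case: o => [[i|i]|] //=; exact: sigma_of_setT. Qed.
Let Sm o : S o `<=` measurable.
Proof. by case: o => [[i|i]|] //=; exact: sigma_of_measurable. Qed.

Definition answer (q : borel_rV R d * (borel_rV R d * Xi)) : R :=
  orc q.1 (q.1 + r *: q.2.1) q.2.2.

Lemma measurable_answer : measurable_fun setT answer.
Proof.
pose F (p : borel_rV R d * (borel_rV R d * Xi)) : borel_rV R d * borel_rV R d * Xi :=
  ((p.1, (p.1 + r *: p.2.1 : borel_rV R d)), p.2.2).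
apply: (measurableT_comp (f := fun q : borel_rV R d * borel_rV R d * Xi =>
  orc q.1.1 q.1.2 q.2) (g := F)) => //.
have m21 : measurable_fun setT (fun p : borel_rV R d * (borel_rV R d * Xi) => p.2.1).
  exact: (measurableT_comp measurable_fst measurable_snd).
apply: measurable_fun_pair; last first.
  exact: (measurableT_comp measurable_snd measurable_snd).
apply: measurable_fun_pair; first exact: measurable_fst.
apply: measurable_rV => i.
under eq_fun do rewrite mxE [X in _ + X]mxE.
apply: measurable_funD.
  exact: (measurableT_comp (measurable_coord i) measurable_fst).
apply: measurable_funM => //.
exact: (measurableT_comp (measurable_coord i) m21).
Qed.

Lemma norm_answer p : `|answer p| = 1.
Proof.
by rewrite /answer; case: (orc1 p.1 (p.1 + r *: p.2.1) p.2.2) => ->;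
  rewrite ?normrN normr1.
Qed.

Definition draw i w : borel_rV R d * Xi := (Z i w, U i w).

Lemma measurable_draw i : measurable_fun setT (draw i).
Proof. exact: measurable_fun_pair. Qed.

Lemma bounded_answer x i : bounded_rv (fun w => answer (x, draw i w)).
Proof.
split; last by exists 1 => w; rewrite norm_answer.
apply: (measurableT_comp measurable_answer).
by apply: measurable_fun_pair => //; exact: measurable_draw.
Qed.

Let bZ i := bounded_dotp e1 (unifZ i).

Definition mean_answer i (x : borel_rV R d) : 'rV[R]_d :=
  \row_j expect P (fun w => answer (x, draw i w) * (q * Z i w 0 j)).

Lemma bounded_coord i j : bounded_rv (fun w => Z i w 0 j).
Proof.
by under [X in bounded_rv X]eq_fun do rewrite -dotp_delta; exact: bZ.
Qed.

Lemma dotp_mean_answer i x theta : dotp (mean_answer i x) theta =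
  expect P (fun w => answer (x, draw i w) * (q * dotp (Z i w) theta)).
Proof.
have ba := bounded_answer x i; have bc := bounded_coord i.
under [X in expect P X]eq_fun do rewrite 2!mulr_sumr.
rewrite expect_sum => [|j]; last by bounded.
apply: eq_bigr => j _; rewrite mxE mulrC -expectZ; last by bounded.
by congr expect; apply/funext => w; ring.
Qed.

Lemma norm_mean_answer i x j : `|mean_answer i x 0 j| <= q.
Proof.
have ba := bounded_answer x i; have bc := bounded_coord i.
rewrite mxE; apply: le_trans (norm_expect_le _ _) _; first by bounded.
rewrite -[leRHS](expect_cst P); apply: ler_expect => [||w]; try by bounded.
rewrite !normrM norm_answer mul1r (ger0_norm q0) ler_piMr //.
by rewrite -(Z1 i w) ler_coord_l2norm.
Qed.

Lemma measurable_mean_answer i j :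
  measurable_fun setT (fun x : borel_rV R d => mean_answer i x 0 j).
Proof.
have -> : (fun x : borel_rV R d => mean_answer i x 0 j) = (fun x : borel_rV R d =>
    expect P (fun w => answer (x, draw i w) * (q * Z i w 0 j))).
  by apply/funext => x; rewrite mxE.
apply: (@measurable_expect _ _ _ P _ _ (fun p : borel_rV R d * Omega =>
    answer (p.1, draw i p.2) * (q * Z i p.2 0 j)) q).
  apply: measurable_funM.
    apply: (measurableT_comp measurable_answer); apply: measurable_fun_pair => //.
    exact: (measurableT_comp (measurable_draw i) measurable_snd).
  apply: measurable_funM => //.
  by have [mc _] := bounded_coord i j; exact: (measurableT_comp mc measurable_snd).
move=> p; rewrite !normrM norm_answer mul1r (ger0_norm q0) ler_piMr //.
by rewrite -(Z1 i p.2) ler_coord_l2norm.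
Qed.

Lemma measurable_dotp_mean i theta :
  measurable_fun setT (fun x : borel_rV R d => dotp (mean_answer i x) theta).
Proof.
apply: measurable_sum => j; apply: measurable_funM => //.
exact: measurable_mean_answer.
Qed.

Hypothesis m0 : (0 < m)%N.
Let c : R := (Num.sqrt (4 * m%:R))^-1.
Let c0 : 0 < c.
Proof. by rewrite invr_gt0 sqrtr_gt0 mulr_gt0 // ltr0n. Qed.
Let c2 : c ^+ 2 = (4 * m%:R)^-1.
Proof. by rewrite exprVn sqr_sqrtr // mulr_ge0. Qed.

(** After symmetrization only the hyperbolic cosine of the signed direction is
    left, and this does not see the sign given by the oracle.  Hence the moments
    of the uniform law apply although the answer depends on the direction. *)
Lemma expect_exp_answer i x theta :
  expect P (fun w => expR (c * (answer (x, draw i w) * (q * dotp (Z i w) theta)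
    - dotp (mean_answer i x) theta))) <= expR (2 * c ^+ 2 * dotp theta theta).
Proof.
have ba := bounded_answer x i; have bZi := bZ i.
pose X w := c * (answer (x, draw i w) * (q * dotp (Z i w) theta)).
have bX : bounded_rv X by rewrite /X; bounded.
have -> : (fun w => expR (c * (answer (x, draw i w) * (q * dotp (Z i w) theta)
    - dotp (mean_answer i x) theta))) = (fun w => expR (X w - expect P X)).
  apply/funext => w; congr expR.
  by rewrite /X expectZ; [rewrite dotp_mean_answer; ring|bounded].
apply: le_trans (expect_exp_centred P bX) _.
have d0 := dim_gt0 e1.
pose t : 'rV[R]_d := (c * q) *: theta.
have tt : dotp t t / d%:R = c ^+ 2 * dotp theta theta.
  rewrite /t dotpZl dotpZr; have q2 : q ^+ 2 = d%:R by rewrite sqr_sqrtr.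
  by rewrite -q2; field; rewrite gt_eqF // sqrtr_gt0.
have -> : (fun w => (expR (X w) + expR (- X w)) / 2) =
    (fun w => 2^-1 * (expR (dotp (Z i w) t) + expR (dotp (Z i w) (- t)))).
  apply/funext => w; rewrite mulrC; congr (_ * _).
  rewrite /X /t dotpNr dotpZr.
  rewrite /answer; case: (orc1 (x, draw i w).1
    ((x, draw i w).1 + r *: (x, draw i w).2.1) (x, draw i w).2.2) => ->.
    by rewrite addrC; congr (expR _ + expR _); ring.
  by congr (expR _ + expR _); ring.
rewrite expectZ; last by bounded.
rewrite expectD; [|by bounded|by bounded].
have h1 := expect_exp_dotp e1 (unifZ i) t.
have h2 := expect_exp_dotp e1 (unifZ i) (- t).
rewrite dotpNl dotpNr opprK tt in h2; rewrite tt in h1.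
have -> : expR (2 * c ^+ 2 * dotp theta theta) =
    expR (c ^+ 2 * dotp theta theta) ^+ 2.
  by rewrite -expRM_natl mulrA.
rewrite ler_sqr ?nnegrE ?expR_ge0 //; last first.
  by rewrite mulr_ge0 ?addr_ge0 ?expect_ge0 // => w; exact: expR_ge0.
lra.
Qed.

Variable x : Omega -> 'rV[R]_d.
Hypothesis mx : forall B : set (borel_rV R d), measurable B -> Hist (x @^-1` B).

(** The sum of the signed directions minus its mean given the query point [x w],
    scaled so that its exponential moments are at most those of a standard
    Gaussian vector. *)
Definition deviation w : 'rV[R]_d :=
  \row_j (c * \sum_(i < m) (answer (x w, draw i w) * (q * Z i w 0 j)
     - mean_answer i (x w) 0 j)).

Lemma dotp_deviation w theta : dotp (deviation w) theta =
  c * \sum_(i < m) (answer (x w, draw i w) * (q * dotp (Z i w) theta)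
     - dotp (mean_answer i (x w)) theta).
Proof.
rewrite /dotp mulr_sumr; under eq_bigr do rewrite mxE -mulrA mulr_suml mulr_sumr.
rewrite exchange_big /=; apply: eq_bigr => i _.
rewrite -mulr_sumr; congr (_ * _); rewrite !mulr_sumr -sumrB.
by apply: eq_bigr => j _; ring.
Qed.

Lemma measurable_x : measurable_fun setT (x : Omega -> borel_rV R d).
Proof. by move=> _ B mB; rewrite setTI; apply: Histm; exact: mx. Qed.

Lemma bounded_deviation j : bounded_rv (fun w => deviation w 0 j).
Proof.
under [X in bounded_rv X]eq_fun do rewrite mxE.
apply: bounded_rvZ; apply: bounded_rv_sum => i; apply: bounded_rvB.
  apply: bounded_rvM; last by apply: bounded_rvZ; exact: bounded_coord.
  split; last by exists 1 => w; rewrite norm_answer.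
  apply: (measurableT_comp measurable_answer); apply: measurable_fun_pair.
    exact: measurable_x.
  exact: measurable_draw.
split; last by exists q => w; exact: norm_mean_answer.
exact: (measurableT_comp (measurable_mean_answer i j) measurable_x).
Qed.

Lemma norm_deviation w j : `|deviation w 0 j| <= c * (m%:R * (2 * q)).
Proof.
rewrite mxE normrM gtr0_norm // ler_pM2l // (le_trans (ler_norm_sum _ _ _)) //.
have -> : m%:R * (2 * q) = \sum_(i < m) (q + q).
  by rewrite sumr_const card_ord mulr_natl mulr_natl mulr2n.
apply: ler_sum => i _; rewrite (le_trans (ler_normB _ _)) // lerD //.
  rewrite !normrM norm_answer mul1r (ger0_norm q0) ler_piMr //.
  by rewrite -(Z1 i w) ler_coord_l2norm.
exact: norm_mean_answer.
Qed.

(** Given the query point, the [m] terms are independent and centred. *)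
Lemma expect_exp_deviation theta :
  expect P (fun w => expR (dotp (deviation w) theta)) <= expR (dotp theta theta / 2).
Proof.
have bD j := bounded_deviation j.
have bH : bounded_rv (fun w => dotp (deviation w) theta).
  by apply: bounded_rv_sum => j; bounded.
rewrite -lee_fin -integral_expect; last by bounded.
pose G i (p : borel_rV R d * (borel_rV R d * Xi)) : R :=
  expR (c * (answer p * (q * dotp p.2.1 theta) - dotp (mean_answer i p.1) theta)).
under eq_integral do rewrite dotp_deviation mulr_sumr expR_sum.
have -> : expR (dotp theta theta / 2) =
    expR (2 * c ^+ 2 * dotp theta theta) ^+ size (index_enum 'I_m).
  rewrite -[index_enum _]enumT size_enum_ord -expRM_natl c2; congr expR; field.
  by rewrite gt_eqF // ltr0n.
apply: (@integral_prod_le _ _ _ P _ S SI ST Sm indepS 'I_m _ (borel_rV R d) _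
  (borel_rV R d * Xi)%type x draw [set None]%SET
  (fun i => [set Some (inl i); Some (inr i)]%SET) G) => //.
- by apply: (measurable_cylinders ST (i := None)); rewrite ?inE //; exact: mx.
- move=> i; apply: measurable_fun_pair.
    apply: (measurable_cylinders ST (i := Some (inl i))); rewrite ?inE ?eqxx //.
    by move=> B mB; exists B => //; rewrite setTI.
  apply: (measurable_cylinders ST (i := Some (inr i))); rewrite ?inE ?eqxx ?orbT //.
  by move=> B mB; exists B => //; rewrite setTI.
- by move=> i o; rewrite !inE => /orP[] /eqP ->.
- move=> i k o; rewrite !inE => ik /orP[] /eqP ->.
    by apply/negP => /orP[] /eqP // [] ik'; rewrite ik' eqxx in ik.
  by apply/negP => /orP[] /eqP // [] ik'; rewrite ik' eqxx in ik.
- move=> i; apply: measurableT_comp => //; apply: measurable_funM => //.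
  apply: measurable_funB; last first.
    exact: (measurableT_comp (measurable_dotp_mean i theta) measurable_fst).
  apply: measurable_funM; first exact: measurable_answer.
  apply: measurable_funM => //; apply: (measurableT_comp (measurable_dotp theta)).
  exact: (measurableT_comp measurable_fst measurable_snd).
- by move=> i p; exact: expR_ge0.
- move=> i v; rewrite integral_expect.
    by rewrite lee_fin; exact: expect_exp_answer.
  by have ba := bounded_answer v i; have bZi := bZ i; rewrite /G /=; bounded.
- exact: index_enum_uniq.
Qed.

(** Expanding the product over the coordinates gives exponentials of linear forms
    in the deviation; their Gaussian bounds factor again over the coordinates, as
    if these were independent. *)
Lemma expect_mixture N a : 0 <= a ->
  expect P (fun w => \prod_(j < d) mixture N a (deviation w 0 j))
    <= expR (8 * a * d%:R).
Proof.
move=> a0; have bD j := bounded_deviation j.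
have -> : (fun w => \prod_(j < d) mixture N a (deviation w 0 j)) = (fun w =>
    \sum_(k : {ffun 'I_d -> unit + ('I_N.+1 * bool)})
      (\prod_j mix_weight a (k j)) *
      expR (dotp (deviation w) (\row_j mix_slope R (k j)))).
  apply/funext => w; rewrite bigA_distr_bigA /=; apply: eq_bigr => k _.
  rewrite big_split /= -expR_sum; congr (_ * expR _).
  by apply: eq_bigr => j _; rewrite mxE mulrC.
have bH theta : bounded_rv (fun w => dotp (deviation w) theta).
  by apply: bounded_rv_sum => j; bounded.
rewrite expect_sum => [|k]; last by bounded.
apply: (@le_trans _ _ (\sum_(k : {ffun 'I_d -> unit + ('I_N.+1 * bool)})
    \prod_j (mix_weight a (k j) * expR (mix_slope R (k j) ^+ 2 / 2)))).
  apply: ler_sum => k _; rewrite expectZ; last by bounded.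
  rewrite big_split /= ler_wpM2l ?prodr_ge0 // => [j _|].
    exact: mix_weight_ge0.
  apply: le_trans (expect_exp_deviation _) _; rewrite -expR_sum ler_expR.
  rewrite -mulr_suml le_eqVlt; apply/orP; left; apply/eqP; congr (_ / 2).
  by apply: eq_bigr => j _; rewrite mxE expr2.
rewrite -(bigA_distr_bigA (fun (_ : 'I_d) (o : unit + ('I_N.+1 * bool)) =>
  mix_weight a o * expR (mix_slope R o ^+ 2 / 2))) /= prodr_const card_ord.
rewrite (mulrC _ d%:R) expRM_natl lerXn2r ?nnegrE ?expR_ge0 //.
  by apply: sumr_ge0 => o _; rewrite mulr_ge0 ?expR_ge0 // mix_weight_ge0.
by apply: le_trans (mixture_gauss N a0) _; exact: expR_ge1Dx.
Qed.

Lemma measurable_excess T : measurable_fun setT (fun w => excess T (deviation w)).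
Proof.
apply: measurable_sum => j; apply: measurable_maxr => //.
apply: measurable_funB => //; apply: measurable_funM => //.
by apply: measurable_funX; have [] := bounded_deviation j.
Qed.

(** Markov's inequality for the exponential of the excess. *)
Lemma deviation_tail a b : 0 < a ->
  (P [set w | (b <= excess (1 / 4 - ln a) (deviation w))%R]
    <= (expR (8 * a * d%:R - b))%:E)%E.
Proof.
move=> a0; pose N := (Num.truncn (c * (m%:R * (2 * q)))).+1.
have hN w j : `|deviation w 0 j| <= N%:R.
  by apply: le_trans (norm_deviation w j) _; apply: ltW; exact: truncnS_gt.
pose X w := \prod_(j < d) mixture N a (deviation w 0 j).
have X0 w : 0 <= X w.
  apply: prodr_ge0 => j _; apply: le_trans ler01 _.
  by apply: mixture_ge1; exact: ltW.
have bX : bounded_rv X.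
  apply: bounded_rv_prod => j; apply: bounded_rv_sum => o.
  by have bD := bounded_deviation j; bounded.
apply: (@le_trans _ _ (P [set w | (expR b <= X w)%R])).
  apply: le_measure; rewrite ?inE.
  - apply: (measurable_bool_set (b := fun w => b <= excess (1 / 4 - ln a) (deviation w))).
    by apply: measurable_fun_ler => //; exact: measurable_excess.
  - apply: (measurable_bool_set (b := fun w => expR b <= X w)).
    by apply: measurable_fun_ler => //; case: bX.
  - move=> w /= bw; apply: (le_trans _ (expR_excess_le a0 (hN w))).
    by rewrite ler_expR.
have hm := expect_markov P bX (expR_gt0 b) X0.
apply: (le_trans hm).
rewrite lee_fin expRD expRN ler_wpM2r ?invr_ge0 ?expR_ge0 //.
by apply: expect_mixture; exact: ltW.
Qed.

End one_call.

(** * Expectation of a noisy answer *)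

Lemma measurable_correct_answer (R : realType) (d : nat) (dX : measure_display)
    (Xi : measurableType dX) (orc : 'rV[R]_d -> 'rV[R]_d -> Xi -> R) :
  measurable_fun [set: borel_rV R d * borel_rV R d * Xi]
    (fun q : borel_rV R d * borel_rV R d * Xi => orc q.1.1 q.1.2 q.2) ->
  forall sg0 (f : 'rV[R]_d -> R) x y, measurable (correct_answer sg0 f orc x y).
Proof.
move=> morc sg0 f x y.
have mo : measurable_fun setT (orc x y).
  apply: (measurableT_comp (f := fun q : borel_rV R d * borel_rV R d * Xi =>
    orc q.1.1 q.1.2 q.2) (g := fun u => ((x, y), u))) => //.
  by apply: measurable_fun_pair => //; exact: measurable_cst.
by have := mo measurableT _ (measurable_set1 (sgnpm sg0 (f y - f x))); rewrite setTI.
Qed.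

(** The answer to one query: the noise [U] is independent of the direction [Z]
    and answers correctly with a probability [p] that does not depend on [Z]. *)
Section one_query.
Variables (R : realType) (d : nat) (e : 'rV[R]_d).
Hypothesis e1 : l2norm e = 1.
Variables (dO : measure_display) (Omega : measurableType dO).
Variable P : probability Omega R.
Variables (dX : measure_display) (Xi : measurableType dX).
Variable orc : 'rV[R]_d -> 'rV[R]_d -> Xi -> R.
Hypothesis morc : measurable_fun [set: borel_rV R d * borel_rV R d * Xi]
  (fun q : borel_rV R d * borel_rV R d * Xi => orc q.1.1 q.1.2 q.2).
Hypothesis orc1 : forall x y u, orc x y u = -1 \/ orc x y u = 1.
Variables (r : R) (Z : Omega -> 'rV[R]_d) (U : Omega -> Xi).
Hypothesis unifZ : uniform_rv P Z.
Hypothesis mU : measurable_fun setT U.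
Hypothesis indepZU :
  indep_sets P (sigma_of (Z : Omega -> borel_rV R d)) (sigma_of U).
Variables (sg0 : bool) (f : 'rV[R]_d -> R) (p : R).
Hypothesis cf : continuous f.
Hypothesis orcp : forall x y, P (U @^-1` correct_answer sg0 f orc x y) = p%:E.
Variable x : 'rV[R]_d.

Let q : R := Num.sqrt d%:R.
Let mZ : measurable_fun setT (Z : Omega -> borel_rV R d).
Proof. by case: unifZ. Qed.
Let Z1 w : l2norm (Z w) = 1.
Proof. by case: unifZ. Qed.
Let ans (zu : borel_rV R d * Xi) : R := answer orc r (x, zu).

Definition true_sign (z : 'rV[R]_d) : R := sgnpm sg0 (f (x + r *: z) - f x).

Lemma true_sign_cases z : true_sign z = -1 \/ true_sign z = 1.
Proof.
rewrite /true_sign /sgnpm; case: ifP => _; first by right.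
by case: ifP => _; [left|case: sg0; [left|right]; rewrite ?expr1 ?expr0].
Qed.

Lemma norm_true_sign z : `|true_sign z| = 1.
Proof. by case: (true_sign_cases z) => ->; rewrite ?normrN normr1. Qed.

Lemma measurable_true_sign : measurable_fun setT (true_sign : borel_rV R d -> R).
Proof.
have mF : measurable_fun setT (fun z : borel_rV R d => f (x + r *: z) - f x).
  apply: continuous_measurable_rV => z; apply: continuousB; last exact: cst_continuous.
  apply: continuous_comp; last exact: cf.
  by apply: continuousD; [exact: cst_continuous|exact: scaler_continuous].
by apply: measurable_fun_ifT => //;
  [exact: measurable_fun_ltr|apply: measurable_fun_ifT => //; exact: measurable_fun_ltr].
Qed.

Let hit (z : borel_rV R d) (u : Xi) : R := (1 + ans (z, u) * true_sign z) / 2.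

Let hitE z u : hit z u = (orc x (x + r *: z) u == true_sign z)%:R.
Proof.
rewrite /hit /ans /answer /=.
have n1 : (-1 == 1 :> R) = false by apply: lt_eqF; lra.
case: (orc1 x (x + r *: z) u) => ->; case: (true_sign_cases z) => ->;
  by rewrite ?eqxx ?(eq_sym 1) ?n1 /=; field.
Qed.

Let bounded_clip F : sphere_bounded e F -> bounded_rv (fun w => F (Z w)).
Proof. exact: (bounded_sphere unifZ). Qed.

Lemma bounded_true_sign : sphere_bounded e true_sign.
Proof.
split; last by exists 1 => z; rewrite norm_true_sign.
exact: (measurableT_comp measurable_true_sign (measurable_clip e)).
Qed.

Let mdraw : measurable_fun setT (fun w => (Z w, U w) : borel_rV R d * Xi).
Proof. exact: measurable_fun_pair. Qed.

Let mans : measurable_fun setT ans.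
Proof.
apply: (measurableT_comp (measurable_answer morc r)).
by apply: measurable_fun_pair => //; exact: measurable_cst.
Qed.

Let bans : bounded_rv (fun w => ans (Z w, U w)).
Proof.
split; last by exists 1 => w; rewrite /ans norm_answer.
exact: (measurableT_comp mans mdraw).
Qed.

Let mhit : measurable_fun setT (fun zu : borel_rV R d * Xi => hit zu.1 zu.2).
Proof.
apply: measurable_funM => //; apply: measurable_funD => //.
apply: measurable_funM.
  by have -> : (fun zu : borel_rV R d * Xi => ans (zu.1, zu.2)) = ans
    by apply/funext => -[].
exact: (measurableT_comp measurable_true_sign measurable_fst).
Qed.

Let mcorrect := measurable_correct_answer morc sg0 f x.

(** Integrating over the noise first replaces the indicator of a correct answer
    by its constant probability. *)
Lemma expect_hit (phi : borel_rV R d -> R) : bounded_rv phi ->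
  (forall z, 0 <= phi z) ->
  expect P (fun w => hit (Z w) (U w) * phi (Z w)) = p * expect P (fun w => phi (Z w)).
Proof.
move=> bphi phi0.
have hit0 z u : 0 <= hit z u by rewrite hitE.
have bphiZ : bounded_rv (fun w => phi (Z w)).
  have [mphi [B phiB]] := bphi; split; last by exists B.
  exact: (measurableT_comp mphi mZ).
have bsZ : bounded_rv (fun w => true_sign (Z w)) by exact: bounded_clip bounded_true_sign.
have bhit : bounded_rv (fun w => hit (Z w) (U w)) by rewrite /hit; bounded.
apply: EFin_inj; rewrite EFinM -!integral_expect; [|by bounded|by bounded].
pose F := sigma_of (Z : Omega -> borel_rV R d); pose G := sigma_of U.
pose Phi (w : g_sigma_algebraType F * g_sigma_algebraType G) : \bar R :=
  (hit (Z w.1) (U w.2) * phi (Z w.1))%:E.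
have mZF : measurable_fun setT (Z : g_sigma_algebraType F -> borel_rV R d).
  by move=> _ B mB; apply: sub_sigma_algebra; exists B.
have mUG : measurable_fun setT (U : g_sigma_algebraType G -> Xi).
  by move=> _ B mB; apply: sub_sigma_algebra; exists B.
have mZ1 : measurable_fun setT (fun w : g_sigma_algebraType F * g_sigma_algebraType G =>
    Z w.1 : borel_rV R d).
  exact: (measurableT_comp mZF measurable_fst).
have -> : (\int[P]_w (hit (Z w) (U w) * phi (Z w))%:E = \int[P]_w Phi (w, w))%E by [].
rewrite decoupling //.
- under eq_integral => w _.
    rewrite /Phi /=; under eq_integral do rewrite mulrC EFinM.
    rewrite ge0_integralZl ?lee_fin //; first last.
    + by move=> w' _; rewrite lee_fin.
    + apply/measurable_EFinP.
      apply: (measurableT_comp (f := fun zu => hit zu.1 zu.2) (g := fun w' => (Z w, U w'))) => //.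
      by apply: measurable_fun_pair => //; exact: measurable_cst.
    rewrite (_ : (\int[P]_w' (hit (Z w) (U w'))%:E = p%:E)%E); last first.
      rewrite -(orcp x (x + r *: Z w)) -[in RHS](setIT (U @^-1` _)) -integral_indic //.
        apply: eq_integral => w' _; rewrite hitE indicE; congr (_%:R%:E).
        by case: eqP => h; [rewrite mem_set|rewrite memNset].
      by rewrite -[X in measurable X]setTI; exact: mU.
    rewrite muleC.
    over.
  rewrite ge0_integralZl ?lee_fin //.
  - by apply/measurable_EFinP; have [] := bphiZ.
  - by move=> w _; rewrite lee_fin.
  - by rewrite -lee_fin -(orcp x x).
- exact: sigma_of_setI.
- exact: sigma_of_setI.
- exact: sigma_of_measurable.
- exact: sigma_of_measurable.
- apply/measurable_EFinP; apply: measurable_funM.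
    have mg : measurable_fun setT (fun w : g_sigma_algebraType F *
        g_sigma_algebraType G => (Z w.1, U w.2) : borel_rV R d * Xi).
      apply: measurable_fun_pair => //.
      exact: (measurableT_comp mUG measurable_snd).
    exact: (measurableT_comp mhit mg).
  by have [mphi _] := bphi; exact: (measurableT_comp mphi mZ1).
- by move=> w; rewrite lee_fin mulr_ge0.
Qed.

(** The answer is the true sign times [2 * hit - 1]. *)
Lemma expect_answer_dotp D :
  expect P (fun w => ans (Z w, U w) * (q * dotp (Z w) D)) =
  (2 * p - 1) * expect P (fun w => true_sign (Z w) * (q * dotp (Z w) D)).
Proof.
have bsZ := bounded_clip bounded_true_sign.
have bZ := bounded_dotp e1 unifZ.
pose F z := true_sign z * (q * dotp z D).
have bF : sphere_bounded e F.
  have := sphere_bounded_dotp e1; have := bounded_true_sign.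
  by rewrite /F /sphere_bounded; bounded.
have [_ [B FB]] := bF.
have B0 : 0 <= B by apply: le_trans (FB 0).
have bFZ := bounded_clip bF.
have bhit : bounded_rv (fun w => hit (Z w) (U w)) by rewrite /hit; bounded.
(* [expect_hit] applies to nonnegative functions only, so [F] is shifted by [B]. *)
have h1 := @expect_hit (fun z => F (clip e z) + B).
have h2 := @expect_hit (fun=> B).
have {}h1 : expect P (fun w => hit (Z w) (U w) * (F (Z w) + B)) =
    p * expect P (fun w => F (Z w) + B).
  have E : (fun w => F (Z w) + B) = (fun w => F (clip e (Z w)) + B).
    by apply/funext => w; rewrite clip_id.
  rewrite E -h1.
  - by congr expect; apply/funext => w; rewrite clip_id.
  - by bounded.
  - by move=> z; rewrite -lerBlDr sub0r; have := FB z; rewrite ler_norml => /andP[].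
have {}h2 : expect P (fun w => hit (Z w) (U w) * B) = p * B.
  by rewrite h2 ?expect_cst //; bounded.
have h3 : expect P (fun w => hit (Z w) (U w) * F (Z w)) = p * expect P (fun w => F (Z w)).
  move: h1; have -> : (fun w => hit (Z w) (U w) * (F (Z w) + B)) =
      (fun w => hit (Z w) (U w) * F (Z w) + hit (Z w) (U w) * B).
    by apply/funext => w; rewrite mulrDr.
  rewrite !expectD ?h2 ?expect_cst; [|by bounded..].
  by rewrite mulrDr => /addIr.
have -> : (fun w => ans (Z w, U w) * (q * dotp (Z w) D)) =
    (fun w => 2 * (hit (Z w) (U w) * F (Z w)) - F (Z w)).
  apply/funext => w; rewrite /hit /F.
  by case: (true_sign_cases (Z w)) => ->; field.
rewrite expectB ?expectZ ?h3; [|by bounded..].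
by rewrite /F; ring.
Qed.

End one_query.

(** * A misaligned estimate forces a large deviation *)

Section estimator_quality.
Variables (R : realType) (d : nat) (e : 'rV[R]_d).
Hypothesis e1 : l2norm e = 1.
Variables (dO : measure_display) (Omega : measurableType dO).
Variable P : probability Omega R.
Variables (dX : measure_display) (Xi : measurableType dX).
Variable orc : 'rV[R]_d -> 'rV[R]_d -> Xi -> R.
Hypothesis morc : measurable_fun [set: borel_rV R d * borel_rV R d * Xi]
  (fun q : borel_rV R d * borel_rV R d * Xi => orc q.1.1 q.1.2 q.2).
Hypothesis orc1 : forall x y u, orc x y u = -1 \/ orc x y u = 1.
Variables (r : R) (m : nat).
Variables (Z : 'I_m -> Omega -> 'rV[R]_d) (U : 'I_m -> Omega -> Xi).
Hypothesis unifZ : forall i, uniform_rv P (Z i).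
Hypothesis mU : forall i, measurable_fun setT (U i).
Hypothesis indepZU : forall i,
  indep_sets P (sigma_of (Z i : Omega -> borel_rV R d)) (sigma_of (U i)).
Hypothesis m0 : (0 < m)%N.

Variables (f : 'rV[R]_d -> R) (L s p delta : R) (sg0 : bool).
Hypothesis df : forall x, differentiable f x.
Hypothesis fL : forall x y, l2norm (grad f x - grad f y) <= L * l2norm (x - y).
Hypothesis cvxf : convex_function (E := 'rV[R]_d) [set: 'rV[R]_d] f.
Hypothesis L0 : 0 < L.
Hypothesis cg : forall x, l1norm (grad f x) <= Num.sqrt s * l2norm (grad f x).
Hypothesis orcp : forall i x y, P (U i @^-1` correct_answer sg0 f orc x y) = p%:E.
Hypothesis pdelta : 1 / 2 + delta <= p.
Hypothesis delta0 : 0 < delta.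
Hypothesis r0 : 0 < r.
Hypothesis s1 : 1 <= s.
Hypothesis sd : s < d%:R.

Let q : R := Num.sqrt d%:R.
Let Lam : R := s * ln (2 * d%:R / s).

Hypothesis mLam : 30 ^+ 4 * Lam <= m%:R * delta ^+ 2.

Let s0 : 0 < s.
Proof. exact: lt_le_trans ltr01 s1. Qed.
Let d0 : 0 < d%:R :> R.
Proof. exact: lt_trans sd. Qed.

Lemma ln2_ge_half : 1 / 2 <= ln 2 :> R.
Proof.
have := expR_ge1Dx (- ln 2 : R); rewrite expRN lnK ?posrE //; lra.
Qed.

Lemma log_split : Lam = s * ln 2 + s * - ln (s / d%:R).
Proof.
rewrite /Lam -mulrDr; congr (_ * _).
rewrite -lnV ?posrE ?divr_gt0 // -lnM ?posrE ?invr_gt0 ?divr_gt0 // invf_div.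
by rewrite mulrA.
Qed.

Lemma ln_ratio_le0 : 0 <= - ln (s / d%:R).
Proof. by rewrite oppr_ge0 ln_le0 // ler_pdivrMr // mul1r ltW. Qed.

Lemma Lam_ge : s <= 2 * Lam.
Proof.
rewrite log_split; have := ler_wpM2l (ltW s0) ln2_ge_half.
have := mulr_ge0 (ltW s0) ln_ratio_le0; lra.
Qed.

Let Lam0 : 0 < Lam.
Proof. by have := Lam_ge; have := s0; lra. Qed.

(* The threshold at which the exponential moment of the excess is at most [exp (8 s)]. *)
Let T : R := 1 / 4 - ln (s / d%:R).

Lemma threshold_ge0 : 0 <= T.
Proof. by rewrite /T; have := ln_ratio_le0; lra. Qed.

Lemma threshold_le : s * T <= Lam.
Proof.
rewrite log_split /T; have := ler_wpM2l (ltW s0) ln2_ge_half; have := s0; lra.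
Qed.

Lemma grad_dir_feasible x : grad f x != 0 ->
  l1norm (grad_dir f x) <= Num.sqrt s.
Proof.
move=> g0; have G0 : 0 < l2norm (grad f x).
  rewrite lt_def l2norm_ge0 andbT; apply: contra_neq g0; exact: l2norm_eq0.
rewrite /grad_dir l1normZ ger0_norm ?invr_ge0 ?l2norm_ge0 //.
by rewrite mulrC ler_pdivrMr.
Qed.

(** In expectation the direction of the gradient beats a misaligned candidate [g]
    in the objective of the estimator: the correlation of the true sign is scaled
    by [2 p - 1], which is at least [2 delta]. *)
Lemma mean_answer_margin i x g : grad f x != 0 -> l2norm g <= 1 ->
  3 * (q * (L * r)) <= 2 * l2norm (grad f x) ->
  dotp (grad_dir f x) g <= 1 / 3 ->
  delta / 15 <= dotp (mean_answer P orc r Z U i x) (grad_dir f x - g).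
Proof.
move=> gx g1 rG vg; have q0 : 0 < q by rewrite sqrtr_gt0.
have v1 : dotp (grad_dir f x) (grad_dir f x) = 1.
  by rewrite -sqr_l2norm l2norm_grad_dir // expr1n.
rewrite (dotp_mean_answer e1 morc orc1 r unifZ mU).
have cf : continuous f by move=> y; exact: differentiable_continuous.
rewrite (expect_answer_dotp e1 morc orc1 r (unifZ i) (mU i) (@indepZU i) cf (orcp i)).
have ts1 z : `|true_sign r sg0 f x z| <= 1 by rewrite norm_true_sign.
have ts_pos z : l2norm z = 1 -> 0 < dotp z (grad_dir f x) ->
    true_sign r sg0 f x z = 1.
  by move=> z1 zv; rewrite /true_sign /sgnpm subr_gt0 (sign_pos df fL cvxf r0 zv).
have ts_neg z : l2norm z = 1 -> q * dotp z (grad_dir f x) < - (1 / 3) ->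
    true_sign r sg0 f x z = -1.
  move=> z1 zv; have lt0 := sign_neg df fL L0 r0 q0 z1 rG zv.
  by rewrite /true_sign /sgnpm subr_gt0 subr_lt0 lt0 ltNge (ltW lt0).
have gg1 : dotp g g <= 1 by rewrite -sqr_l2norm expr_le1 // l2norm_ge0.
have h := expect_sign_correlation e1 (unifZ i) v1
  (bounded_true_sign e r sg0 cf x) ts1 ts_pos ts_neg gg1 vg.
have p1 : 2 * delta <= 2 * p - 1 by move: pdelta; lra.
have p0 : 0 <= 2 * p - 1 by apply: le_trans p1; rewrite mulr_ge0 // ltW.
apply: le_trans (ler_wpM2l p0 h); move: p1; lra.
Qed.

(** The direction [v] of the gradient is feasible, hence does not beat the
    maximizer [g], although it would by a margin [m delta / 15] if the answers
    were replaced by their means.  If the excess were below [17 Lam], the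
    deviation tested on [v] and on [g] would be of order [sqrt (m Lam)], too
    little to offset this margin when [m delta^2 >= 30^4 Lam]. *)
Lemma bad_estimate_excess (x : Omega -> 'rV[R]_d) w g : grad f (x w) != 0 ->
  3 * (q * (L * r)) <= 2 * l2norm (grad f (x w)) ->
  is_1bit_grad_est s (fun i => Z i w)
    (fun i => orc (x w) (x w + r *: Z i w) (U i w)) g ->
  dotp (grad_dir f (x w)) g <= 1 / 3 ->
  17 * Lam <= excess T (deviation P orc r Z U x w).
Proof.
move=> gx rG [[g1 g2] gmax] vg; rewrite leNgt; apply/negP => /ltW hexc.
set v := grad_dir f (x w) in vg; set H := deviation _ _ _ _ _ _ _ in hexc.
pose y := Num.sqrt Lam; pose n : R := Num.sqrt m%:R.
have y0 : 0 < y by rewrite sqrtr_gt0.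
have n0 : 0 < n by rewrite sqrtr_gt0 ltr0n.
have y2 : y ^+ 2 = Lam by rewrite sqr_sqrtr // ltW.
have n2 : n ^+ 2 = m%:R by rewrite sqr_sqrtr.
have v1 : l2norm v <= 1 by rewrite l2norm_grad_dir.
have vl1 := grad_dir_feasible gx; rewrite -/v in vl1.
have Hle h : l1norm h <= Num.sqrt s -> l2norm h <= 1 -> `|dotp H h| <= 12 * y.
  move=> h1 h2; apply: le_trans (norm_dotp_excess threshold_ge0 hexc h1 h2) _.
  have e1' : Num.sqrt T * Num.sqrt s <= y.
    rewrite -sqrtrM ?threshold_ge0 // ler_sqrt ?(ltW Lam0) //.
    by rewrite (mulrC T); exact: threshold_le.
  have e2 : Num.sqrt (17 * Lam) <= 5 * y.
    rewrite -ler_sqr ?nnegrE ?sqrtr_ge0 ?mulr_ge0 ?(ltW y0) //.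
    have L17 : 0 <= 17 * Lam by have := Lam0; lra.
    by rewrite (sqr_sqrtr L17) exprMn y2; have := Lam0; lra.
  lra.
have HD : - (24 * y) <= dotp H (v - g).
  rewrite dotpBr; have := Hle _ vl1 v1; have := Hle _ g1 g2.
  by rewrite !ler_norml => /andP[h1 h2] /andP[h3 h4]; lra.
pose b i : R := orc (x w) (x w + r *: Z i w) (U i w).
have win : \sum_(i < m) b i * (q * dotp (Z i w) (v - g)) <= 0.
  have := gmax v (conj vl1 v1).
  rewrite -subr_le0 -sumrB => h.
  have -> : \sum_(i < m) b i * (q * dotp (Z i w) (v - g)) =
      q * \sum_(i < m) (b i * dotp (Z i w) v - b i * dotp (Z i w) g).
    by rewrite mulr_sumr; apply: eq_bigr => i _; rewrite dotpBr; ring.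
  by rewrite mulr_ge0_le0 // sqrtr_ge0.
have margin : m%:R * (delta / 15) <=
    \sum_(i < m) dotp (mean_answer P orc r Z U i (x w)) (v - g).
  rewrite mulr_natl -[X in _ *+ X](card_ord m) -sumr_const.
  by apply: ler_sum => i _; exact: mean_answer_margin.
move: HD; rewrite /H dotp_deviation sumrB.
set A := \sum_(i < m) dotp _ _ in margin *.
rewrite (_ : \sum_(i < m) _ = \sum_(i < m) b i * (q * dotp (Z i w) (v - g))) //.
set B := \sum_(i < m) _ in win *.
rewrite (_ : Num.sqrt (4 * m%:R) = 2 * n); last first.
  rewrite sqrtrM // (_ : 4 = 2 ^+ 2 :> R) ?sqrtr_sqr ?ger0_norm //.
  by ring.
rewrite [leRHS]mulrC ler_pdivlMr ?mulr_gt0 // => HD.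
have h1 : n ^+ 2 * delta <= 15 * (48 * (y * n)).
  by rewrite n2; move: margin win HD; lra.
have h2 : n * delta <= 15 * (48 * y).
  rewrite -(ler_pM2l n0); apply: le_trans (_ : _ <= 15 * (48 * (y * n))) _.
    by apply: le_trans h1; rewrite expr2 mulrA.
  by rewrite le_eqVlt; apply/orP; left; apply/eqP; ring.
have h3 : 30 * 30 * y <= n * delta.
  rewrite -ler_sqr ?nnegrE ?mulr_ge0 ?(ltW y0) ?(ltW n0) ?(ltW delta0) //.
  rewrite !exprMn y2 n2; apply: le_trans mLam.
  by rewrite le_eqVlt; apply/orP; left; apply/eqP; ring.
move: h2 h3 y0; lra.
Qed.

End estimator_quality.

(** * One call of the gradient estimator *)

Section one_estimate.
Variables (R : realType) (d : nat).
Variables (dO : measure_display) (Omega : measurableType dO).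
Variable P : probability Omega R.
Variables (dX : measure_display) (Xi : measurableType dX).
Variable orc : 'rV[R]_d -> 'rV[R]_d -> Xi -> R.
Hypothesis morc : measurable_fun [set: borel_rV R d * borel_rV R d * Xi]
  (fun q : borel_rV R d * borel_rV R d * Xi => orc q.1.1 q.1.2 q.2).
Hypothesis orc1 : forall x y u, orc x y u = -1 \/ orc x y u = 1.
Variables (r : R) (m : nat).
Variables (Z : 'I_m -> Omega -> 'rV[R]_d) (U : 'I_m -> Omega -> Xi).
Hypothesis mZ : forall i, measurable_fun setT (Z i : Omega -> borel_rV R d).
Hypothesis unifZ : forall i,
  uniform_on_sphere (pushforward P (Z i : Omega -> borel_rV R d)).
Hypothesis mU : forall i, measurable_fun setT (U i).
Variable Hist : set (set Omega).
Hypothesis HistI : setI_closed Hist.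
Hypothesis HistT : Hist setT.
Hypothesis Histm : Hist `<=` measurable.
Hypothesis indepS : mutually_independent P (fun o : option ('I_m + 'I_m) =>
  match o with
  | None => Hist
  | Some (inl i) => sigma_of (Z i : Omega -> borel_rV R d)
  | Some (inr i) => sigma_of (U i)
  end).
Hypothesis m0 : (0 < m)%N.
Variables (f : 'rV[R]_d -> R) (L s p delta : R) (sg0 : bool).
Hypothesis df : forall x, differentiable f x.
Hypothesis fL : forall x y, l2norm (grad f x - grad f y) <= L * l2norm (x - y).
Hypothesis cvxf : convex_function (E := 'rV[R]_d) [set: 'rV[R]_d] f.
Hypothesis L0 : 0 < L.
Hypothesis cg : forall x, l1norm (grad f x) <= Num.sqrt s * l2norm (grad f x).
Hypothesis orcp : forall i x y, P (U i @^-1` correct_answer sg0 f orc x y) = p%:E.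
Hypothesis pdelta : 1 / 2 + delta <= p.
Hypothesis delta0 : 0 < delta.
Hypothesis r0 : 0 < r.
Hypothesis s1 : 1 <= s.
Hypothesis sd : s < d%:R.
Let Lam : R := s * ln (2 * d%:R / s).
Hypothesis mLam : 30 ^+ 4 * Lam <= m%:R * delta ^+ 2.
Variables (x g : Omega -> 'rV[R]_d).
Hypothesis mx : forall B : set (borel_rV R d), measurable B -> Hist (x @^-1` B).
Hypothesis gest : forall w, is_1bit_grad_est s (fun i => Z i w)
  (fun i => orc (x w) (x w + r *: Z i w) (U i w)) (g w).

Let d0 : (0 < d)%N.
Proof. by rewrite -(ltr_nat R); move: s1 sd; lra. Qed.
Let e : 'rV[R]_d := delta_mx 0 (Ordinal d0).
Let e1 : l2norm e = 1.
Proof. by rewrite l2normE dotp_delta mxE !eqxx sqrtr1. Qed.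
Let Z' i w := clip e (Z i w).

(** The exceptional event [N] consists of a large excess of the deviation, which
    has probability at most [exp (8 s - 17 Lam) <= exp (- Lam)] since
    [s <= 2 Lam], and of the null event that some direction is off the sphere.
    The failure of the estimate is covered by an event instead of being one, as
    the choice of the maximizer [g] may be arbitrary. *)
Lemma good_estimate : exists N : set Omega,
  [/\ measurable N, (P N <= (expR (- Lam))%:E)%E &
   forall w, ~ N w -> grad f (x w) != 0 ->
     3 * (Num.sqrt d%:R * (L * r)) <= 2 * l2norm (grad f (x w)) ->
     1 / 3 <= dotp (grad_dir f (x w)) (g w)].
Proof.
have unif' i : uniform_rv P (Z' i) by exact: uniform_clip.
have indep' : mutually_independent P (fun o : option ('I_m + 'I_m) =>
    match o with
    | None => Hist
    | Some (inl i) => sigma_of (Z' i : Omega -> borel_rV R d)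
    | Some (inr i) => sigma_of (U i)
    end).
  apply: mutually_independent_sub indepS => -[[i|i]|] //; exact: sigma_of_clip.
have indepZU i : indep_sets P (sigma_of (Z' i : Omega -> borel_rV R d))
    (sigma_of (U i)).
  set S := (fun o : option ('I_m + 'I_m) => _) in indep'.
  have Sm o : S o `<=` measurable.
    case: o => [[j|j]|] //; last exact: sigma_of_measurable.
    by apply: sigma_of_measurable; case: (unif' j).
  have ST o : S o setT.
    by case: o => [[j|j]|] //; exact: sigma_of_setT.
  move=> A B ZA UB.
  apply: (indep_cylinders Sm indep' (K := [set (Some (inl i))]%SET)
    (K' := [set (Some (inr i))]%SET)).
  - by move=> o; rewrite !inE => /eqP ->.
  - by apply: (cylinders_one ST (i := Some (inl i))) => //; rewrite inE.
  - by apply: (cylinders_one ST (i := Some (inr i))) => //; rewrite inE.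
pose T : R := 1 / 4 - ln (s / d%:R).
pose N0 := [set w | (17 * Lam <= excess T (deviation P orc r Z' U x w))%R].
have [N1 [mN1 PN1 sphere]] : {ae P, forall w, forall i, l2norm (Z i w) = 1}.
  apply: filter_forall => i; exists (~` (Z i @^-1` [set z | l2norm z = 1])).
  have mS : measurable (Z i @^-1` [set z | l2norm z = 1]).
    rewrite -[X in measurable X]setTI.
    by apply: (@mZ i) => //; exact: measurable_unit_sphere.
  split; [exact: measurableC| |by []].
  have [PS _] := unifZ i.
  by rewrite probability_setC // [X in (1 - X)%E]PS subee.
have mN0 : measurable N0.
  apply: (measurable_bool_set (b := fun w =>
    (17 * Lam <= excess T (deviation P orc r Z' U x w))%R)).
  apply: measurable_fun_ler => //.
  exact: (measurable_excess e1 morc orc1 r unif' mU Histm mx).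
have sd0 : 0 < s / d%:R.
  by rewrite divr_gt0 ?ltr0n //; move: s1; lra.
have PN0 : (P N0 <= (expR (- Lam))%:E)%E.
  have := deviation_tail e1 morc orc1 r unif' mU HistI HistT Histm indep' m0
    mx (17 * Lam) sd0.
  move=> h; apply: le_trans h _; rewrite lee_fin ler_expR.
  rewrite -mulrA divfK; last by rewrite pnatr_eq0 -lt0n.
  have := Lam_ge s1 sd; rewrite -/Lam; lra.
exists (N0 `|` N1); split; [exact: measurableU|by rewrite measureU0|].
move=> w /not_orP[nN0 nN1] gx rG; rewrite leNgt; apply/negP => vg.
have w1 i : l2norm (Z i w) = 1.
  by apply: contrapT => h; apply: nN1; apply: sphere => /(_ i).
have ZZ' : (fun i => Z' i w) = (fun i => Z i w).
  by apply/funext => i; rewrite /Z' clip_id.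
apply: nN0; apply: (bad_estimate_excess e1 morc orc1 unif' mU _ m0 df fL cvxf
  L0 cg orcp pdelta delta0 r0 s1 sd mLam gx rG _ (ltW vg)) => //.
pose est z := is_1bit_grad_est s z
  (fun i => orc (x w) (x w + r *: z i) (U i w)) (g w).
by rewrite -[is_1bit_grad_est _ _ _ _]/(est (fun i => Z' i w)) ZZ'; exact: gest.
Qed.

End one_estimate.

(** * The whole run *)

Lemma natceil_ge (R : realType) (t : R) : t <= (natceil t)%:R.
Proof.
have h : 0 <= Num.ceil (Num.max t 0).
  by rewrite ceil_ge0 (lt_le_trans (ltrN10 _)) // le_max lexx orbT.
rewrite /natceil natr_absz ger0_norm //.
by apply: le_trans (ceil_ge _); rewrite le_max lexx.
Qed.

Lemma union_bound (R : realType) (dO : measure_display)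
    (Omega : measurableType dO) (P : probability Omega R) (K : nat) (a : R)
    (A : nat -> set Omega) :
  (forall k, (k < K)%N -> measurable (A k)) ->
  (forall k, (k < K)%N -> exists N : set Omega,
    [/\ measurable N, (P N <= a%:E)%E & ~` N `<=` A k]) ->
  ((1 - K%:R * a)%:E <= P [set w | forall k, (k < K)%N -> A k w])%E.
Proof.
move=> mA hN.
have hN' k : exists N : set Omega, (k < K)%N ->
    [/\ measurable N, (P N <= a%:E)%E & ~` N `<=` A k].
  by case: (ltnP k K) => [/hN[N ?]|_]; [exists N|exists set0].
have {hN'}[N hN'] := choice hN'.
pose V := \big[setU/set0]_(k < K) N k.
have mV : measurable V.
  by apply: bigsetU_measurable => k _; case: (hN' k).
have PV : (P V <= (K%:R * a)%:E)%E.
  apply: le_trans (Boole_inequality P (A := N) (n := K) _) _.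
    by move=> k /hN'[].
  rewrite mulr_natl -[X in _ *+ X](card_ord K) -sumr_const -sumEFin.
  by apply: lee_sum => k _; have [] := hN' k.
apply: (@le_trans _ _ (P (~` V))).
  rewrite probability_setC // EFinB leeB //.
apply: le_measure; rewrite ?inE.
- exact: measurableC.
- rewrite (_ : [set w | _] = \bigcap_(k in `I_K) A k); last by [].
  by apply: fin_bigcap_measurable => //; exact: finite_II.
move=> w Vw k kK; have [_ _] := hN' k kK; apply => Nw; apply: Vw.
by rewrite /V -(bigcup_mkord K N); exists k.
Qed.

Section measurability_of_iterates.
Variables (R : realType) (d : nat) (dO : measure_display).
Variable Omega : measurableType dO.
Variables (g x : nat -> Omega -> 'rV[R]_d) (x0 : 'rV[R]_d) (alpha : nat -> R).

Lemma measurable_iterate (G : set (set Omega)) k :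
  (forall j, (j < k)%N -> sigma_of (g j : Omega -> borel_rV R d) `<=` <<s G >>) ->
  (forall w, x 0%N w = x0) ->
  (forall j w, (j < k)%N -> x j.+1 w = x j w - alpha j *: g j w) ->
  measurable_fun setT (x k : g_sigma_algebraType G -> borel_rV R d).
Proof.
elim: k => [|k IH] gG x_0 xS.
  have -> : x 0%N = cst x0 by apply/funext => w; rewrite x_0.
  exact: measurable_cst.
have {}IH : measurable_fun setT (x k : g_sigma_algebraType G -> borel_rV R d).
  by apply: IH => // [j jk|j w jk]; [apply: gG|apply: xS]; exact: ltnW.
have mg : measurable_fun setT (g k : g_sigma_algebraType G -> borel_rV R d).
  by move=> _ B mB; apply: (gG k) => //; exists B.
apply: measurable_rV => i.
have -> : (fun w => x k.+1 w 0 i) = (fun w => x k w 0 i - alpha k * g k w 0 i).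
  by apply/funext => w; rewrite xS // !mxE.
apply: measurable_funB.
  exact: (measurableT_comp (measurable_coord i) IH).
by apply: measurable_funM => //; exact: (measurableT_comp (measurable_coord i) mg).
Qed.

End measurability_of_iterates.

Section history_of_a_run.
Variables (R : realType) (d : nat).
Variables (dO : measure_display) (Omega : measurableType dO).
Variables (dX : measure_display) (Xi : measurableType dX).
Variables (P : probability Omega R) (Q : probability Xi R).
Variable orc : 'rV[R]_d -> 'rV[R]_d -> Xi -> R.
Variables (x0 : 'rV[R]_d) (s : R) (m : nat) (r : R) (K : nat) (alpha : nat -> R).
Variables (z : nat -> 'I_m -> Omega -> 'rV[R]_d) (xi : nat -> 'I_m -> Omega -> Xi).
Variables (g x : nat -> Omega -> 'rV[R]_d).
Hypothesis run : SCOBO_run P Q orc x0 s r K alpha z xi g x.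

Lemma history_setI k : setI_closed (history z xi g k).
Proof. exact: (@measurableI _ (g_sigma_algebraType _)). Qed.

Lemma history_setT k : history z xi g k setT.
Proof. exact: (@measurableT _ (g_sigma_algebraType _)). Qed.

Lemma history_measurable k : (k <= K)%N -> history z xi g k `<=` measurable.
Proof.
move=> kK; apply: smallest_sub; first exact: sigma_algebra_measurable.
move=> A [j jk]; have jK := leq_trans jk kK.
case=> [[i]|[i]|]; apply: sigma_of_measurable.
- exact: (run_measurable_z run).
- exact: (run_measurable_xi run).
- exact: (run_measurable_g run).
Qed.

(** An iterate is a function of the outputs of the earlier calls. *)
Lemma history_iterate k (B : set (borel_rV R d)) : (k <= K)%N ->
  measurable B -> history z xi g k (x k @^-1` B).
Proof.
move=> kK mB; rewrite -[X in history _ _ _ _ X]setTI.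
apply: (measurable_iterate (k := k) (x0 := x0) (alpha := alpha)
  (g := g)) mB => //.
- move=> j jk A gA; apply: sub_sigma_algebra; exists j => //.
  by constructor 3.
- exact: (run_init run).
- by move=> j w jk; apply: (run_step run); exact: leq_trans kK.
Qed.

Lemma measurable_run k : (k <= K)%N ->
  measurable_fun setT (x k : Omega -> borel_rV R d).
Proof.
move=> kK _ B mB; rewrite setTI; apply: (history_measurable kK).
exact: history_iterate.
Qed.

End history_of_a_run.

Theorem corollary5p2 (R : realType) :
  exists C c : R, [/\ 0 < C, 0 < c &
  forall (d : nat) (s L nu : R) (f : 'rV[R]_d -> R),
    0 < s -> s < d%:R ->
    0 < nu -> nu <= L -> nu / (2 * L) <= 1 / 2 ->
    Fclass L nu f -> CG s f ->
  forall (dX : measure_display) (Xi : measurableType dX)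
    (Q : probability Xi R) (orc : 'rV[R]_d -> 'rV[R]_d -> Xi -> R)
    (sg0 : bool) (delta0 mu : R),
    0 < delta0 -> delta0 < mu -> mu <= 1 / 2 ->
    polynomial_comparison_oracle sg0 Q orc f delta0 mu 1 ->
    constant_correctness sg0 Q orc f ->
  forall (eps eta : R) (x0 : 'rV[R]_d),
    0 < eps -> 0 < eta -> eta < nu / (2 * L) ->
  let Delta0 := l2norm (x0 - Pstar f x0) in
  let rhostar := (1 - eta ^+ 2) / (nu / (2 * L) - eta) in
  let alpha := (1 + rhostar)^-1 * Num.sqrt (2 * eps / L) in
  let K := natceil ((Delta0 - alpha * eta) ^+ 3 /
    ((alpha * rhostar) ^+ 2 * (alpha * nu / (2 * L) - alpha * eta))) in
  let m := natceil (C / (eta ^+ 4 * delta0 ^+ 2) * (s * ln (2 * d%:R / s))) in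
  let r := alpha * nu * rhostar / (2 * L * Num.sqrt d%:R) in
  forall (dO : measure_display) (Omega : measurableType dO)
    (P : probability Omega R)
    (z : nat -> 'I_m -> Omega -> 'rV[R]_d)
    (xi : nat -> 'I_m -> Omega -> Xi)
    (g x : nat -> Omega -> 'rV[R]_d),
    SCOBO_run P Q orc x0 s r K (fun=> alpha) z xi g x ->
    ((1 - 8 * K%:R * expR (- (c * eta ^+ 4 * (s * ln (2 * d%:R / s)))))%:E
      <= P [set w | forall k, (k < K)%N ->
              (f (x k.+1 w) <= f (x k w))%R \/
              (f (x k w) - fstar f <= eps)%R])%E].
Proof.
exists (30 ^+ 4), 1; split => //.
move=> d s L nu f s0 sd nu0 nuL cond [[df _ _] cvxf [_ fL] fmin rsc] [_ cg].
move=> dX Xi Q orc sg0 delta0 mu del0 delmu mu_half [_ morc orc1 acc] [p Qp].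
move=> eps eta x0 eps0 eta0 etanu Delta0 rhostar alpha K m r dO Omega P.
move=> z xi g x run.
set Lam := s * ln (2 * d%:R / s) in m z xi run *.
have L0 : 0 < L := lt_le_trans nu0 nuL.
have alpha0 : 0 < alpha := alpha_gt0 nu0 L0 cond eps0 eta0 etanu.
have cf : continuous f by move=> y; exact: differentiable_continuous.
(* A nonzero gradient forces [1 <= s]; without one, [f] is constant. *)
have [flat|[y gy]] : (forall y, grad f y = 0) \/ exists y, grad f y != 0.
  have [h|h] := pselect (exists y, grad f y != 0); [by right|left=> y].
  by apply/eqP; apply: contrapT => /negP gy; apply: h; exists y.
  rewrite (_ : [set w | _] = setT) ?probability_setT.
    by rewrite lee_fin gerBl !mulr_ge0 // expR_ge0.
  apply/seteqP; split => // w _ k kK; left.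
  apply: le_trans (tangent_le df fL cvxf (x k.+1 w) (x k w)).
  by rewrite flat dotp0l addr0.
have s1 : 1 <= s.
  have G0 : 0 < l2norm (grad f y).
    rewrite lt_def l2norm_ge0 andbT; apply: contra_neq gy; exact: l2norm_eq0.
  have := le_trans (l2norm_le_l1norm (grad f y)) (cg y).
  rewrite ler_pMl // -[X in X <= Num.sqrt s]sqrtr1 ler_sqrt //; exact: ltW.
have Lam0 : 0 < Lam by have := Lam_ge s1 sd; rewrite -/Lam; lra.
have eta4 : eta ^+ 4 <= 1.
  by apply: exprn_ile1; [exact: ltW|move: etanu cond; lra].
have eta4_0 : 0 < eta ^+ 4 by rewrite exprn_gt0.
have mLam : 30 ^+ 4 * Lam <= m%:R * delta0 ^+ 2.
  have del2 : 0 < delta0 ^+ 2 by rewrite exprn_gt0.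
  rewrite -ler_pdivrMr //; apply: le_trans (natceil_ge _).
  rewrite [leRHS]mulrAC ler_wpM2l //; first by rewrite mulr_ge0 ?exprn_ge0 // ltW.
  by rewrite lef_pV2 ?posrE ?mulr_gt0 // ler_piMl // ltW.
have m0 : (0 < m)%N.
  rewrite lt0n; apply: contraTneq mLam => ->.
  by rewrite mul0r -ltNge mulr_gt0 // exprn_gt0.
have q0 : 0 < Num.sqrt d%:R :> R by rewrite sqrtr_gt0 (lt_trans s0).
have r0 : 0 < r.
  have rho0 : 0 < rhostar := rhostar_gt0 nu0 L0 cond eta0 etanu.
  apply: divr_gt0; apply: mulr_gt0 => //; exact: mulr_gt0.
(* For [kappa = 1] the bound on the oracle is the same at all pairs of points. *)
have pdelta : 1 / 2 + delta0 <= p.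
  have := acc 0 0; rewrite Qp lee_fin (subrr 1) powRr0 mulr1.
  by rewrite min_l // ltW.
have mfx k : (k <= K)%N -> measurable_fun setT (fun w => f (x k w)).
  move=> kK; apply: (measurableT_comp (f := f : borel_rV R d -> R)).
    exact: continuous_measurable_rV.
  exact: (measurable_run run).
apply: (@le_trans _ _ (1 - K%:R * expR (- Lam))%:E).
  rewrite lee_fin lerD2l lerN2 mul1r -mulrA mulrCA ler_wpM2l //.
  apply: (@le_trans _ _ (expR (- (eta ^+ 4 * Lam)))).
    by rewrite ler_expR lerN2 ler_piMl // ltW.
  by rewrite ler_peMl ?expR_ge0 // ler1n.
apply: (union_bound (A := fun k => [set w | f (x k.+1 w) <= f (x k w) \/
  f (x k w) - fstar f <= eps])) => k kK.
  rewrite (_ : [set w | _] = [set w | (f (x k.+1 w) <= f (x k w)) ||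
    (f (x k w) - fstar f <= eps)]); last first.
    by apply/seteqP; split => w /orP.
  apply: (measurable_bool_set (b := fun w => (f (x k.+1 w) <= f (x k w)) ||
    (f (x k w) - fstar f <= eps))).
  apply: measurable_or.
    by apply: measurable_fun_ler; apply: mfx => //; exact: ltnW.
  apply: measurable_fun_ler => //; apply: measurable_funB => //.
  by apply: mfx; exact: ltnW.
have xip i a b : P (xi k i @^-1` correct_answer sg0 f orc a b) = p%:E.
  rewrite -(Qp a b) -(run_law_xi run i kK) //.
  exact: measurable_correct_answer.
have hI : setI_closed (history z xi g k) by exact: history_setI.
have hT : history z xi g k setT by exact: history_setT.
have hx (B : set (borel_rV R d)) : measurable B -> history z xi g k (x k @^-1` B).
  exact: (history_iterate run (ltnW kK)).
have [N [mN PN good]] := good_estimate morc orc1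
  (fun i => run_measurable_z run i kK) (fun i => run_law_z run i kK)
  (fun i => run_measurable_xi run i kK)
  hI hT (history_measurable run (ltnW kK)) (run_independent run kK) m0
  df fL cvxf L0 cg xip pdelta del0 r0 s1 sd mLam
  hx (fun w => run_grad_est run w kK).
exists N; split=> // w /good gw /=.
have [|far] := leP (f (x k w) - fstar f) eps; [by right|left].
have G := grad_lower_bound df fL cvxf L0 nu0 eps0 fmin rsc far.
have gx : grad f (x k w) != 0.
  apply: contraTneq G => ->; rewrite -ltNge /l2norm big1 ?sqrtr0 ?mulr0.
    by rewrite mulr_gt0 // sqrtr_gt0 divr_gt0 // mulr_gt0.
  by move=> i _; rewrite mxE expr0n.
rewrite (run_step run) //; apply: (step_decreases df fL L0 (ltW alpha0)).
- by have [[]] := run_grad_est run w kK.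
- exact: (alpha_small nu0 L0 cond eta0 etanu G).
- by apply: gw => //; exact: (radius_small nu0 L0 cond eta0 etanu q0 G).
Qed.
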